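(* Let $P u=\partial_t u-a^{ij}(t,x)D_{ij}u$ on $\mathbb{R}^{d+1}$, where the coefficient matrix $\mathbf{A}=(a^{ij}(t,x))$ is symmetric and satisfies $\lambda|\xi|^2\le a^{ij}(t,x)\xi_i\xi_j\le\Lambda|\xi|^2$ for all $\xi\in\mathbb{R}^d$ and all $(t,x)\in\mathbb{R}^{d+1}$, with constants $0<\lambda\le\Lambda<\infty$. Suppose that the formal adjoint operator $P^*v=-\partial_t v-D_{ij}(a^{ij}(t,x)v)$ satisfies the local boundedness property. Given $T>0$, let $N_0$ be the constant associated with $R_0=\sqrt{T}$ in the local boundedness property. Then the fundamental solution $\Gamma(t,x,s,y)$ of $P$ satisfies the upper Gaussian bound: for any $x,y\in\mathbb{R}^d$ and $t,s\in\mathbb{R}$ such that $0<t-s<T$, $$\Gamma(t,x,s,y)\le\frac{N}{(t-s)^{d/2}}\exp\left\{-\kappa\frac{|x-y|^2}{t-s}\right\},$$ where $\kappa>0$ is a constant depending only on $\Lambda$, and $N>0$ is a constant depending only on $d,\lambda,\Lambda,N_0$.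
   Context: Summation over repeated indices $i,j=1,\dots,d$ is understood. $B_\rho(x_0)$ is the open ball in $\mathbb{R}^d$ of radius $\rho$ centered at $x_0$, and for $X_0=(t_0,x_0)\in\mathbb{R}^{d+1}$ and $\rho>0$, $$C_\rho(X_0)=(t_0,t_0+\rho^2)\times B_\rho(x_0).$$ The symbol $⨍$ denotes the average over the indicated set. Local boundedness property: $P^*$ satisfies the local boundedness property for solutions if, for any solution $u$ of $P^*u=0$ in $C_{2r}(X_0)$, where $X_0=(t_0,x_0)\in\mathbb{R}^{d+1}$ and $0<r<R_0$, the estimate $$\sup_{C_r(X_0)}|u|\le N_0\,\frac{1}{|C_{2r}(X_0)|}\int_{C_{2r}(X_0)}|u(t,x)|\,dx\,dt$$ holds. Here $N_0>0$ may depend on $R_0$, but it is uniform for all $r\in(0,R_0)$ and $X_0\in\mathbb{R}^{d+1}$, and is independent of $u$. Fundamental solution: a fundamental solution $\Gamma(t,x,s,y)$ for $P$ is a function satisfying $P\Gamma(\cdot,\cdot,s,y)=\delta_{s,y}$ in $\mathbb{R}^{d+1}$, or equivalently $P\Gamma(\cdot,\cdot,s,y)=0$ in $(s,\infty)\times\mathbb{R}^d$ and $\lim_{t\searrow s}\Gamma(t,\cdot,s,y)=\delta_y$ on $\mathbb{R}^d$. As usual, $\Gamma$ is the nonnegative fundamental solution with $\Gamma=0$ for $t<s$; for bounded initial data $f$ (such as indicator functions of balls), $u(t,x)=\int_{\mathbb{R}^d}\Gamma(t,x,\tau,z)f(z)\,dz$ is the bounded solution of $Pu=0$ in $(\tau,\infty)\times\mathbb{R}^d$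 with $u(\tau,\cdot)=f$; and for fixed $(t,x)$ the function $(s,y)\mapsto\Gamma(t,x,s,y)$ solves $P^*\Gamma(t,x,\cdot,\cdot)=0$ in $(-\infty,t)\times\mathbb{R}^d$. Conventions: the equation $P^*u=0$ is understood in the sense of distributions (the $a^{ij}$ are not assumed differentiable). Since adjoint solutions are a priori defined up to null sets, suprema and infima of them are essential, and pointwise inequalities for $\Gamma$ are understood with the usual choice of representative of $\Gamma(t,x,\cdot,\cdot)$. *)

(* Defs.v *)
From HB Require Import structures.
From mathcomp Require Import all_boot all_order all_algebra.
From mathcomp Require Import all_classical all_reals all_analysis.
From mathcomp Require Import ess_sup_inf.

Set Implicit Arguments.
Unset Strict Implicit.
Unset Printing Implicit Defensive.

Import Order.TTheory GRing.Theory Num.Theory.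
Import numFieldNormedType.Exports.

Local Open Scope classical_set_scope.
Local Open Scope ring_scope.

(* Points of R^d are row vectors 'rV[R]_d, points of R^(d+1) are pairs (t, x).
   The library norm on 'rV[R]_d is the sup norm; it is used only through the
   topology. Lengths and balls are Euclidean ([enorm], [eball]). *)

Definition rV_display : measure_display -> measure_display.
Proof. exact. Qed.

Section measurable_rV.
Context {R : realType}.
Variable n : nat.

Let coors : 'I_n -> 'rV[R]_n -> R := fun i x => x ord0 i.

Let rV_set0 : g_sigma_preimage coors set0.
Proof. exact: sigma_algebra0. Qed.

Let rV_setC A : g_sigma_preimage coors A -> g_sigma_preimage coors (~` A).
Proof. exact: sigma_algebraC. Qed.

Let rV_bigcup (F : (set 'rV[R]_n)^nat) :
  (forall i, g_sigma_preimage coors (F i)) ->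
  g_sigma_preimage coors (\bigcup_i (F i)).
Proof. exact: sigma_algebra_bigcup. Qed.

(* The sigma-algebra generated by the coordinates, that is, the Borel one. *)
HB.instance Definition _ := @isMeasurable.Build (rV_display default_measure_display)
  'rV[R]_n (g_sigma_preimage coors) rV_set0 rV_setC rV_bigcup.

End measurable_rV.

Section rV_cons.
Context {R : realType}.
Variable n : nat.

Definition rV_cons (p : R * 'rV[R]_n) : 'rV[R]_n.+1 :=
  \row_i (if unlift ord0 i is Some j then p.2 ord0 j else p.1).

Definition rV_uncons (x : 'rV[R]_n.+1) : R * 'rV[R]_n :=
  (x ord0 ord0, \row_j x ord0 (lift ord0 j)).

Lemma rV_consK : cancel rV_cons rV_uncons.
Proof.
move=> [a z]; rewrite /rV_uncons /rV_cons mxE unlift_none; congr (_, _).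
by apply/rowP => j; rewrite !mxE liftK.
Qed.

End rV_cons.

Section measurable_rV_lemmas.
Context {R : realType}.

Lemma measurable_coord n (i : 'I_n) :
  measurable_fun [set: 'rV[R]_n] (fun x => x ord0 i).
Proof.
move=> _ Y mY; rewrite setTI; apply: sub_sigma_algebra => /=.
rewrite -bigcup_seq/=; exists i => /=; first by rewrite mem_index_enum.
by exists Y => //; rewrite setTI.
Qed.

Lemma measurable_fun_rV d (T : measurableType d) n (f : T -> 'rV[R]_n) :
  (forall i, measurable_fun [set: T] (fun t => f t ord0 i)) ->
  measurable_fun [set: T] f.
Proof.
move=> mf _ A mA; rewrite setTI.
suff: (measurable : set (set 'rV[R]_n)) `<=` [set B | measurable (f @^-1` B)].
  exact.
apply: smallest_sub => /=.
  split => /=.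
  - by rewrite preimage_set0.
  - by move=> B mB; rewrite setTD preimage_setC; exact: measurableC.
  - by move=> F mF; rewrite preimage_bigcup; exact: bigcup_measurable.
rewrite -bigcup_seq => B [i _ [Y mY <-]] /=.
rewrite setTI; have := mf i measurableT Y mY; rewrite setTI.
by [].
Qed.

Lemma measurable_rV_cons n : measurable_fun setT (@rV_cons R n).
Proof.
apply: measurable_fun_rV => i.
case: (unliftP ord0 i) => [j ->|->].
  rewrite (_ : (fun _ => _) = (fun x : 'rV[R]_n => x ord0 j) \o snd).
    by apply: measurableT_comp => //; exact: measurable_coord.
  by apply/funext => p /=; rewrite mxE liftK.
rewrite (_ : (fun _ => _) = fst) //.
by apply/funext => p /=; rewrite mxE unlift_none.
Qed.

Lemma measurable_rV_uncons n : measurable_fun setT (@rV_uncons R n).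
Proof.
apply/measurable_fun_pairP; split; first exact: measurable_coord.
apply: measurable_fun_rV => i.
apply: (eq_measurable_fun (fun x : 'rV[R]_n.+1 => x ord0 (lift ord0 i))).
  by move=> x _; rewrite mxE.
exact: measurable_coord.
Qed.

End measurable_rV_lemmas.

Section leb_succ.
Context {R : realType}.
Variables (n : nat) (m : {sigma_finite_measure set 'rV[R]_n -> \bar R}).
Local Open Scope ereal_scope.

Definition leb_succ : set 'rV[R]_n.+1 -> \bar R :=
  pushforward (@lebesgue_measure R \x m) (@rV_cons R n).

Let leb_succ0 : leb_succ set0 = 0.
Proof. by rewrite /leb_succ /pushforward preimage_set0 measure0. Qed.

Let leb_succ_ge0 A : 0 <= leb_succ A.
Proof. by rewrite /leb_succ /pushforward; exact: measure_ge0. Qed.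

Let mpre A : measurable A -> measurable (@rV_cons R n @^-1` A).
Proof.
by move=> mA; rewrite -[X in measurable X]setTI; exact: measurable_rV_cons.
Qed.

Let leb_succ_sigma_additive : semi_sigma_additive leb_succ.
Proof.
move=> F mF tF mUF; rewrite /leb_succ /pushforward preimage_bigcup.
apply: measure_semi_sigma_additive.
- by move=> k; exact: mpre.
- apply/trivIsetP => /= i j _ _ ij; rewrite -preimage_setI.
  by move/trivIsetP : tF => /(_ _ _ _ _ ij) ->//; rewrite preimage_set0.
- by rewrite -preimage_bigcup; exact: mpre.
Qed.

HB.instance Definition _ := isMeasure.Build _ _ _ leb_succ
  leb_succ0 leb_succ_ge0 leb_succ_sigma_additive.

Let leb_succ_sigma_finite : sigma_finite setT leb_succ.
Proof.
have /sigma_finiteP[F [TF ndF Foo]] := sigma_finiteT (@lebesgue_measure R).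
have /sigma_finiteP[G [TG ndG Goo]] := sigma_finiteT m.
exists (fun k => @rV_uncons R n @^-1` (F k `*` G k)).
  rewrite -preimage_bigcup -[LHS](preimage_setT (@rV_uncons R n)).
  congr (_ @^-1` _); apply/esym; rewrite -subTset => -[x y] _.
  have [i _ Fx] : (\bigcup_i F i) x by rewrite -TF.
  have [j _ Gy] : (\bigcup_j G j) y by rewrite -TG.
  exists (maxn i j) => //; split.
  - by move: x Fx; exact/subsetPset/ndF/leq_maxl.
  - by move: y Gy; exact/subsetPset/ndG/leq_maxr.
move=> k; have [mF Fk] := Foo k; have [mG Gk] := Goo k; split.
  by rewrite -[X in measurable X]setTI; apply: measurable_rV_uncons => //;
    exact: measurableX.
rewrite /leb_succ /pushforward -comp_preimage.
rewrite (_ : _ \o _ = id) ?preimage_id; last first.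
  by apply/funext => p /=; exact: rV_consK.
by rewrite product_measure1E// lte_mul_pinfty// ge0_fin_numE.
Qed.

HB.instance Definition _ := Measure_isSigmaFinite.Build _ _ _ leb_succ
  leb_succ_sigma_finite.

End leb_succ.

(* d-dimensional Lebesgue measure, as an iterated product. *)
Fixpoint leb {R : realType} (d : nat) :
    {sigma_finite_measure set 'rV[R]_d -> \bar R} :=
  match d with
  | 0%N => \d_(0 : 'rV[R]_0)
  | d'.+1 => leb_succ (leb d')
  end.

Definition stleb {R : realType} (d : nat) :
    {measure set (measurableTypeR R * 'rV[R]_d) -> \bar R} :=
  (@lebesgue_measure R \x leb d)%E.

Section geometry.
Context {R : realType} {d : nat}.

Definition enorm (x : 'rV[R]_d) : R := Num.sqrt (\sum_i x ord0 i ^+ 2).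

Definition eball (x0 : 'rV[R]_d) (rho : R) : set 'rV[R]_d :=
  [set x | enorm (x - x0) < rho].

Definition cylinder (X0 : R * 'rV[R]_d) (rho : R) : set (R * 'rV[R]_d) :=
  `]X0.1, X0.1 + rho ^+ 2[%classic `*` eball X0.2 rho.

End geometry.

Section test_functions.
Context {R : realType} {V : normedModType R}.

Fixpoint iter_derive (vs : seq V) (f : V -> R) : V -> R :=
  if vs is v :: vs' then 'D_v (iter_derive vs' f) else f.

Definition smooth (f : V -> R) : Prop := forall vs : seq V,
  continuous (iter_derive vs f) /\
  forall x v, derivable (iter_derive vs f) x v.

Definition test_function (U : set V) (f : V -> R) : Prop :=
  smooth f /\
  exists K, [/\ compact K, K `<=` U & forall x, ~ K x -> f x = 0].

End test_functions.

Section equations.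
Context {R : realType} {d : nat}.
Local Notation space := 'rV[R]_d.
Local Notation spacetime := (R * 'rV[R]_d)%type.
Implicit Types (a : spacetime -> 'M[R]_d) (U : set spacetime).

Definition dir_t : spacetime := (1, 0).
Definition dir_x (i : 'I_d) : spacetime := (0, delta_mx ord0 i).

Definition elliptic (lambda Lambda : R) a : Prop :=
  [/\ forall i j, measurable_fun [set: spacetime] (fun X => a X i j),
      forall X i j, a X i j = a X j i
    & forall X (xi : space),
        lambda * enorm xi ^+ 2
          <= \sum_i \sum_j a X i j * xi ord0 i * xi ord0 j
          <= Lambda * enorm xi ^+ 2].

Definition Lp_loc (p : nat) U (g : spacetime -> R) : Prop :=
  measurable_fun U g /\
  forall K, compact K -> K `<=` U ->
    (\int[stleb d]_(X in K) (`|g X| ^+ p)%R%:E < +oo)%E.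

Definition weak_derivative U (v : spacetime) (u g : spacetime -> R) : Prop :=
  forall phi, test_function U phi ->
    \int[stleb d]_(X in U) (u X * 'D_v phi X)
      = - \int[stleb d]_(X in U) (g X * phi X).

(* P u = 0 in U, in the strong sense: u is (the continuous representative of)
   a function of the parabolic Sobolev space W^{1,2}_{d+1,loc}(U), and the
   equation holds almost everywhere in U. Here [ut], [Du i] and [D2u i j] are
   the weak derivatives of u. *)
Definition strong_solution a U (u : spacetime -> R) : Prop :=
  (forall X, U X -> {for X, continuous u}) /\
  exists (ut : spacetime -> R) (Du : 'I_d -> spacetime -> R)
         (D2u : 'I_d -> 'I_d -> spacetime -> R),
    [/\ [/\ Lp_loc d.+1 U u, Lp_loc d.+1 U ut,
            forall i, Lp_loc d.+1 U (Du i)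
          & forall i j, Lp_loc d.+1 U (D2u i j)],
        weak_derivative U dir_t u ut,
        forall i, weak_derivative U (dir_x i) u (Du i),
        forall i j, weak_derivative U (dir_x i) (Du j) (D2u i j)
      & {ae stleb d, forall X, U X ->
          ut X - \sum_i \sum_j a X i j * D2u i j X = 0}].

Definition P_smooth a (phi : spacetime -> R) (X : spacetime) : R :=
  'D_dir_t phi X - \sum_i \sum_j a X i j * 'D_(dir_x i) ('D_(dir_x j) phi) X.

(* P^* u = 0 in U in the sense of distributions: for
   P^* v = - d_t v - D_ij (a^ij v), the pairing <P^* u, phi> is
   the integral of u * P phi. *)
Definition adjoint_solution a U (u : spacetime -> R) : Prop :=
  Lp_loc 1 U u /\
  forall phi, test_function U phi ->
    \int[stleb d]_(X in U) (u X * P_smooth a phi X) = 0.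

Definition average (C : set spacetime) (u : spacetime -> R) : \bar R :=
  ((stleb d C)^-1 * \int[stleb d]_(X in C) (u X)%:E)%E.

(* [\_ C] extends by 0 outside C, so that the essential supremum of the
   nonnegative function below is the one over C. *)
Definition local_boundedness a (R0 N0 : R) : Prop :=
  forall (r : R) (X0 : spacetime) (u : spacetime -> R),
    0 < r < R0 ->
    adjoint_solution a (cylinder X0 (2 * r)) u ->
    (ess_sup (stleb d) ((fun X => `|u X|%R%:E) \_ (cylinder X0 r))
      <= N0%:E * average (cylinder X0 (2 * r)) (fun X => `|u X|%R))%E.

(* Bounded initial data for which the pointwise initial condition below
   determines the bounded solution; indicators of balls are examples. *)
Definition initial_datum (f : space -> R) : Prop :=
  [/\ measurable_fun [set: space] f,
      exists M : R, forall x, `|f x| <= M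
    & {ae leb d, forall x, {for x, continuous f}}].

(* A bounded solution of P u = 0 in (tau, +oo) x R^d with u(tau, .) = f, the
   initial value being attained at the points of continuity of f. *)
Definition bounded_solution a (tau : R) (f : space -> R) (u : spacetime -> R)
    : Prop :=
  let U := [set X : spacetime | tau < X.1] in
  [/\ strong_solution a U u,
      exists M : R, forall X, U X -> `|u X| <= M
    & forall z, {for z, continuous f} ->
        u X @[X --> within U (nbhs (tau, z))] --> f z].

Implicit Type Gamma : R -> space -> R -> space -> R.

Record fundamental_solution a Gamma : Prop := FundamentalSolution {
  fs_ge0 : forall t x s y, 0 <= Gamma t x s y ;
  fs_causal : forall t x s y, t < s -> Gamma t x s y = 0 ;
  fs_equation : forall s y,
    strong_solution a [set X | s < X.1] (fun X => Gamma X.1 X.2 s y) ;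
  fs_pole : forall s y (phi : space -> R), test_function setT phi ->
    (\int[leb d]_x (Gamma t x s y * phi x)) @[t --> s^'+] --> phi y ;
  fs_integrable : forall t x tau, tau < t ->
    (leb d).-integrable setT (EFin \o Gamma t x tau) ;
  fs_cauchy : forall tau f, initial_datum f ->
    let u := fun X : spacetime => \int[leb d]_z (Gamma X.1 X.2 tau z * f z) in
    bounded_solution a tau f u /\
    forall v, bounded_solution a tau f v ->
      forall X, tau < X.1 -> v X = u X ;
  fs_adjoint : forall t x,
    adjoint_solution a [set Y | Y.1 < t] (fun Y => Gamma t x Y.1 Y.2) }.

(* The function s, y |-> Gamma t x s y is an adjoint solution, thus a class of
   functions modulo null sets. Its precise representative is given by the
   (upper) limits of its averages over the cylinders C_r(s, y). *)
Definition precise Gamma (t : R) (x : space) (s : R) (y : space) : \bar R :=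
  limf_esup
    (fun r : R => average (cylinder (s, y) r) (fun Y => Gamma t x Y.1 Y.2))
    0^'+.

Definition gaussian (N kappa t : R) (x : space) (s : R) (y : space) : R :=
  N / (t - s) `^ (d%:R / 2) * expR (- (kappa * (enorm (x - y) ^+ 2 / (t - s)))).

End equations.

(* Main.v *)
Require Import Defs.
From mathcomp Require Import all_boot all_order all_algebra.
From mathcomp Require Import all_classical all_reals all_analysis.
From mathcomp Require Import measurable_realfun ess_sup_inf.
From mathcomp Require Import ring lra.

(** Fix t and x. As a function of (s, y), Gamma t x s y is a nonnegative solution
of the adjoint equation in the past of t, and it is a probability density in y
because the constant 1 is the bounded solution with initial value 1
([fundamental_mass1]).

The proof rests on a bounded version of the method of exponential weights. The
function exp (al.z + Lambda |al|^2 s) is a supersolution for every matrix that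
is bounded by Lambda; composing the exponent with the logistic function
instead of the exponential keeps the inequality P psi >= 0
([P_smooth_barrier_ge0]), keeps the upper bound by the exponential, and makes
psi bounded with bounded derivatives, so that psi may be paired with Gamma.
The adjoint equation shows that s |-> \int Gamma(t,x,s,z) psi(s,z) dz is
nondecreasing, and the initial condition identifies its value for a pole (t,x)
close to time s with psi(t,x). Hence \int Gamma(t,x,s,z) psi(s,z) dz <=
psi(t,x) ([ae_barrier_le]). Taking psi at least 1/2 on the ball of radius
sqrt(t - s0) around y0, with al a suitable multiple of y0 - x, bounds the mass
of that ball, for s in (s0,t), by a multiple of exp (- |x - y0|^2 / (8 Lambda
(t - s0))) ([ae_ball_mass]). The average of Gamma over the cylinder of that
radius at (s0,y0) therefore has a Gaussian bound, and local boundedness turns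
it into a pointwise bound almost everywhere in the cylinder of half that
radius. Countably many of these cylinders cover the times at distance less
than T from t ([ae_gaussian]).

Since adjoint solutions are merely locally integrable, the monotonicity is
first an inequality between averages over time windows ([window_kmean_le]),
obtained from test functions eta(s) psi_n(s,z) with psi_n a spatial truncation
of psi; it then holds between Lebesgue points in time ([kmean_le]). The
passage n -> oo is organised by the class [tame] of sequences of smooth
functions, which is closed under derivatives and under everything needed to
build cutoffs.

It remains to go from almost every (s,y) to every s. By Fubini the bound holds
for almost every y at almost every time. If f is continuous with values in
[0,1] and u is the bounded solution starting from f at time s, uniqueness
gives \int Gamma(t,x,s,z) f(z) dz = \int Gamma(t,x,tau,z) u(tau,z) dz for s <
tau < t ([chapman_kolmogorov]). Letting good times tau decrease to s, the
Gaussian dominates and the bound passes to the limit after integration against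
f ([integral_continuous_le]); continuous functions are enough to compare two
densities almost everywhere ([ae_le_of_continuous]). The precise
representative is a limit of averages over shrinking cylinders, where the
space-time bound and the continuity of the Gaussian apply
([precise_le_gaussian]). *)

Set Implicit Arguments.
Unset Strict Implicit.
Unset Printing Implicit Defensive.

Import Order.TTheory GRing.Theory Num.Theory.
Import numFieldNormedType.Exports.

Local Open Scope classical_set_scope.
Local Open Scope ring_scope.

(** * Sequences of smooth functions stable under differentiation *)

Section tame_functions.
Context {R : realType}.

(** The derivatives are given by a witness G, so that closure properties need no
formula for them. *)
Definition bsmooth (g : R -> R) : Prop := exists G : nat -> R -> R,
  [/\ G 0%N = g, forall k (x : R), is_derive x 1 (G k) (G k.+1 x)
    & forall k, exists M, forall x, `|G k x| <= M].

Definition functional (V : normedModType R) (L : V -> R) : Prop :=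
  (forall c u v, L (c *: u + v) = c * L u + L v) /\ continuous L.

(** [tame f l]: the sequence f is built from convergent constants and from
bounded smooth functions of affine forms whose coefficients converge, by sums
and products; l is the expression formed with the limits of these data. The
syntactic description makes the class stable under directional derivatives, and
this gives, with no estimate to prove, that all derivatives of f_n exist, are
bounded uniformly in n, and converge pointwise to those of l. *)
Inductive tame (V : normedModType R) : (nat -> V -> R) -> (V -> R) -> Prop :=
| tame_cst c c0 : c @ \oo --> c0 -> tame (fun n _ => c n) (fun=> c0)
| tame_comp g b b0 L L0 : bsmooth g -> b @ \oo --> b0 ->
    (forall n, functional (L n)) -> functional L0 ->
    (forall v, L ^~ v @ \oo --> L0 v) ->
    tame (fun n X => g (b n + L n X)) (fun X => g (b0 + L0 X))
| tame_add f1 l1 f2 l2 : tame f1 l1 -> tame f2 l2 ->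
    tame (fun n X => f1 n X + f2 n X) (fun X => l1 X + l2 X)
| tame_mul f1 l1 f2 l2 : tame f1 l1 -> tame f2 l2 ->
    tame (fun n X => f1 n X * f2 n X) (fun X => l1 X * l2 X).

Lemma bsmooth_continuous g : bsmooth g -> continuous g.
Proof.
move=> [G [<- dG _]] x; apply: differentiable_continuous.
by apply/derivable1_diffP; have [] := dG 0%N x.
Qed.

Lemma bsmooth_deriv g : bsmooth g ->
  exists2 g', bsmooth g' & forall x : R, is_derive x 1 g (g' x).
Proof.
move=> [G [<- dG bG]]; exists (G 1%N); last exact: dG.
by exists (fun k => G k.+1); split.
Qed.

Lemma tame_lim_const (V : normedModType R) f (l : V -> R) :
  tame f l -> tame (fun=> l) l.
Proof.
elim=> {f l} [c c0 _|g b b0 L L0 gs _ _ fL0 _|? ? ? ? _ ? _ ?|? ? ? ? _ ? _ ?].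
- by apply: (@tame_cst _ (fun=> c0)); exact: cvg_cst.
- apply: (@tame_comp _ g (fun=> b0) b0 (fun=> L0) L0) => //; first exact: cvg_cst.
  by move=> v; exact: cvg_cst.
- exact: tame_add.
- exact: tame_mul.
Qed.

Lemma tame_const (V : normedModType R) f (l : V -> R) :
  tame f l -> forall n, tame (fun=> f n) (f n).
Proof.
elim=> {f l} [c c0 _|g b b0 L L0 gs _ fL _ _|? ? ? ? _ h1 _ h2|? ? ? ? _ h1 _ h2] n.
- by apply: (@tame_cst _ (fun=> c n)); exact: cvg_cst.
- apply: (@tame_comp _ g (fun=> b n) (b n) (fun=> L n) (L n)) => //; first exact: cvg_cst.
  by move=> v; exact: cvg_cst.
- by apply: tame_add.
- by apply: tame_mul.
Qed.

Lemma tame_continuous (V : normedModType R) f (l : V -> R) :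
  tame f l -> forall n, continuous (f n).
Proof.
elim=> {f l} [c c0 _ n|g b b0 L L0 gs _ fL _ _ n X|f1 l1 f2 l2 _ h1 _ h2 n X|
   f1 l1 f2 l2 _ h1 _ h2 n X].
- by move=> X; exact: cvg_cst.
- have [_ cL] := fL n.
  apply: (@continuous_comp _ _ _ (fun X => b n + L n X) g); last exact: bsmooth_continuous.
  by apply: cvgD; [exact: cvg_cst|exact: cL].
- by apply: cvgD; [exact: h1|exact: h2].
- by apply: cvgM; [exact: h1|exact: h2].
Qed.

Lemma tame_cvg (V : normedModType R) f (l : V -> R) :
  tame f l -> forall X, f ^~ X @ \oo --> l X.
Proof.
elim=> {f l} [c c0 cc X//|g b b0 L L0 gs bb _ _ LL X|f1 l1 f2 l2 _ h1 _ h2 X|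
   f1 l1 f2 l2 _ h1 _ h2 X].
- apply: (@cvg_comp _ _ _ (fun n => b n + L n X) g _ (nbhs (b0 + L0 X))).
    by apply: cvgD => //; exact: LL.
  exact: bsmooth_continuous.
- by apply: cvgD; [exact: h1|exact: h2].
- by apply: cvgM; [exact: h1|exact: h2].
Qed.

Lemma tame_bounded (V : normedModType R) f (l : V -> R) :
  tame f l -> exists M, forall n X, `|f n X| <= M.
Proof.
elim=> {f l} [c c0 cc|g b b0 L L0 gs bb _ _ LL|f1 l1 f2 l2 _ [M1 h1] _ [M2 h2]|
   f1 l1 f2 l2 _ [M1 h1] _ [M2 h2]].
- have /cvg_seq_bounded [M [Mr MP]] : cvgn c by apply/cvg_ex; exists c0.
  by exists (M + 1) => n X; apply: (MP (M + 1)) => //; rewrite ltrDl.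
- have [G [<- _ /(_ 0%N) [M hM]]] := gs.
  by exists M => n X; exact: hM.
- exists (M1 + M2) => n X; apply: le_trans (ler_normD _ _) _.
  exact: lerD.
- exists (M1 * M2) => n X; rewrite normrM; apply: ler_pM => //.
Qed.

(** The base case of the differentiation of a tame sequence: on a line, an
affine form is an affine function of the parameter. *)
Lemma is_derive_affine (V : normedModType R) g b (L : V -> R) X v d :
  functional L -> is_derive (b + L X) 1 g d ->
  is_derive X v (fun Y => g (b + L Y)) (L v * d).
Proof.
move=> [lL cL] [dg gd].
have L0 : L 0 = 0.
  by have := lL 1 0 0; rewrite scale1r addr0 mul1r => /eqP; rewrite addrC -subr_eq subrr => /eqP.
have line : is_derive (0 : R) 1 (fun h : R => g (b + L X + h * L v)) (L v * d).
  have hh : is_derive (0 : R) 1 (fun h : R => b + L X + h * L v) (L v).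
    have h2 : is_derive (0 : R) 1 ((@id R) * cst (L v)) (0 *: 0 + L v *: 1).
      by apply: is_deriveM.
    have := @is_deriveD _ _ _ (cst (b + L X)) _ (0 : R) 1 0 _ _ h2.
    rewrite scale0r !add0r [_ *: 1]mulr1; apply; exact: is_derive_cst.
  rewrite mulrC -gd.
  apply: (@is_derive1_comp _ g (fun h : R => b + L X + h * L v)) => //.
  by rewrite mul0r addr0; split.
have E (h : R) : g (b + L (h *: v + X)) = g (b + L X + h * L v).
  by congr g; rewrite lL; ring.
have q : (fun h : R => h^-1 *: (((fun Y => g (b + L Y)) \o shift X) (h *: v) - g (b + L X)))
       = (fun h : R => h^-1 *: (((fun h : R => g (b + L X + h * L v)) \o shift 0) (h *: 1)
             - (fun h : R => g (b + L X + h * L v)) 0)).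
  by apply/funext => h /=; rewrite E /= mul0r !addr0 [h *: 1]mulr1.
case: line => dl vl; split; last rewrite -vl /derive.
  by rewrite /derivable q.
by rewrite q.
Qed.

Lemma tame_derive_ex (V : normedModType R) f (l : V -> R) v :
  tame f l -> exists df dl, [/\ tame df dl, forall n X, is_derive X v (f n) (df n X)
    & forall X, is_derive X v l (dl X)].
Proof.
elim=> {f l} [c c0 cc|g b b0 L L0 gs bb fL fL0 LL
   |f1 l1 f2 l2 t1 [d1 [e1 [td1 h1 k1]]] t2 [d2 [e2 [td2 h2 k2]]]
   |f1 l1 f2 l2 t1 [d1 [e1 [td1 h1 k1]]] t2 [d2 [e2 [td2 h2 k2]]]].
- exists (fun _ _ => 0), (fun _ => 0); split.
  + by apply: (@tame_cst _ (fun=> 0)); exact: cvg_cst.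
  + by move=> n X; exact: is_derive_cst.
  + by move=> X; exact: is_derive_cst.
- have [g' gs' dg] := bsmooth_deriv gs.
  exists (fun n X => L n v * g' (b n + L n X)), (fun X => L0 v * g' (b0 + L0 X)); split.
  + by apply: tame_mul; [exact: tame_cst|exact: tame_comp].
  + by move=> n X; exact: is_derive_affine.
  + by move=> X; exact: is_derive_affine.
- exists (fun n X => d1 n X + d2 n X), (fun X => e1 X + e2 X); split.
  + exact: tame_add.
  + by move=> n X; apply: is_deriveD.
  + by move=> X; apply: is_deriveD.
- exists (fun n X => f1 n X * d2 n X + f2 n X * d1 n X),
    (fun X => l1 X * e2 X + l2 X * e1 X); split.
  + by apply: tame_add; apply: tame_mul.
  + by move=> n X; apply: is_deriveM.
  + by move=> X; apply: is_deriveM.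
Qed.

Lemma tame_derive (V : normedModType R) f (l : V -> R) v :
  tame f l -> [/\ forall n X, derivable (f n) X v, forall X, derivable l X v
    & tame (fun n => 'D_v (f n)) ('D_v l)].
Proof.
move=> /(tame_derive_ex v) [df [dl [t h k]]]; split.
- by move=> n X; case: (h n X).
- by move=> X; case: (k X).
- rewrite (_ : (fun n => _) = df).
    rewrite (_ : 'D_v l = dl) //.
    by apply/funext => X; case: (k X).
  by apply/funext => n; apply/funext => X; case: (h n X).
Qed.

Lemma tame_smooth (V : normedModType R) f (l : V -> R) :
  tame f l -> forall n, smooth (f n).
Proof.
move=> t n vs.
suff [f' [l' [t' ->]]] : exists f' l', tame f' l' /\ iter_derive vs (f n) = f' n.
  split; first exact: tame_continuous t' n.
  by move=> x v; have [+ _ _] := tame_derive v t'; apply.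
elim: vs => [|v vs [f' [l' [t' e]]]]; first by exists f, l.
exists (fun n => 'D_v (f' n)), ('D_v l'); split; last by rewrite /= e.
by have [] := tame_derive v t'.
Qed.

Lemma tame_bsmooth f (l : R -> R) : tame f l -> bsmooth l.
Proof.
move=> t; pose G k := iter k (fun g : R -> R => 'D_1 g) l.
have tG k : exists f', tame f' (G k).
  elim: k => [|k [f' tk]]; first by exists f.
  by exists (fun n => 'D_1 (f' n)); have [_ _] := tame_derive (1 : R) tk.
exists G; split => //.
- move=> k x; have [f' tk] := tG k.
  have [_ dk _] := tame_derive (1 : R) tk.
  by apply: (DeriveDef _ (erefl _)); exact: dk.
- move=> k; have [f' /tame_lim_const/tame_bounded [M hM]] := tG k.
  by exists M => x; exact: (hM 0%N).
Qed.

End tame_functions.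

(** * The logistic function and exp (-1/x) *)

Section bounded_smooth_examples.
Context {R : realType}.
Implicit Types (g : R -> R) (Q : {poly R}).

(** A class of bounded functions that contains a derivative of each of its members
consists of functions all of whose derivatives are bounded; this replaces
explicit formulas for higher derivatives. *)
Lemma bsmooth_class (C : set (R -> R)) :
  (forall g, C g -> (exists M, forall x, `|g x| <= M) /\
    exists2 g', C g' & forall x : R, is_derive x 1 g (g' x)) ->
  forall g, C g -> bsmooth g.
Proof.
move=> HC g Cg; pose G k := iter k (fun g : R -> R => 'D_1 g) g.
have der h : C h -> (forall x : R, derivable h x 1) /\ C ('D_1 h).
  move=> /HC[_ [h' Ch' dh]]; split=> [x|]; first by case: (dh x).
  rewrite (_ : 'D_1 h = h') //.
  by apply/funext => x; case: (dh x).
have CG k : C (G k) by elim: k => [//|k /der[]].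
exists G; split => [//|k x|k].
- by have [dG _] := der _ (CG k); apply: (DeriveDef _ (erefl _)); exact: dG.
- by have [] := HC _ (CG k).
Qed.

Definition sigmoid (x : R) : R := (1 + expR (- x))^-1.

Lemma sigmoid_gt0 x : 0 < sigmoid x.
Proof. by rewrite invr_gt0 ltr_pwDl ?expR_ge0. Qed.

Lemma sigmoid_lt1 x : sigmoid x < 1.
Proof. by rewrite invf_lt1 ?ltrDl ?expR_gt0// ltr_pwDl ?expR_ge0. Qed.

(** The logistic function keeps the exponential decay at -oo that produces the
Gaussian factor. *)
Lemma sigmoid_le_expR x : sigmoid x <= expR x.
Proof.
rewrite -[leRHS]invrK -expRN lef_pV2 ?posrE ?expR_gt0 ?ltr_pwDl ?expR_ge0//.
by rewrite lerDr.
Qed.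

Lemma ge0_sigmoid x : 0 <= x -> 2^-1 <= sigmoid x.
Proof.
move=> x0; rewrite lef_pV2 ?posrE ?ltr_pwDl ?expR_ge0//.
by rewrite -[leRHS]/(1 + 1) lerD2l expR_le1 oppr_le0.
Qed.

Lemma is_derive_sigmoid (x : R) :
  is_derive x 1 sigmoid (sigmoid x * (1 - sigmoid x)).
Proof.
have e0 : 1 + expR (- x) != 0 by rewrite gt_eqF// ltr_pwDl ?expR_ge0.
have h1 : is_derive x 1 (expR \o -%R) (expR (- x) * -1).
  by apply: is_derive1_comp; apply: is_deriveN.
have h2 : is_derive x 1 (fun x : R => 1 + expR (- x)) (- expR (- x)).
  have := @is_deriveD _ _ _ (cst (1 : R)) (expR \o -%R) x 1 0 _ _ h1.
  by rewrite add0r mulrN1; apply.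
have := @is_deriveV _ (fun x : R => 1 + expR (- x)) x _ 1 e0 h2; rewrite (_ : _ *: _ = sigmoid x * (1 - sigmoid x)) //.
by rewrite /sigmoid /GRing.scale/=; field.
Qed.

(** As sigma' = sigma (1 - sigma), polynomials in sigma form a class closed under
derivation, and they are bounded because 0 < sigma < 1. *)
Lemma bsmooth_sigmoid : bsmooth sigmoid.
Proof.
apply: (@bsmooth_class (fun g => exists Q, g = fun x => Q.[sigmoid x])); last first.
  by exists 'X; apply/funext => x; rewrite hornerX.
move=> _ [Q ->]; split.
  have [M hM] := poly_disk_bound Q 1; exists M => x; apply: hM.
  by rewrite ger0_norm ?(ltW (sigmoid_gt0 _))// ltW// sigmoid_lt1.
exists (fun x => (Q^`() * ('X * (1 - 'X))).[sigmoid x]); first by eexists.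
move=> x; rewrite hornerM.
have -> : ('X * (1 - 'X)).[sigmoid x] = sigmoid x * (1 - sigmoid x) by rewrite !hornerE.
have := @is_derive1_comp _ (horner Q) sigmoid _ _ _ (is_derive_poly Q (sigmoid x)) (is_derive_sigmoid x).
done.
Qed.

(** The functions Q(1/x) exp (-1/x), extended by 0 to x <= 0. The derivatives of
exp (-1/x) are all of this form, which makes it smooth across 0; [flat 1] is
exp (-1/x) itself. *)
Definition flat Q (x : R) : R := if 0 < x then Q.[x^-1] * expR (- x^-1) else 0.

(** With u = 1/x, each monomial u^i exp (-u) is bounded by i!, from the exponential
series. *)
Lemma flat_bounded Q : exists M, forall x, `|flat Q x| <= M.
Proof.
exists (\sum_(i < size Q) `|Q`_i| * i`!%:R) => x.
have M0 : 0 <= \sum_(i < size Q) `|Q`_i| * i`!%:R by apply: sumr_ge0.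
rewrite /flat; case: ifPn => x0; last by rewrite normr0.
rewrite horner_coef mulr_suml; apply: le_trans (ler_norm_sum _ _ _) _.
apply: ler_sum => i _; rewrite -mulrA normrM ler_wpM2l//.
have u0 : 0 <= x^-1 by rewrite invr_ge0 ltW.
rewrite ger0_norm ?mulr_ge0 ?exprn_ge0 ?expR_ge0//.
rewrite expRN ler_pdivrMr ?expR_gt0//.
case: (nat_of_ord i) => [|n].
  by rewrite expr0 fact0 mul1r -[leLHS]expR0 ler_expR.
rewrite mulrC -ler_pdivrMr ?ltr0n ?fact_gt0//.
by apply: le_trans (expR_ge1Dxn n u0); rewrite lerDr.
Qed.

Lemma is_derive0_quadratic g M : (forall x, `|g x| <= M * x ^+ 2) -> is_derive (0 : R) 1 g 0.
Proof.
move=> gM.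
have g0 : g 0 = 0.
  by apply/eqP; rewrite -normr_le0; apply: le_trans (gM 0) _; rewrite expr0n mulr0.
have M0 : 0 <= M by have := gM 1; rewrite expr1n mulr1; exact: le_trans.
have lim : h^-1 *: ((g \o shift 0) (h *: (1 : R)) - g 0) @[h --> (0:R)^'] --> (0 : R).
  apply/cvgrPdist_le => e e0; near=> h.
  rewrite sub0r normrN /= g0 subr0 addr0 [h *: 1]mulr1 normrM normfV.
  have h0 : h != 0 by near: h; exact: nbhs_dnbhs_neq.
  rewrite ler_pdivrMl ?normr_gt0//; apply: le_trans (gM _) _.
  rewrite -[h ^+ 2]ger0_norm ?sqr_ge0// normrX expr2 mulrCA ler_wpM2l//.
  rewrite -[leRHS](mulfVK (lt0r_neq0 (ltr_pwDl ltr01 M0))) mulrC.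
  have : `|h| <= e / (1 + M).
    near: h; apply: dnbhs0_le; by rewrite divr_gt0// ltr_pwDl.
  move=> hh; apply: ler_pM => //; by rewrite lerDr.
by split; [apply/cvg_ex; exists 0|apply: cvg_lim].
Unshelve. all: by end_near. Qed.

Lemma is_derive_near (f g : R -> R) (x d : R) :
  (\near x, f x = g x) -> is_derive x 1 f d -> is_derive x 1 g d.
Proof.
move=> fg [df <-]; split; first exact: near_eq_derivable df.
by apply/esym/near_eq_derive.
Qed.

(** At the origin, Q(1/x) exp (-1/x) is x^2 times a function of the same form,
which is bounded, so the derivative exists and vanishes. *)
Lemma is_derive_flat Q (x : R) :
  is_derive x 1 (flat Q) (flat ((Q - Q^`()) * 'X^2) x).
Proof.
have [x0|x0|->] := ltgtP x 0.
- apply: (@is_derive_near (cst 0)); last by rewrite /flat ltNge ltW//=; exact: is_derive_cst.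
  near=> y; rewrite /flat ltNge ltW//=; near: y; exact: lt_nbhsl.
- apply: (@is_derive_near (fun x => Q.[x^-1] * expR (- x^-1))).
    near=> y; rewrite /flat (_ : 0 < y)//; near: y; exact: lt_nbhsr.
  have dV : is_derive x 1 (@GRing.inv R) (- x ^- 2).
    have := @is_deriveV _ id x 1 1 (lt0r_neq0 x0).
    by rewrite [_ *: 1]mulr1; apply.
  have h1 : is_derive x 1 (horner Q \o @GRing.inv R) (Q^`().[x^-1] * - x ^- 2).
    by apply: is_derive1_comp.
  have h2 : is_derive x 1 (expR \o (fun x => - x^-1)) (expR (- x^-1) * x ^- 2).
    apply: is_derive1_comp; rewrite -[x ^- 2]opprK; exact: is_deriveN.
  have := is_deriveM h1 h2.
  rewrite (_ : _ + _ = flat ((Q - Q^`()) * 'X^2) x)//.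
  by rewrite /flat x0 !hornerE -exprVn /GRing.scale/= expr2; ring.
- rewrite [X in is_derive _ _ _ X](_ : _ = 0); last by rewrite /flat ltxx.
  have [M hM] := flat_bounded (Q * 'X^2).
  apply: (@is_derive0_quadratic _ M) => y; have := hM y; rewrite /flat.
  case: ifPn => y0; last by rewrite normr0 => M0; rewrite mulr_ge0 ?sqr_ge0.
  rewrite -[y ^+ 2]ger0_norm ?sqr_ge0// -ler_pdivrMr ?normr_gt0 ?sqrf_eq0 ?gt_eqF//.
  by rewrite -normfV -normrM hornerM hornerXn -exprVn mulrAC.
Unshelve. all: by end_near. Qed.

Lemma bsmooth_flat Q : bsmooth (flat Q).
Proof.
apply: (@bsmooth_class (fun g => exists Q, g = flat Q)); last by exists Q.
move=> _ [{}Q ->]; split; first exact: flat_bounded.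
by eexists; [eexists; reflexivity|exact: is_derive_flat].
Qed.

End bounded_smooth_examples.

(** * Smooth approximations of indicators of intervals *)

Section smooth_steps.
Context {R : realType}.
Implicit Types (g : R -> R).
Local Notation mu := (@lebesgue_measure R).

Lemma bsmooth_primitive g E : bsmooth g ->
  (forall x : R, is_derive x 1 E (g x)) -> (exists M, forall x, `|E x| <= M) ->
  bsmooth E.
Proof.
move=> [G [G0 dG bG]] dE bE; exists (fun k => if k is k'.+1 then G k' else E).
split => [//|[|k] x|[|k]] /=; [|exact: dG|exact: bE|exact: bG].
by rewrite G0; exact: dE.
Qed.

Lemma functional_mul (c : R) : functional (fun x : R => c * x).
Proof.
split=> [a u v|]; first by rewrite mulrDr mulrCA.
by move=> x; apply: cvgM; [exact: cvg_cst|exact: cvg_id].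
Qed.

Lemma bsmooth_affine g a b : bsmooth g -> bsmooth (fun x => g (b + a * x)).
Proof.
move=> bg; apply: (@tame_bsmooth _ (fun _ x => g (b + a * x))).
apply: (@tame_comp _ _ g (fun=> b) b (fun _ x => a * x) (fun x => a * x)) => //.
- exact: cvg_cst.
- by move=> n; exact: functional_mul.
- exact: functional_mul.
- by move=> v; exact: cvg_cst.
Qed.

Lemma bsmooth_tame g : bsmooth g -> tame (fun=> g) g.
Proof.
move=> bg; have e : (fun x => g (0 + 1 * x)) = g.
  by apply/funext => x; rewrite add0r mul1r.
have := @tame_comp _ R g (fun=> 0) 0 (fun _ x => 1 * x) (fun x => 1 * x).
rewrite e; apply => //.
- exact: cvg_cst.
- by move=> n; exact: functional_mul.
- exact: functional_mul.
- by move=> v; exact: cvg_cst.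
Qed.

Lemma bsmooth_mul g1 g2 : bsmooth g1 -> bsmooth g2 -> bsmooth (fun x => g1 x * g2 x).
Proof.
move=> b1 b2; apply: (@tame_bsmooth _ (fun _ x => g1 x * g2 x)).
by apply: tame_mul; exact: bsmooth_tame.
Qed.

Lemma bsmooth_sub g1 g2 : bsmooth g1 -> bsmooth g2 -> bsmooth (fun x => g1 x - g2 x).
Proof.
move=> b1 b2; have -> : (fun x => g1 x - g2 x) = (fun x => g1 x + -1 * g2 x).
  by apply/funext => x; rewrite mulN1r.
apply: (@tame_bsmooth _ (fun _ x => g1 x + -1 * g2 x)).
apply: tame_add; first exact: bsmooth_tame.
apply: tame_mul; last exact: bsmooth_tame.
by apply: (@tame_cst _ _ (fun=> -1)); exact: cvg_cst.
Qed.

Lemma flat1_ge0 (x : R) : 0 <= flat 1 x.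
Proof. by rewrite /flat; case: ifP => // _; rewrite hornerE mul1r expR_ge0. Qed.

Lemma flat1_le1 (x : R) : flat 1 x <= 1.
Proof.
rewrite /flat; case: ifP => // x0; rewrite hornerE mul1r expR_le1 oppr_le0.
by rewrite invr_ge0 ltW.
Qed.

Lemma flat1_eq0 (x : R) : x <= 0 -> flat 1 x = 0.
Proof. by rewrite /flat leNgt; case: ifP. Qed.

Lemma cvg_flat1 (x : R) : 0 < x -> flat 1 (n.+1%:R * x) @[n --> \oo] --> (1 : R).
Proof.
move=> x0.
have -> : (fun n => flat 1 (n.+1%:R * x)) = (fun n => expR (- (x^-1 * n.+1%:R^-1))).
  apply/funext => n; rewrite /flat mulr_gt0// hornerE mul1r invfM.
  by congr (expR (- _)); exact: mulrC.
rewrite -[X in _ --> X]expR0; apply: (@cvg_comp _ _ _ _ expR _ (nbhs 0)).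
  rewrite -oppr0; apply: cvgN; rewrite -(mulr0 x^-1).
  by apply: cvgM; [exact: cvg_cst|exact: cvg_harmonic].
exact: continuous_expR.
Qed.

(** A smooth approximation from below of the indicator of (-h,h); since
exp (-1/(n x)) tends to 1 for x > 0, it converges to the indicator pointwise. *)
Definition window (h : R) (n : nat) (x : R) : R :=
  flat 1 (n.+1%:R * (h + x)) * flat 1 (n.+1%:R * (h - x)).

(** A primitive of [window]. The difference of two of its translates vanishes
outside a compact interval, while its derivative is a difference of windows:
such functions of time compare the averages over two windows. *)
Definition smooth_step (h : R) (n : nat) (x : R) : R :=
  \int[mu]_(t in `]-oo, x]) window h n t.

Section window.
Variables (h : R) (n : nat).
Hypothesis h_gt0 : 0 < h.

Lemma window_ge0 x : 0 <= window h n x.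
Proof. by rewrite mulr_ge0 ?flat1_ge0. Qed.

Lemma window_le1 x : window h n x <= 1.
Proof.
rewrite -[leRHS]mulr1; apply: ler_pM; [exact: flat1_ge0|exact: flat1_ge0|..]; exact: flat1_le1.
Qed.

Lemma window_eq0 x : h <= `|x| -> window h n x = 0.
Proof.
rewrite /window; case: (ger0P x) => x0 hx.
  by rewrite [X in _ * X]flat1_eq0 ?mulr0// mulr_ge0_le0// subr_le0.
by rewrite flat1_eq0 ?mul0r// mulr_ge0_le0// -lerBrDr sub0r.
Qed.

Lemma window_bsmooth : bsmooth (window h n).
Proof.
have -> : window h n = (fun x => flat 1 (n.+1%:R * h + n.+1%:R * x) *
    flat 1 (n.+1%:R * h + (- n.+1%:R) * x)).
  by apply/funext => x; rewrite /window; congr (flat 1 _ * flat 1 _); ring.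
by apply: bsmooth_mul; apply: bsmooth_affine; exact: bsmooth_flat.
Qed.

Lemma integrable_compact_support (f : R -> R) (a b : R) : continuous f ->
  (forall x, x \notin `[a, b] -> f x = 0) -> mu.-integrable setT (EFin \o f).
Proof.
move=> cf f0.
have -> : EFin \o f = (EFin \o f) \_ `[a, b].
  apply/funext => x; rewrite /patch /= mem_setE; case: ifPn => // /f0 ->//.
apply: (integrable_mkcond _ _).1 => //; apply: continuous_compact_integrable.
  exact: segment_compact.
exact: continuous_subspaceT.
Qed.

Lemma window_integrable : mu.-integrable setT (EFin \o window h n).
Proof.
apply: (@integrable_compact_support _ (- h) h).
  exact: bsmooth_continuous window_bsmooth.
move=> x; rewrite in_itv/= => hx; apply: window_eq0.
by move: hx; rewrite -ler_norml -ltNge => /ltW.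
Qed.

Lemma is_derive_smooth_step (x : R) : is_derive x 1 (smooth_step h n) (window h n x).
Proof.
have cw := bsmooth_continuous window_bsmooth.
have iw : mu.-integrable `]-oo, (x + 1)] (EFin \o window h n).
  by apply: integrableS window_integrable.
have xlt : x < x + 1 by rewrite ltrDl.
have xinf : (-oo%O < BRight x)%E by rewrite ltNyr.
have [dw] := @continuous_FTC1 _ (window h n) -oo%O x (x + 1) xlt iw xinf (cw x).
by rewrite derive1E => <-; exact: DeriveDef.
Qed.

Lemma smooth_stepE x : smooth_step h n x = \int[mu]_t ((window h n) \_ `]-oo, x]) t.
Proof. by rewrite /smooth_step Rintegral_mkcond. Qed.

Lemma smooth_step_eq0 x : x <= - h -> smooth_step h n x = 0.
Proof.
move=> xh; rewrite smooth_stepE; under eq_Rintegral.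
  move=> t _; rewrite (_ : _ \_ _ = cst 0).
    over.
  apply/funext => u; rewrite /patch mem_setE in_itv/=; case: ifPn => // ux.
  by apply: window_eq0; rewrite ler_normr; apply/orP; right; lra.
by rewrite Rintegral_cst// mul0r.
Qed.

Lemma smooth_step_eq x : h <= x -> smooth_step h n x = smooth_step h n h.
Proof.
move=> hx; rewrite !smooth_stepE; congr (Rintegral _ _ _); apply/funext => t.
rewrite /patch !mem_setE !in_itv/=; have [th|th] := leP t h.
  by rewrite (le_trans th).
by case: ifP => // _; rewrite window_eq0// (le_trans (ltW th))// ler_norm.
Qed.

Lemma smooth_step_le : {homo smooth_step h n : x y / x <= y}.
Proof.
move=> x y xy; rewrite !smooth_stepE; apply: le_Rintegral => //.
- by rewrite -restrict_EFin; apply: (integrable_mkcond _ _).1 => //; exact: integrableS window_integrable.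
- by rewrite -restrict_EFin; apply: (integrable_mkcond _ _).1 => //; exact: integrableS window_integrable.
- move=> t _; rewrite /patch !mem_setE !in_itv/=; case: ifPn => [tx|_].
    by rewrite (le_trans tx).
  by case: ifP => // _; exact: window_ge0.
Qed.

Lemma smooth_step_bsmooth : bsmooth (smooth_step h n).
Proof.
apply: (@bsmooth_primitive (window h n)); [exact: window_bsmooth|exact: is_derive_smooth_step|].
exists (smooth_step h n h) => x.
rewrite ger0_norm; last first.
  by have [|/ltW/smooth_step_le] := leP x (- h); [move/smooth_step_eq0 ->|rewrite smooth_step_eq0].
by have [/smooth_step_le//|/ltW/smooth_step_eq ->] := leP x h.
Qed.

End window.

Lemma cvg_window h x : 0 < h ->
  window h n x @[n --> \oo] --> (\1_(`]- h, h[%classic) x : R).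
Proof.
move=> h0; rewrite indicE mem_setE in_itv/= -ltr_norml.
case: (boolP (`|x| < h)) => xh /=; last first.
  have -> : (fun n => window h n x) = (fun=> 0); last exact: cvg_cst.
  by apply/funext => n; rewrite window_eq0// leNgt.
rewrite -[X in _ --> X]mulr1.
move: xh; rewrite ltr_norml => /andP[x1 x2].
apply: cvgM; apply: cvg_flat1; last by rewrite subr_gt0.
by rewrite addrC -subr_gt0 opprK in x1 *.
Qed.

End smooth_steps.

(** * Topology and Borel sets of row vectors *)

Section rV_topology.
Context {R : realType}.

Lemma cvg_rV n (I : Type) (F : set_system I) {FF : Filter F} (u : I -> 'rV[R]_n) (x : 'rV[R]_n) :
  (forall i, u k ord0 i @[k --> F] --> x ord0 i) -> u @ F --> x.
Proof.
move=> ux A [P nP sPA]; rewrite /nbhs/=.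
have : \forall k \near F, forall i, P ord0 i (u k ord0 i).
  by apply: filter_forall => i; apply: ux; exact: nP.
by apply: filterS => k Pk; apply: sPA => i j; rewrite (ord1 i); exact: Pk.
Qed.

Lemma coord_continuous n (i : 'I_n) : continuous (fun x : 'rV[R]_n => x ord0 i).
Proof.
move=> x A nA; exists (fun i' j => if j == i then A else setT).
  by move=> i' j; case: eqP => [->|_]; [rewrite (ord1 i')|exact: filterT].
by move=> y /(_ ord0 i) /=; rewrite eqxx.
Qed.

Lemma rV_cons_continuous n : continuous (@rV_cons R n).
Proof.
move=> [a z]; apply: cvg_rV => i; case: (unliftP ord0 i) => [j ->|->].
  under eq_fun do rewrite mxE liftK; rewrite mxE liftK/=.
  apply: (@cvg_comp _ _ _ snd (fun x : 'rV[R]_n => x ord0 j) _ (nbhs z)).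
    exact: cvg_snd.
  exact: coord_continuous.
under eq_fun do rewrite mxE unlift_none; rewrite mxE unlift_none/=.
exact: cvg_fst.
Qed.

Lemma rV_uncons_continuous n : continuous (@rV_uncons R n).
Proof.
move=> x; have h1 := @coord_continuous n.+1 ord0 x.
suff h2 : (fun y : 'rV[R]_n.+1 => \row_j y ord0 (lift ord0 j) : 'rV[R]_n) @ x
    --> (\row_j x ord0 (lift ord0 j) : 'rV[R]_n) by exact: (cvg_pair h1 h2).
apply: (@cvg_rV _ _ _ (nbhs_filter x)) => i; under eq_fun do rewrite mxE; rewrite mxE.
exact: coord_continuous.
Qed.

(** [grid k \o cell k] rounds the coordinates down to multiples of 1/(k+1). It
takes countably many values, hence transfers measurability from the coordinates
to continuous functions and to open sets. *)
Definition grid n (k : nat) (z : 'rV[int]_n) : 'rV[R]_n :=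
  \row_i ((z ord0 i)%:~R / k.+1%:R).

Definition cell n (k : nat) (x : 'rV[R]_n) : 'rV[int]_n :=
  \row_i (Num.floor (x ord0 i * k.+1%:R)).

Lemma cvg_grid_cell n (x : 'rV[R]_n) : grid k (cell k x) @[k --> \oo] --> x.
Proof.
apply: cvg_rV => i; apply/cvgrPdist_le => e e0; near=> k.
rewrite !mxE -[X in X - _](mulfK (lt0r_neq0 (ltr0Sn R k))) -mulrBl normrM normfV.
rewrite [X in _ / X]ger0_norm// ler_pdivrMr//.
have h := floor_itv (x ord0 i * k.+1%:R).
have h1 : `|x ord0 i * k.+1%:R - (Num.floor (x ord0 i * k.+1%:R))%:~R| <= 1.
  by move: h => /andP[h1 h2]; rewrite intrD in h2; rewrite ger0_norm ?subr_ge0//; lra.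
apply: le_trans h1 _; rewrite mulrC -ler_pdivrMr// mul1r.
apply: (@le_trans _ _ k%:R); last by rewrite ler_nat.
by near: k; exact: nbhs_infty_ger.
Unshelve. all: by end_near. Qed.

Lemma measurable_cell n k (z : 'rV[int]_n) :
  measurable [set x : 'rV[R]_n | cell k x = z].
Proof.
have -> : [set x : 'rV[R]_n | cell k x = z] = \bigcap_(i in [set: 'I_n])
        ((fun x : 'rV[R]_n => x ord0 i) @^-1`
          `[((z ord0 i)%:~R / k.+1%:R), (((z ord0 i) + 1)%:~R / k.+1%:R)[%classic).
  apply/seteqP; split => [x /= <- i _ /=|x xz /=].
    rewrite in_itv/= ler_pdivrMr// ltr_pdivlMr// mxE.
    exact: floor_itv.
  apply/rowP => i; rewrite mxE; apply: floor_def.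
  by have := xz i I; rewrite /= in_itv/= ler_pdivrMr// ltr_pdivlMr.
apply: fin_bigcap_measurable => // i _.
by rewrite -[X in measurable X]setTI; exact: measurable_coord.
Qed.

Lemma measurable_continuous_rV n (f : 'rV[R]_n -> R) :
  continuous f -> measurable_fun setT f.
Proof.
move=> cf; apply: (@measurable_realfun.measurable_fun_cvg _ _ _ _ (fun k => f \o grid k \o cell k)).
  move=> k _ Y _; rewrite setTI.
  have -> : (f \o grid k \o cell k) @^-1` Y =
     \bigcup_(z in [set z | Y (f (grid k z))]) [set x : 'rV[R]_n | cell k x = z].
    by apply/seteqP; split => [x Yx|x [z Yz /= ->]//]; exists (cell k x).
  rewrite bigcup_mkcond; apply: countable_bigcupT_measurable; first exact: countableP.
  by move=> z; case: ifP => // _; exact: measurable_cell.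
move=> x _; apply: (@cvg_comp _ _ _ (fun k => grid k (cell k x)) f _ (nbhs x)); last exact: cf.
exact: cvg_grid_cell.
Qed.

Lemma measurable_continuous_prod n (f : R * 'rV[R]_n -> R) :
  continuous f -> measurable_fun setT f.
Proof.
move=> cf; have -> : f = f \o (@rV_uncons R n) \o (@rV_cons R n).
  by apply/funext => p /=; rewrite rV_consK.
apply: measurableT_comp; last exact: measurable_rV_cons.
apply: measurable_continuous_rV => x.
by apply: continuous_comp; [exact: rV_uncons_continuous|exact: cf].
Qed.

End rV_topology.

Section rV_sets.
Context {R : realType}.

Lemma nbhs_rVP n (x : 'rV[R]_n) (A : set 'rV[R]_n) : nbhs x A ->
  exists2 e : R, 0 < e & forall y : 'rV[R]_n, (forall i, `|x ord0 i - y ord0 i| < e) -> A y.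
Proof.
move=> /nbhs_ballP[e e0 eA]; exists e => // y xy; apply: eA.
by split=> // i j; rewrite (ord1 i); exact: xy.
Qed.

Lemma cell_dist n k (x y : 'rV[R]_n) i : cell k x = cell k y ->
  `|x ord0 i - y ord0 i| < k.+1%:R^-1.
Proof.
move=> /rowP/(_ i); rewrite !mxE => xy.
rewrite -[X in _ < X]mul1r ltr_pdivlMr// -[X in _ * X]ger0_norm// -normrM mulrBl.
have /andP[] := floor_itv (x ord0 i * k.+1%:R).
have /andP[] := floor_itv (y ord0 i * k.+1%:R).
rewrite xy intrD ltr_norml; move=> *; apply/andP; split; lra.
Qed.

Lemma measurable_open_rV n (O : set 'rV[R]_n) : open O -> measurable O.
Proof.
move=> oO.
have -> : O = \bigcup_k \bigcup_(z : 'rV[int]_n)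
    (if `[< [set x : 'rV[R]_n | cell k x = z] `<=` O >] then [set x | cell k x = z] else set0).
  apply/seteqP; split => [x Ox|x [k _ [z _]]]; last first.
    case: ifPn => [/asboolP h /h//|_ h]. by case: h.
  have [e e0 eO] := nbhs_rVP (open_nbhs_nbhs (conj oO Ox)).
  have [k ke] : exists k, k.+1%:R^-1 < e.
    exists (Num.truncn e^-1); rewrite invf_plt ?posrE//.
    by have /truncn_itv/andP[] : 0 <= e^-1 by rewrite invr_ge0 ltW.
  exists k => //; exists (cell k x) => //.
  case: ifPn => // /asboolPn nh; exfalso; apply: nh => y /= yx; apply: eO => i.
  by apply: lt_trans ke; exact: cell_dist.
apply: bigcupT_measurable => k; apply: countable_bigcupT_measurable; first exact: countableP.
by move=> z; case: ifP => // _; exact: measurable_cell.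
Qed.

Lemma measurable_open_prod n (O : set (R * 'rV[R]_n)) : open O -> measurable O.
Proof.
move=> oO; have -> : O = @rV_cons R n @^-1` (@rV_uncons R n @^-1` O).
  by apply/seteqP; split => x /=; rewrite rV_consK.
rewrite -[X in measurable X]setTI; apply: measurable_rV_cons => //.
apply: measurable_open_rV; apply: open_comp => // x _; exact: rV_uncons_continuous.
Qed.

Lemma measurable_compact_prod n (K : set (R * 'rV[R]_n)) : compact K -> measurable K.
Proof.
move=> cK; rewrite -[K]setCK; apply: measurableC; apply: measurable_open_prod.
apply: closed_openC; apply: compact_closed => //; exact: norm_hausdorff.
Qed.

Definition box n (A : R) : set 'rV[R]_n := [set x | forall i, `|x ord0 i| <= A].
Arguments box : clear implicits.

Lemma compact_sub_box n (K : set (R * 'rV[R]_n)) : compact K ->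
  exists A : R, K `<=` `[- A, A]%classic `*` box n A.
Proof.
move=> cK.
have bnd (f : R * 'rV[R]_n -> R) : continuous f -> exists M, forall X, K X -> `|f X| <= M.
  move=> cf; have := compact_bounded (continuous_compact (continuous_subspaceT cf) cK).
  move=> [M [_ hM]]; exists (M + 1) => X KX.
  by apply: (hM (M + 1)); [rewrite ltrDl|exists X].
have cfst : continuous (fst : R * 'rV[R]_n -> R) by move=> -[t x]; exact: cvg_fst.
have [M0 h0] := bnd fst cfst.
have hx i : exists M, forall X, K X -> `|X.2 ord0 i| <= M.
  apply: (bnd (fun X => X.2 ord0 i)) => -[t x].
  apply: (@cvg_comp _ _ _ snd (fun x : 'rV[R]_n => x ord0 i) _ (nbhs x)).
    exact: cvg_snd.
  exact: coord_continuous.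
have [M hM] := choice hx.
exists (`|M0| + \sum_i `|M i|) => -[t x] KX; split => /=.
  rewrite in_itv/= -ler_norml; apply: le_trans (h0 _ KX) _.
  by apply: le_trans (ler_norm _) _; rewrite lerDl sumr_ge0.
move=> i; apply: le_trans (hM i _ KX) _; apply: le_trans (ler_norm _) _.
by rewrite (bigD1 i)//= addrCA lerDl addr_ge0// sumr_ge0.
Qed.

Lemma compact_box n (A : R) : compact (box n A).
Proof.
rewrite (_ : box n A = [set x | forall i, `[- A, A]%classic (x ord0 i)]).
  apply: (@rV_compact R n (fun=> `[- A, A]%classic)).
  by move=> i; exact: segment_compact.
by apply/seteqP; split => x hx i; have := hx i; rewrite /= in_itv/= -ler_norml.
Qed.

Lemma measurable_box n (A : R) : measurable (box n A).
Proof.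
rewrite (_ : box n A = \bigcap_(i in [set: 'I_n]) ((fun x : 'rV[R]_n => x ord0 i) @^-1` `[- A, A]%classic)).
  apply: fin_bigcap_measurable => // i _.
  by rewrite -[X in measurable X]setTI; exact: measurable_coord.
by apply/seteqP; split => x hx i; have := hx i; rewrite /= in_itv/= -ler_norml//; apply.
Qed.

Definition cube n (c : 'rV[R]_n) (r : R) : set 'rV[R]_n :=
  [set x | forall i, `|x ord0 i - c ord0 i| < r].

Lemma measurable_cube n c r : measurable (@cube n c r).
Proof.
rewrite (_ : cube c r = \bigcap_(i in [set: 'I_n]) ((fun x : 'rV[R]_n => x ord0 i) @^-1`
    `]c ord0 i - r, c ord0 i + r[%classic)).
  apply: fin_bigcap_measurable => // i _.
  by rewrite -[X in measurable X]setTI; exact: measurable_coord.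
by apply/seteqP; split => x hx i; have := hx i; rewrite /= in_itv/= -ltr_distl//; apply.
Qed.

(** Cubes, unlike Euclidean balls, are compatible with the recursive construction
of the measure; the measure of balls is only needed up to comparison with
inscribed and circumscribed cubes. *)
Lemma leb_cube n (c : 'rV[R]_n) r : 0 < r -> leb n (cube c r) = ((2 * r) ^+ n)%:E.
Proof.
move=> r0; elim: n c => [|n IH] c.
  by rewrite /= diracE mem_set//; case.
rewrite /= /leb_succ /pushforward.
have -> : @rV_cons R n @^-1` cube c r =
    `]c ord0 ord0 - r, c ord0 ord0 + r[%classic `*` cube (\row_j c ord0 (lift ord0 j)) r.
  apply/seteqP; split => [[t x] /= h|[t x] /= [h1 h2]].
    split => /=.
      by have := h ord0; rewrite mxE unlift_none/= in_itv/= ltr_distl.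
    by move=> i; have := h (lift ord0 i); rewrite !mxE liftK.
  move=> i; case: (unliftP ord0 i) => [j ->|->]; rewrite mxE.
    by rewrite liftK/=; have := h2 j; rewrite mxE.
  by rewrite unlift_none/= ltr_distl; move: h1; rewrite in_itv.
rewrite product_measure1E//; last exact: measurable_cube.
rewrite IH /= lebesgue_measure_itv/= lte_fin ltrD2l gtrN//.
by rewrite -EFinD -EFinM exprS; congr (_ * _)%:E; ring.
Qed.

Lemma stleb_compact_lty n (K : set (R * 'rV[R]_n)) : compact K -> (stleb n K < +oo)%E.
Proof.
move=> cK; have [A KA] := compact_sub_box cK.
pose B : R := `|A| + 1; have B0 : 0 < B by rewrite /B ltr_wpDl.
have AB : A < B by rewrite /B (le_lt_trans (ler_norm A))// ltrDl.
have sub : K `<=` `]- B, B[%classic `*` cube (0 : 'rV[R]_n) B.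
  move=> [t x] /KA[/= tA xA]; have /andP[t1 t2] : - A <= t <= A by rewrite in_itv/= in tA.
  split.
    by rewrite /= in_itv/=; apply/andP; split; lra.
  by move=> i; rewrite mxE subr0; exact: le_lt_trans (xA i) AB.
apply: (@le_lt_trans _ _ (stleb n (`]- B, B[%classic `*` cube (0 : 'rV[R]_n) B))).
  apply: le_measure; rewrite ?inE//; first exact: measurable_compact_prod.
  by apply: measurableX => //; exact: measurable_cube.
rewrite /stleb /= product_measure1E//; last exact: measurable_cube.
by rewrite leb_cube//= lebesgue_measure_itv/=; case: ifP => _; rewrite ?mul0e// -EFinD -EFinM ltry.
Qed.

End rV_sets.
Arguments box {R} n A.

(** * Derivatives of compactly supported functions have integral zero *)

Section integral_of_derivatives.
Context {R : realType}.
Local Notation mu := (@lebesgue_measure R).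

Lemma integrable_bounded_support d (T : measurableType d) (m : {measure set T -> \bar R})
    (D : set T) (f : T -> R) (M : R) : measurable D -> (m D < +oo)%E ->
  measurable_fun setT f -> (forall x, `|f x| <= M) -> (forall x, ~ D x -> f x = 0) ->
  m.-integrable setT (EFin \o f).
Proof.
move=> mD Doo mf fM f0.
have -> : EFin \o f = (EFin \o f) \_ D.
  by apply/funext => x; rewrite /patch/=; case: ifPn => // /negP; rewrite inE => /f0 ->.
apply: (integrable_mkcond _ _).1 => //; apply: measurable_bounded_integrable => //.
  exact: measurable_funTS.
exists M; split; first exact: num_real.
by move=> N MN x _; exact: le_trans (fM x) (ltW MN).
Qed.

(** A directional derivative only depends on the restriction of the function to
a line, so it may be transported between spaces with a common line. *)
Lemma is_derive_line (V W : normedModType R) (f : V -> R) (g : W -> R) x v y w d :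
  (forall h, f (h *: v + x) = g (h *: w + y)) ->
  is_derive x v f d -> is_derive y w g d.
Proof.
move=> fg [df fd].
have e : (fun h : R => h^-1 *: ((f \o shift x) (h *: v) - f x)) =
         (fun h : R => h^-1 *: ((g \o shift y) (h *: w) - g y)).
  apply/funext => h /=; rewrite fg; congr (_ *: (_ - _)).
  by have := fg 0; rewrite !scale0r !add0r.
by split; [rewrite /derivable -e|rewrite -fd /derive -e].
Qed.

Lemma pairr_continuous (U V : topologicalType) (u : U) :
  continuous (fun v : V => (u, v)).
Proof.
move=> v; have h1 : (fun=> u) @ v --> u by exact: cvg_cst.
have h2 : id @ v --> v by exact: cvg_id.
exact: (cvg_pair h1 h2).
Qed.

Lemma pairl_continuous (U V : topologicalType) (v : V) :
  continuous (fun u : U => (u, v)).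
Proof.
move=> u; have h1 : id @ u --> u by exact: cvg_id.
have h2 : (fun=> v) @ u --> v by exact: cvg_cst.
exact: (cvg_pair h1 h2).
Qed.

Lemma integral_derivative0 (f F : R -> R) (A : R) : continuous f ->
  (forall x : R, is_derive x 1 F (f x)) ->
  (forall x, A < `|x| -> F x = 0 /\ f x = 0) ->
  (\int[mu]_x (f x)%:E = 0)%E.
Proof.
move=> cf dF F0; pose B : R := `|A| + 1.
have AB : A < B by rewrite (le_lt_trans (ler_norm A))// ltrDl.
have B0 : 0 < B by rewrite ltr_wpDl.
have cF : continuous F.
  move=> x; apply: differentiable_continuous.
  by apply/derivable1_diffP; case: (dF x).
have -> : (\int[mu]_x (f x)%:E = \int[mu]_(x in `[(- B)%R, B]) (f x)%:E)%E.
  rewrite [RHS]integral_mkcond; apply: eq_integral => x _; rewrite /patch mem_setE in_itv/=.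
  rewrite -ler_norml; case: (leP (`|x : R|)%R B) => // xB.
  by have [_ ->] := F0 x (lt_trans AB xB).
rewrite (@continuous_FTC2 _ f F).
- have [-> _] := F0 B (lt_le_trans AB (ler_norm B)).
  have [-> _] : F (- B) = 0 /\ f (- B) = 0.
    by apply: F0; rewrite normrN (lt_le_trans AB (ler_norm B)).
  by rewrite subee.
- by rewrite gtrN.
- exact: continuous_subspaceT.
- split; first by move=> x _; case: (dF x).
  + by apply: cvg_at_right_filter; exact: cF.
  + by apply: cvg_at_left_filter; exact: cF.
- by move=> x _; rewrite derive1E; case: (dF x).
Qed.

Lemma leb_box_lty n (A : R) : (leb n (box n A) < +oo)%E.
Proof.
have B0 : 0 < `|A| + 1 by rewrite ltr_wpDl.
apply: (@le_lt_trans _ _ (leb n (cube (0 : 'rV[R]_n) (`|A| + 1)))).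
  apply: le_measure; rewrite ?inE//; [exact: measurable_box|exact: measurable_cube|].
  move=> x xA i; rewrite mxE subr0; apply: le_lt_trans (xA i) _.
  by rewrite (le_lt_trans (ler_norm A))// ltrDl.
by rewrite leb_cube// ltry.
Qed.

Lemma integrable_prod n (f : R * 'rV[R]_n -> R) (A M : R) : measurable_fun setT f ->
  (forall X, `|f X| <= M) -> (forall X, ~ (`[- A, A]%classic `*` box n A) X -> f X = 0) ->
  (stleb n).-integrable setT (EFin \o f).
Proof.
move=> mf Mf f0.
apply: (@integrable_bounded_support _ _ (stleb n) (`[- A, A]%classic `*` box n A) f M) => //.
  by apply: measurableX => //; exact: measurable_box.
rewrite /stleb/= product_measure1E//; last exact: measurable_box.
apply: lte_mul_pinfty; [exact: measure_ge0| |exact: leb_box_lty].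
by rewrite /= lebesgue_measure_itv/=; case: ifP.
Qed.

(** Fubini along the coordinate of differentiation and the fundamental theorem of
calculus there. The recursion follows that of the measure: the derivative is
either along the first coordinate or along one of the remaining ones. *)
Lemma integral_partial_derivative n (i : 'I_n) (phi psi : 'rV[R]_n -> R) (A M : R) :
  continuous psi -> (forall x, `|psi x| <= M) ->
  (forall x, is_derive x (delta_mx ord0 i) phi (psi x)) ->
  (forall x, ~ box n A x -> phi x = 0 /\ psi x = 0) ->
  (\int[leb n]_x (psi x)%:E = 0)%E.
Proof.
elim: n i phi psi => [[]//|n IH] i phi psi cpsi Mpsi dphi supp.
have cc : continuous (psi \o @rV_cons R n).
  by move=> X; apply: continuous_comp; [exact: rV_cons_continuous|exact: cpsi].
have supp' X : ~ (`[- A, A]%classic `*` box n A) X -> phi (rV_cons X) = 0 /\ psi (rV_cons X) = 0.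
  move=> nX; apply: supp => bX; apply: nX; case: X bX => a z bX; split => /=.
    by have := bX ord0; rewrite mxE unlift_none/= in_itv/= ler_norml.
  by move=> j; have := bX (lift ord0 j); rewrite mxE liftK.
have ipsi : (stleb n).-integrable setT (EFin \o (psi \o @rV_cons R n)).
  apply: (@integrable_prod _ _ A M); first exact: measurable_continuous_prod.
    by move=> X; exact: Mpsi.
  by move=> X /supp'[].
rewrite /= /leb_succ integral_pushforward//; last 2 first.
- exact: measurable_rV_cons.
- by apply/measurable_EFinP; exact: measurable_continuous_rV.
rewrite preimage_setT -(integral12_prod_meas1 ipsi) /fubini_F.
have slice (a : R) : continuous (fun z : 'rV[R]_n => rV_cons (a, z)).
  move=> z; apply: (@cvg_comp _ _ _ (fun z => (a, z)) (@rV_cons R n) _ (nbhs (a, z))).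
    exact: pairr_continuous.
  exact: rV_cons_continuous.
have slice' (z : 'rV[R]_n) : continuous (fun a : R => rV_cons (a, z)).
  move=> a; apply: (@cvg_comp _ _ _ (fun a => (a, z)) (@rV_cons R n) _ (nbhs (a, z))).
    exact: pairl_continuous.
  exact: rV_cons_continuous.
case: (unliftP ord0 i) dphi => [j ->|->] dphi.
  rewrite integral0_eq// => a _.
  apply: (IH j (fun z => phi (rV_cons (a, z)))).
  - move=> z; apply: (@continuous_comp _ _ _ (fun z => rV_cons (a, z)) psi).
      exact: slice.
    exact: cpsi.
  - by move=> x; exact: Mpsi.
  - move=> z; apply: is_derive_line (dphi (rV_cons (a, z))) => h; congr phi.
    apply/rowP => k; rewrite !mxE/=; case: (unliftP ord0 k) => [k' ->|->].
      by rewrite /= !mxE (inj_eq lift_inj).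
    by rewrite /= mulr0 add0r.
  - by move=> z nz; apply: supp' => -[].
rewrite (Fubini ipsi) integral0_eq// => z _.
apply: (@integral_derivative0 _ (fun a => phi (rV_cons (a, z))) A).
- by move=> a; apply: (@continuous_comp _ _ _ (fun a => rV_cons (a, z)) psi); [exact: slice'|exact: cpsi].
- move=> a; apply: is_derive_line (dphi (rV_cons (a, z))) => h; congr phi.
  apply/rowP => k; rewrite !mxE/=; case: (unliftP ord0 k) => [k' ->|->].
    by rewrite /= mulr0 add0r.
  by rewrite /=.
- move=> a Aa; apply: supp' => -[/=]; rewrite in_itv/= -ler_norml leNgt Aa//.
Qed.

End integral_of_derivatives.

(** * Constants are solutions: the mass of the fundamental solution *)

Section test_function_facts.
Context {R : realType} {d : nat}.
Local Notation space := 'rV[R]_d.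
Local Notation spacetime := (R * 'rV[R]_d)%type.
Implicit Types (a : spacetime -> 'M[R]_d) (Gamma : R -> space -> R -> space -> R) (U K : set spacetime) (phi : spacetime -> R) (v : spacetime).

Lemma derive_off_support K phi v X : compact K -> (forall X, ~ K X -> phi X = 0) ->
  ~ K X -> 'D_v phi X = 0.
Proof.
move=> cK phi0 nK; rewrite -(derive_cst 0 X v); apply: near_eq_derive.
have oK : open (~` K).
  by apply: closed_openC; apply: compact_closed => //; exact: norm_hausdorff.
have := open_nbhs_nbhs (conj oK nK); apply: filterS => Y; exact: phi0.
Qed.

Lemma bounded_of_support K (f : spacetime -> R) : compact K -> continuous f ->
  (forall X, ~ K X -> f X = 0) -> exists M, forall X, `|f X| <= M.
Proof.
move=> cK cf f0.
have [M [_ hM]] := compact_bounded (continuous_compact (continuous_subspaceT cf) cK).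
exists (`|M| + 1) => X; have [KX|/f0 ->] := pselect (K X); last by rewrite normr0 addr_ge0.
by apply: (hM (`|M| + 1)); [rewrite (le_lt_trans (ler_norm M))// ltrDl|exists X].
Qed.

Lemma Rintegral_support U (f : spacetime -> R) : (forall X, ~ U X -> f X = 0) ->
  \int[stleb d]_(X in U) f X = \int[stleb d]_X f X.
Proof.
move=> f0; rewrite Rintegral_mkcond; congr (Rintegral _ _ _); apply/funext => X.
by rewrite /patch; case: ifPn => // /negP; rewrite inE => /f0.
Qed.

(** The directions that occur in the definition of solutions. *)
Definition time_space_dir v := v = dir_t \/ exists i, v = dir_x i.

Lemma rV_uncons_line (h : R) (v X : spacetime) :
  rV_uncons (h *: rV_cons v + rV_cons X) = h *: v + X.
Proof.
case: v X => [v1 v2] [X1 X2]; rewrite /rV_uncons; congr (_, _).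
  by rewrite !mxE unlift_none.
by apply/rowP => j; rewrite !mxE liftK.
Qed.

Lemma rV_unconsK n : cancel (@rV_uncons R n) (@rV_cons R n).
Proof.
move=> x; apply/rowP => i; rewrite mxE; case: (unliftP ord0 i) => [j ->|->] //=.
by rewrite mxE.
Qed.

Lemma rV_cons_dir v : time_space_dir v -> exists i, rV_cons v = delta_mx ord0 i.
Proof.
case=> [->|[j ->]]; [exists ord0|exists (lift ord0 j)]; apply/rowP => k;
  rewrite !mxE/=; case: (unliftP ord0 k) => [k' ->|->] //=.
- by rewrite !mxE.
- by rewrite !mxE (inj_eq lift_inj).
Qed.

(** Space-time is read as a space of row vectors of one more coordinate, whose
measure is by construction the image of the space-time measure. *)
Lemma integral_derive_test U phi v : test_function U phi -> time_space_dir v ->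
  (\int[stleb d]_X ('D_v phi X)%:E = 0)%E.
Proof.
move=> [sphi [K [cK _ phi0]]] vdir.
have [i iE] := rV_cons_dir vdir.
have [A KA] := compact_sub_box cK.
have [cD _] := sphi [:: v].
have [_ dphi] := sphi [::].
have D0 X : ~ K X -> 'D_v phi X = 0 by exact: derive_off_support cK phi0.
have [M hM] := bounded_of_support cK cD D0.
have iD : (stleb d).-integrable setT (EFin \o 'D_v phi).
  apply: (@integrable_prod _ _ _ A M) => //; first exact: measurable_continuous_prod.
  by move=> X nX; apply: D0 => /KA.
have cpsi : continuous ('D_v phi \o @rV_uncons R d).
  by move=> x; apply: continuous_comp; [exact: rV_uncons_continuous|exact: cD].
have := @integral_partial_derivative R d.+1 i (phi \o @rV_uncons R d)
  ('D_v phi \o @rV_uncons R d) A M cpsi.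
rewrite /= /leb_succ integral_pushforward//; last 3 first.
- exact: measurable_rV_cons.
- by apply/measurable_EFinP; exact: measurable_continuous_rV.
- rewrite preimage_setT (_ : _ \o _ = EFin \o 'D_v phi)//.
  by apply/funext => X /=; rewrite rV_consK.
rewrite preimage_setT.
under eq_integral do rewrite /= rV_consK.
apply; first by move=> x; exact: hM.
  move=> x; rewrite -iE.
  apply: (@is_derive_line _ _ _ phi _ (rV_uncons x) v).
    by move=> h /=; rewrite -[in RHS](rV_unconsK x) rV_uncons_line.
  by apply: (DeriveDef _ (erefl _)); exact: dphi.
move=> x nx; have nK : ~ K (rV_uncons x).
  move=> /KA[/= x0 xs]; apply: nx => k; case: (unliftP ord0 k) => [j ->|->].
    by have := xs j; rewrite mxE.
  by rewrite ler_norml; rewrite in_itv in x0.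
by split; [exact: phi0|exact: D0].
Qed.

Lemma weak_derivative_cst U v (c : R) : time_space_dir v ->
  weak_derivative U v (fun=> c) (fun=> 0).
Proof.
move=> vdir phi tphi.
have [sphi [K [cK KU phi0]]] := tphi.
have D0 X : ~ K X -> 'D_v phi X = 0 by exact: derive_off_support cK phi0.
under [in RHS]eq_Rintegral do rewrite mul0r.
rewrite Rintegral_support; last by move=> X nU; rewrite D0 ?mulr0// => /KU.
rewrite (_ : Rintegral _ _ _ = 0); last first.
  have [A KA] := compact_sub_box cK.
  have [cD _] := sphi [:: v].
  have [M hM] := bounded_of_support cK cD D0.
  rewrite RintegralZl//; last first.
    apply: (@integrable_prod _ _ _ A M) => //; first exact: measurable_continuous_prod.
    by move=> X nX; apply: D0 => /KA.
  by rewrite /Rintegral (integral_derive_test tphi vdir) mulr0.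
by rewrite Rintegral_support// /Rintegral integral0 oppr0.
Qed.

Lemma Lp_loc_cst p U (c : R) : Lp_loc p U (fun=> c).
Proof.
split=> [|K cK _]; first exact: measurable_cst.
rewrite integral_cst; last exact: measurable_compact_prod.
by rewrite lte_mul_pinfty ?lee_fin//; exact: stleb_compact_lty.
Qed.

Lemma strong_solution_cst a U (c : R) : strong_solution a U (fun=> c).
Proof.
split=> [X _|]; first exact: cvg_cst.
exists (fun=> 0), (fun _ _ => 0), (fun _ _ _ => 0); split.
- by split=> [|| i|i j]; exact: Lp_loc_cst.
- by apply: weak_derivative_cst; left.
- by move=> i; apply: weak_derivative_cst; right; exists i.
- by move=> i j; apply: weak_derivative_cst; right; exists i.
- apply: aeW => X _; rewrite big1 ?subr0// => i _; rewrite big1// => j _.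
  by rewrite mulr0.
Qed.

Lemma bounded_solution1 a tau : bounded_solution a tau (fun=> 1 : R) (fun=> 1).
Proof.
split; first exact: strong_solution_cst.
  by exists 1 => X _; rewrite normr1.
by move=> z _; exact: cvg_cst.
Qed.

(** Both 1 and the integral of Gamma are bounded solutions with initial value 1,
and such a solution is unique. *)
Lemma fundamental_mass1 a Gamma t x s : fundamental_solution a Gamma -> s < t ->
  (\int[leb d]_z (Gamma t x s z)%:E = 1)%E.
Proof.
move=> fs st.
have id1 : initial_datum (fun _ : space => 1 : R).
  split; first exact: measurable_cst.
    by exists 1 => y; rewrite normr1.
  apply: aeW => y. exact: cst_continuous.
have [_ /(_ _ (bounded_solution1 a s) (t, x) st)/=] := fs_cauchy fs s id1.
under eq_Rintegral do rewrite mulr1.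
rewrite /Rintegral => ->; rewrite fineK//.
by have := integrable_fin_num measurableT (fs_integrable fs x st).
Qed.

End test_function_facts.

(** * Spatial cutoffs and products with functions of time *)

Section spacetime_test_functions.
Context {R : realType} {d : nat}.
Local Notation space := 'rV[R]_d.
Local Notation spacetime := (R * 'rV[R]_d)%type.
Implicit Types (a : spacetime -> 'M[R]_d) (phi psi : spacetime -> R) (v : spacetime).

Lemma functional_sum (V : normedModType R) (I : Type) (r : seq I) (L : I -> V -> R) :
  (forall i, functional (L i)) -> functional (fun X => \sum_(i <- r) L i X).
Proof.
move=> fL; elim: r => [|i r [IHl IHc]].
  have -> : (fun X => \sum_(i <- [::]) L i X) = (fun=> 0).
    by apply/funext => X; rewrite big_nil.
  by split=> [c u v|X]; [rewrite mulr0 addr0|exact: cvg_cst].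
have -> : (fun X => \sum_(i <- i :: r) L i X) = (fun X => L i X + \sum_(i <- r) L i X).
  by apply/funext => X; rewrite big_cons.
have [iL iC] := fL i; split=> [c u v|X]; first by rewrite iL IHl; ring.
by apply: cvgD; [exact: iC|exact: IHc].
Qed.

Lemma functional_scale (V : normedModType R) (c : R) (L : V -> R) :
  functional L -> functional (fun X => c * L X).
Proof.
move=> [lL cL]; split=> [k u v|X]; first by rewrite lL; ring.
by apply: cvgM; [exact: cvg_cst|exact: cL].
Qed.

Lemma functional_fst : functional (fun X : spacetime => X.1).
Proof. by split=> [//|[s z]]; exact: cvg_fst. Qed.

Lemma functional_coord i : functional (fun X : spacetime => X.2 ord0 i).
Proof.
split=> [c u v|[s z]]; first by rewrite !mxE.
apply: (@cvg_comp _ _ _ snd (fun x : space => x ord0 i) _ (nbhs z)).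
  exact: cvg_snd.
exact: coord_continuous.
Qed.

Definition spacetime_form (c : R) (al : space) (X : spacetime) : R :=
  c * X.1 + \sum_i al ord0 i * X.2 ord0 i.

Lemma functional_spacetime_form c al : functional (spacetime_form c al).
Proof.
have f1 := functional_scale c functional_fst.
have f2 : functional (fun X : spacetime => \sum_i al ord0 i * X.2 ord0 i).
  by apply: functional_sum => i; apply: functional_scale; exact: functional_coord.
split=> [k u v|X]; first by rewrite /spacetime_form f1.1 f2.1; ring.
by apply: cvgD; [exact: f1.2|exact: f2.2].
Qed.

Lemma tame_prod (V : normedModType R) (I : Type) (r : seq I)
    (f : I -> nat -> V -> R) (l : I -> V -> R) : (forall i, tame (f i) (l i)) ->
  tame (fun n X => \prod_(i <- r) f i n X) (fun X => \prod_(i <- r) l i X).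
Proof.
move=> t; elim: r => [|i r IH].
  rewrite (_ : (fun n X => _) = (fun _ _ => 1)); last first.
    by apply/funext => n; apply/funext => X; rewrite big_nil.
  rewrite (_ : (fun X => _) = (fun=> 1)); last by apply/funext => X; rewrite big_nil.
  by apply: (@tame_cst _ _ (fun=> 1)); exact: cvg_cst.
rewrite (_ : (fun n X => _) = (fun n X => f i n X * \prod_(i <- r) f i n X)); last first.
  by apply/funext => n; apply/funext => X; rewrite big_cons.
rewrite (_ : (fun X => _) = (fun X => l i X * \prod_(i <- r) l i X)); last first.
  by apply/funext => X; rewrite big_cons.
exact: tame_mul.
Qed.

Lemma tame_functional (V : normedModType R) (g : R -> R) (b : R) (L : V -> R) :
  bsmooth g -> functional L -> tame (fun _ X => g (b + L X)) (fun X => g (b + L X)).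
Proof.
move=> gs fL; apply: (@tame_comp _ _ g (fun=> b) b (fun=> L) L) => //; first exact: cvg_cst.
by move=> v; exact: cvg_cst.
Qed.

(** Equal to 0 when some coordinate exceeds n + 1 in absolute value, and tending
to 1. The factor exp 2 compensates [flat 1] at 1, which is exp (-1), in both
factors. *)
Definition cutoff (n : nat) (X : spacetime) : R :=
  \prod_(i < d) (expR 2 * (flat 1 (1 + n.+1%:R^-1 * X.2 ord0 i)
                           * flat 1 (1 + (- n.+1%:R^-1) * X.2 ord0 i))).

(** The slopes 1/(n+1) of the affine forms tend to 0, so all derivatives of the
cutoffs tend to those of the constant 1. *)
Lemma tame_cutoff : tame cutoff (fun=> 1).
Proof.
have -> : (fun=> 1) = (fun X : spacetime => \prod_(i < d)
   (expR 2 * (flat 1 (1 + 0 * X.2 ord0 i) * flat 1 (1 + 0 * X.2 ord0 i)))) :> (spacetime -> R).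
  apply/funext => X; rewrite big1// => i _.
  rewrite mul0r addr0 /flat ltr01 -polyC1 hornerC invr1 mul1r -!expRD.
  by rewrite (_ : 2 + _ = 0) ?expR0//; ring.
have h : (n.+1%:R^-1 : R) @[n --> \oo] --> 0 by exact: cvg_harmonic.
apply: tame_prod => i; apply: tame_mul.
  by apply: (@tame_cst _ _ (fun=> expR 2)); exact: cvg_cst.
have fc := functional_coord i.
apply: tame_mul.
  apply: (@tame_comp _ _ (flat 1) (fun=> 1) 1 (fun n (X : spacetime) => n.+1%:R^-1 * X.2 ord0 i)
    (fun X => 0 * X.2 ord0 i)).
  - exact: bsmooth_flat.
  - exact: cvg_cst.
  - by move=> n; exact: functional_scale fc.
  - exact: functional_scale fc.
  - by move=> v; apply: cvgM => //; exact: cvg_cst.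
apply: (@tame_comp _ _ (flat 1) (fun=> 1) 1 (fun n (X : spacetime) => (- n.+1%:R^-1) * X.2 ord0 i)
    (fun X => 0 * X.2 ord0 i)).
- exact: bsmooth_flat.
- exact: cvg_cst.
- by move=> n; exact: functional_scale fc.
- exact: functional_scale fc.
- by move=> v; apply: cvgM; [rewrite -oppr0; exact: cvgN|exact: cvg_cst].
Qed.

Lemma cutoff_eq0 n X : ~ box d n.+1%:R X.2 -> cutoff n X = 0.
Proof.
move=> /existsNP[i /negP]; rewrite -ltNge => Xi.
rewrite /cutoff (bigD1 i)//= (_ : flat 1 _ * flat 1 _ = 0) ?mulr0 ?mul0r//.
have n0 : 0 < n.+1%:R :> R by [].
case: (ger0P (X.2 ord0 i)) Xi => x0 Xi.
  rewrite [X in _ * X]flat1_eq0 ?mulr0// mulNr subr_le0 mulrC ler_pdivlMr// mul1r.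
  exact: ltW.
rewrite flat1_eq0 ?mul0r// mulrC -lerBrDl sub0r ler_pdivrMr// mulN1r lerNr.
exact: ltW.
Qed.

Lemma P_smooth_time_mul a (eta eta' : R -> R) psi X :
  (forall x : R, is_derive x 1 eta (eta' x)) ->
  (forall v X, derivable psi X v) -> (forall w v X, derivable ('D_w psi) X v) ->
  P_smooth a (fun X => eta X.1 * psi X) X =
    eta' X.1 * psi X + eta X.1 * P_smooth a psi X.
Proof.
move=> deta d1 d2.
have de v Y : is_derive Y v (fun Z : spacetime => eta Z.1) (v.1 * eta' Y.1).
  have := @is_derive_affine _ _ eta 0 _ Y v (eta' Y.1) functional_fst.
  under eq_fun do rewrite add0r; rewrite add0r; apply; exact: deta.
have dm v phi Y : (forall X, derivable phi X v) ->
    'D_v (fun Z => eta Z.1 * phi Z) Y = eta Y.1 * 'D_v phi Y + phi Y * (v.1 * eta' Y.1).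
  move=> dphi; have [e1 e2] := de v Y.
  rewrite (_ : (fun Z => _) = (fun Z : spacetime => eta Z.1) * phi)// deriveM//.
  by rewrite e2.
have dmx i phi : (forall v X, derivable phi X v) ->
    'D_(dir_x i) (fun Z => eta Z.1 * phi Z) = (fun Y => eta Y.1 * 'D_(dir_x i) phi Y).
  by move=> dphi; apply/funext => Y; rewrite dm// mul0r mulr0 addr0.
rewrite /P_smooth dm// mul1r mulrBr mulr_sumr.
rewrite (_ : \sum_i \sum_j _ = \sum_i eta X.1 * (\sum_j a X i j * 'D_(dir_x i) ('D_(dir_x j) psi) X)).
  ring.
apply: eq_bigr => i _; rewrite mulr_sumr; apply: eq_bigr => j _.
rewrite (dmx j psi)// (dm _ ('D_(dir_x j) psi)); last by move=> ?; exact: d2.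
by rewrite /= mul0r mulr0 addr0 mulrCA.
Qed.

End spacetime_test_functions.

(** * The operator on tame sequences *)

Section elliptic_coefficients.
Context {R : realType} {d : nat}.
Local Notation spacetime := (R * 'rV[R]_d)%type.
Implicit Types (a : spacetime -> 'M[R]_d).

Lemma quad_formE (A : 'M[R]_d) (xi : 'rV[R]_d) :
  \sum_i \sum_j A i j * xi ord0 i * xi ord0 j = (xi *m A *m xi^T) ord0 ord0.
Proof.
rewrite mxE exchange_big/=; apply: eq_bigr => j _.
rewrite !mxE mulr_suml; apply: eq_bigr => i _.
by rewrite [A i j * _]mulrC.
Qed.

Lemma enorm_sqr (x : 'rV[R]_d) : enorm x ^+ 2 = \sum_i x ord0 i ^+ 2.
Proof. by rewrite sqr_sqrtr// sumr_ge0// => i _; exact: sqr_ge0. Qed.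

Lemma enorm_delta i : enorm (delta_mx ord0 i : 'rV[R]_d) ^+ 2 = 1.
Proof.
rewrite enorm_sqr (bigD1 i)//= mxE !eqxx expr1n big1 ?addr0// => j /negbTE ji.
by rewrite mxE ji/= expr0n.
Qed.

(** The diagonal entries are values of the quadratic form at basis vectors; its
positivity on e_i + e_j and e_i - e_j controls the others by the diagonal
ones. *)
Lemma elliptic_entry_le lambda Lambda a : 0 < lambda -> elliptic lambda Lambda a ->
  forall X i j, `|a X i j| <= Lambda.
Proof.
move=> l0 [_ sa ea] X i j.
have bil k l : (delta_mx ord0 k *m a X *m (delta_mx ord0 l : 'rV[R]_d)^T) ord0 ord0 = a X k l.
  rewrite mxE (bigD1 l)//= big1 ?addr0; last first.
    by move=> m /negbTE ml; rewrite !mxE ml/= mulr0.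
  rewrite !mxE !eqxx mulr1 (bigD1 k)//= big1 ?addr0; last first.
    by move=> m /negbTE mk; rewrite !mxE mk/= mul0r.
  by rewrite !mxE !eqxx mul1r.
have diag k : a X k k <= Lambda.
  by have /andP[_] := ea X (delta_mx ord0 k); rewrite quad_formE bil enorm_delta mulr1.
(* The form at e_i + c e_j, to be used with c = 1 and c = -1. *)
have q (c : R) : 0 <= a X i i + c * a X i j + (c * a X j i + c * (c * a X j j)).
  have /andP[+ _] := ea X (delta_mx ord0 i + c *: delta_mx ord0 j).
  rewrite quad_formE; set Q := (_ *m _ *m _) _ _.
  have -> : Q = a X i i + c * a X i j + (c * a X j i + c * (c * a X j j)).
    rewrite /Q linearD linearZ/= !mulmxDl !mulmxDr -!scalemxAl -!scalemxAr.
    have addE (A B : 'M[R]_1) : (A + B) ord0 ord0 = A ord0 ord0 + B ord0 ord0 by rewrite mxE.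
    have scaleE (k : R) (A : 'M[R]_1) : (k *: A) ord0 ord0 = k * A ord0 ord0 by rewrite mxE.
    rewrite !addE !scaleE. rewrite !bil; ring.
  by apply: le_trans; rewrite mulr_ge0 ?sqr_ge0// ltW.
have := q 1; have := q (-1); rewrite (sa X j i) => q1 q2.
have := diag i; have := diag j => d1 d2.
by rewrite ler_norml; apply/andP; split; lra.
Qed.

Lemma measurable_P_smooth lambda Lambda a psi : elliptic lambda Lambda a ->
  tame (fun=> psi) psi -> measurable_fun setT (P_smooth a psi).
Proof.
move=> [ma _ _] tpsi; apply: measurable_funB.
  apply: measurable_continuous_prod.
  by have [_ _ t] := tame_derive dir_t tpsi; exact: tame_continuous t 0%N.
apply: measurable_sum => i; apply: measurable_sum => j; apply: measurable_funM.
  exact: ma.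
apply: measurable_continuous_prod.
have [_ _ t] := tame_derive (dir_x j) tpsi.
by have [_ _ t'] := tame_derive (dir_x i) t; exact: tame_continuous t' 0%N.
Qed.

Lemma P_smooth_bounded lambda Lambda a f l : 0 < lambda -> elliptic lambda Lambda a ->
  tame f l -> exists M, forall n X, `|P_smooth a (f n) X| <= M.
Proof.
move=> l0 ea tf.
have [_ _ /tame_bounded[M0 h0]] := tame_derive dir_t tf.
have h i j : exists M, forall n X, `|'D_(dir_x i) ('D_(dir_x j) (f n)) X| <= M.
  have [_ _ t] := tame_derive (dir_x j) tf.
  by have [_ _ /tame_bounded[M hM]] := tame_derive (dir_x i) t; exists M.
have [M1 h1] := choice (fun ij => h ij.1 ij.2).
exists (M0 + \sum_i \sum_j Lambda * M1 (i, j)) => n X.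
apply: le_trans (ler_normB _ _) _; apply: lerD => //.
apply: le_trans (ler_norm_sum _ _ _) _; apply: ler_sum => i _.
apply: le_trans (ler_norm_sum _ _ _) _; apply: ler_sum => j _.
by rewrite normrM; apply: ler_pM => //; [exact: elliptic_entry_le l0 ea _ _ _|exact: (h1 (i, j))].
Qed.

Lemma cvgn_sum (I : Type) (r : seq I) (f : nat -> I -> R) (l : I -> R) :
  (forall i, f n i @[n --> \oo] --> l i) ->
  \sum_(i <- r) f n i @[n --> \oo] --> \sum_(i <- r) l i.
Proof.
move=> fl; elim: r => [|i r IH].
  rewrite big_nil (_ : (fun n => _) = (fun=> 0)); first exact: cvg_cst.
  by apply/funext => n; rewrite big_nil.
rewrite big_cons (_ : (fun n => _) = (fun n => f n i + \sum_(i <- r) f n i)).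
  exact: cvgD.
by apply/funext => n; rewrite big_cons.
Qed.

Lemma P_smooth_cvg a f l : tame f l ->
  forall X, P_smooth a (f n) X @[n --> \oo] --> P_smooth a l X.
Proof.
move=> tf X; apply: cvgB.
  by have [_ _ /tame_cvg] := tame_derive dir_t tf; apply.
apply: cvgn_sum => i; apply: cvgn_sum => j; apply: cvgM; first exact: cvg_cst.
have [_ _ t] := tame_derive (dir_x j) tf.
by have [_ _ /tame_cvg] := tame_derive (dir_x i) t; apply.
Qed.

End elliptic_coefficients.

(** * The adjoint equation tested with functions of noncompact support *)

Section spacetime_fubini.
Context {R : realType} {d : nat}.
Local Notation mu := (@lebesgue_measure R).
Local Open Scope ereal_scope.

Lemma stleb_tonelli (f : R * 'rV[R]_d -> \bar R) : measurable_fun setT f ->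
  (forall X, 0 <= f X) ->
  \int[stleb d]_X f X = \int[mu]_s \int[leb d]_z f (s, z).
Proof. exact: (@fubini_tonelli1 _ _ (measurableTypeR R) _ R mu (leb d)). Qed.

Lemma measurable_slice_integral (f : R * 'rV[R]_d -> \bar R) : measurable_fun setT f ->
  (forall X, 0 <= f X) ->
  measurable_fun setT (fun s => \int[leb d]_z f (s, z)).
Proof. exact: (@measurable_fun_fubini_tonelli_F _ _ (measurableTypeR R) _ R (leb d)). Qed.

Lemma stleb_fubini (f : R * 'rV[R]_d -> \bar R) : (stleb d).-integrable setT f ->
  \int[stleb d]_X f X = \int[mu]_s \int[leb d]_z f (s, z).
Proof. by move=> /(@integral12_prod_meas1 _ _ (measurableTypeR R) _ R mu (leb d)). Qed.

End spacetime_fubini.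

Section adjoint_kernel.
Context {R : realType} {d : nat}.
Local Notation space := 'rV[R]_d.
Local Notation spacetime := (R * 'rV[R]_d)%type.
Local Notation mu := (@lebesgue_measure R).
Variables (a : spacetime -> 'M[R]_d) (lambda Lambda : R).
Variables (Gamma : R -> space -> R -> space -> R) (t : R) (x : space).
Hypotheses (lambda_gt0 : 0 < lambda) (ella : elliptic lambda Lambda a).
Hypothesis fsG : fundamental_solution a Gamma.

(** The kernel extended by 0 to the future of t, so that it may be integrated over
the whole space-time. *)
Definition kern (Y : spacetime) : R := if Y.1 < t then Gamma t x Y.1 Y.2 else 0.

Lemma kern_ge0 Y : 0 <= kern Y.
Proof. by rewrite /kern; case: ifP => // _; exact: fs_ge0 fsG _ _ _ _. Qed.

Lemma measurable_past : measurable [set Y : spacetime | Y.1 < t].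
Proof.
rewrite (_ : mkset _ = `]-oo, t[%classic `*` setT); first exact: measurableX.
by apply/seteqP; split => [Y /= Yt|Y [/=]]; [split => //=; rewrite in_itv|rewrite in_itv].
Qed.

Lemma measurable_kern : measurable_fun [set: spacetime] kern.
Proof.
have [[mG _] _] := fs_adjoint fsG t x.
have -> : kern = (fun Y => Gamma t x Y.1 Y.2) \_ [set Y | Y.1 < t].
  by apply/funext => Y; rewrite /kern /patch mem_setE.
exact: (measurable_restrictT _ measurable_past).1.
Qed.

Lemma measurable_kern_slice s : measurable_fun [set: space] (fun z => kern (s, z)).
Proof. by apply: (measurableT_comp measurable_kern); exact: pair1_measurable. Qed.

Lemma kern_mass s : s < t -> (\int[leb d]_z (kern (s, z))%:E = 1)%E.
Proof.
move=> st; rewrite -(fundamental_mass1 x fsG st); apply: eq_integral => z _.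
by rewrite /kern/= st.
Qed.

Lemma kern_mass_le1 s : (\int[leb d]_z (kern (s, z))%:E <= 1)%E.
Proof.
have [st|ts] := ltP s t; first by rewrite kern_mass.
by under eq_integral do rewrite /kern/= ltNge ts/=; rewrite integral0.
Qed.

(** The kernel has mass at most 1 at every time, so boundedness in space suffices
for integrability as soon as the time is confined to a bounded interval. *)
Lemma integrable_kern_mul (F : spacetime -> R) (M s1 s2 : R) :
  measurable_fun setT F -> (forall X, `|F X| <= M) ->
  (forall X, X.1 \notin `[s1, s2] -> F X = 0) ->
  (stleb d).-integrable setT (fun X => (kern X * F X)%:E).
Proof.
move=> mF FM F0.
have M0 : 0 <= M by apply: le_trans (FM (0, 0)).
have m1 : measurable_fun setT (fun X : spacetime => \1_(`[s1, s2]%classic) X.1 : R).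
  exact: measurableT_comp.
pose D (X : spacetime) : \bar R := (kern X * (M * \1_(`[s1, s2]%classic) X.1))%:E.
have mD : measurable_fun setT D.
  apply/measurable_EFinP; apply: measurable_funM; first exact: measurable_kern.
  exact: measurable_funM.
have D0 X : (0 <= D X)%E.
  by rewrite lee_fin mulr_ge0 ?kern_ge0// mulr_ge0.
have iD : (stleb d).-integrable setT D.
  apply/integrableP; split => //.
  under eq_integral do rewrite gee0_abs//.
  rewrite (stleb_tonelli mD D0).
  apply: (@le_lt_trans _ _ (\int[mu]_s (M * \1_(`[s1, s2]%classic) s)%:E)%E).
    apply: ge0_le_integral => //=.
    - by move=> s _; apply: integral_ge0 => z _; exact: D0.
    - exact: measurable_slice_integral.
    - by apply/measurable_EFinP; exact: measurable_funM.
    - move=> s _; rewrite /D/=.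
      under eq_integral do rewrite mulrC EFinM.
      rewrite ge0_integralZl_EFin//.
      + rewrite -[leRHS]mule1; apply: lee_wpmul2l; last exact: kern_mass_le1.
        by rewrite lee_fin mulr_ge0.
      + by move=> z _; rewrite lee_fin kern_ge0.
      + by apply/measurable_EFinP; exact: measurable_kern_slice.
      + by rewrite mulr_ge0.
  under eq_integral do rewrite EFinM.
  rewrite ge0_integralZl_EFin//; last exact/measurable_EFinP.
  rewrite integral_indic// setIT.
  rewrite lte_mul_pinfty//= lebesgue_measure_itv/=; case: ifP => // _.
  by rewrite -EFinD ltry.
apply: (le_integrable _ _ _ iD) => //.
  apply/measurable_EFinP; apply: measurable_funM => //; exact: measurable_kern.
move=> X _; rewrite (gee0_abs (D0 X)) lee_fin normrM ger0_norm ?kern_ge0//.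
apply: ler_wpM2l; first exact: kern_ge0.
rewrite indicE mem_setE; case: (boolP (X.1 \in `[s1, s2])) => [_|/F0 ->].
  by rewrite mulr1.
by rewrite normr0 mulr0.
Qed.

(** The adjoint equation extends to test functions eta(s) psi(s,z) with no decay
in space: for the truncations of psi by the cutoffs it is the definition, and
the tame convergence together with the unit mass of the kernel allows the
dominated convergence theorem. Restricting to product functions makes the time
derivative of eta appear separately. *)
Lemma kern_adjoint (eta eta' : R -> R) (psi : spacetime -> R) (s1 s2 : R) :
  s2 < t -> bsmooth eta -> (forall s : R, is_derive s 1 eta (eta' s)) ->
  (forall s, s \notin `[s1, s2] -> eta s = 0 /\ eta' s = 0) ->
  tame (fun=> psi) psi ->
  (\int[stleb d]_X (kern X * (eta' X.1 * psi X + eta X.1 * P_smooth a psi X))%:E = 0)%E.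
Proof.
move=> s2t beta deta eta0 tpsi.
pose psin n (X : spacetime) := cutoff n X * psi X.
have tpsin : tame psin psi.
  have -> : psi = (fun X => 1 * psi X) by apply/funext => X; rewrite mul1r.
  by apply: tame_mul; first exact: tame_cutoff.
have teta : tame (fun _ (X : spacetime) => eta X.1) (fun X : spacetime => eta X.1).
  have := @tame_functional R _ eta 0 _ beta (@functional_fst R d).
  rewrite (_ : (fun X : spacetime => eta (0 + X.1)) = (fun X => eta X.1))//.
  by apply/funext => X; rewrite add0r.
have tPhi : tame (fun n X => eta X.1 * psin n X) (fun X => eta X.1 * psi X).
  exact: tame_mul.
have Pmul n X : P_smooth a (fun Y => eta Y.1 * psin n Y) X =
    eta' X.1 * psin n X + eta X.1 * P_smooth a (psin n) X.
  apply: P_smooth_time_mul => //.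
    by move=> v Y; have [+ _ _] := tame_derive v tpsin; apply.
  by move=> w v Y; have [_ _ t1] := tame_derive w tpsin;
    have [+ _ _] := tame_derive v t1; apply.
have beta' : bsmooth eta'.
  have [g bg dg] := bsmooth_deriv beta.
  rewrite (_ : eta' = g)//; apply/funext => s.
  by have [_ <-] := deta s; have [_ <-] := dg s.
have meta' : measurable_fun setT (fun X : spacetime => eta' X.1).
  apply: measurableT_comp => //; apply: continuous_measurable_fun.
  exact: bsmooth_continuous.
have meta : measurable_fun setT (fun X : spacetime => eta X.1).
  apply: measurableT_comp => //; apply: continuous_measurable_fun.
  exact: bsmooth_continuous.
pose F n X := eta' X.1 * psin n X + eta X.1 * P_smooth a (psin n) X.
have mF n : measurable_fun setT (F n).
  have t1 : tame (fun=> psin n) (psin n).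
    exact: (tame_const tpsin).
  apply: measurable_funD; apply: measurable_funM => //.
    by apply: measurable_continuous_prod; exact: tame_continuous tpsin n.
  exact: measurable_P_smooth ella t1.
have [M1 h1] := tame_bounded tpsin.
have [M2 h2] := P_smooth_bounded lambda_gt0 ella tpsin.
have bsb (g : R -> R) : bsmooth g -> exists M, forall s, `|g s| <= M.
  by move=> [G [<- _ /(_ 0%N)]].
have [Me he] := bsb _ beta; have [Me' he'] := bsb _ beta'.
have FM n X : `|F n X| <= Me' * M1 + Me * M2.
  apply: le_trans (ler_normD _ _) _; rewrite (normrM (eta' _)) (normrM (eta _)).
  by apply: lerD; apply: ler_pM.
have F0 n X : X.1 \notin `[s1, s2] -> F n X = 0.
  by move=> /eta0[e0 e0']; rewrite /F e0 e0' !mul0r addr0.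
have iF n := integrable_kern_mul (mF n) (FM n) (F0 n).
have adj n : (\int[stleb d]_X (kern X * F n X)%:E = 0)%E.
  have test : test_function [set Y : spacetime | Y.1 < t] (fun X => eta X.1 * psin n X).
    split; first exact: tame_smooth tPhi n.
    exists (`[s1, s2]%classic `*` box d n.+1%:R); split.
    - by apply: compact_setX; [exact: segment_compact|exact: compact_box].
    - move=> X [/= + _]; rewrite in_itv/= => /andP[_ Xs2]; exact: le_lt_trans Xs2 s2t.
    - move=> X nX; have [X1|/eta0[-> _]] := boolP (X.1 \in `[s1, s2]); last by rewrite mul0r.
      by rewrite /psin cutoff_eq0 ?mul0r ?mulr0// => X2; apply: nX.
  have := (fs_adjoint fsG t x).2 _ test.
  rewrite Rintegral_mkcond (_ : _ \_ _ = (fun X => kern X * F n X)); last first.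
    apply/funext => X; rewrite /patch /kern; case: (boolP (X.1 < t)) => Xt.
      by rewrite mem_set//= Pmul.
    by rewrite memNset ?mul0r//; exact/negP.
  move=> int0; rewrite -(fineK (integrable_fin_num measurableT (iF n))).
  by congr (_%:E); exact: int0.
have cF X : F n X @[n --> \oo] --> eta' X.1 * psi X + eta X.1 * P_smooth a psi X.
  have c1 : psin n X @[n --> \oo] --> psi X by have := tame_cvg tpsin; apply.
  have c2 : P_smooth a (psin n) X @[n --> \oo] --> P_smooth a psi X.
    exact: P_smooth_cvg.
  exact: (cvgD (cvgM (cvg_cst (eta' X.1)) c1) (cvgM (cvg_cst (eta X.1)) c2)).
pose C := Me' * M1 + Me * M2.
have C0 : 0 <= C by exact: le_trans (FM 0%N (0, 0)).
pose D (X : spacetime) : R := C * \1_(`[s1, s2]%classic) X.1.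
have iD : (stleb d).-integrable setT (fun X => (kern X * D X)%:E).
  apply: (@integrable_kern_mul D C s1 s2).
  - by apply: measurable_funM => //; exact: measurableT_comp.
  - move=> X; rewrite /D normrM (ger0_norm C0) ler_piMr// indicE.
    by case: (_ \in _); rewrite ?normr1 ?normr0.
  - by move=> X nX; rewrite /D indicE mem_setE (negbTE nX) mulr0.
have cv : (\int[stleb d]_X (kern X * F n X)%:E)%E @[n --> \oo] -->
    (\int[stleb d]_X (kern X * (eta' X.1 * psi X + eta X.1 * P_smooth a psi X))%:E)%E.
  apply: (@dominated_cvg _ _ _ (stleb d) _ measurableT _ _
    (fun X => (kern X * D X)%:E)) => //.
  - by move=> n; have /integrableP[] := iF n.
  - move=> X _; apply: cvg_EFin; first by near=> n.
    exact: (cvgM (cvg_cst (kern X)) (cF X)).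
  - move=> n X _; rewrite lee_fin normrM ger0_norm ?kern_ge0// ler_wpM2l ?kern_ge0//.
    rewrite /D indicE mem_setE; case: (boolP (X.1 \in `[s1, s2])) => [_|/F0 ->].
      by rewrite mulr1.
    by rewrite normr0 mulr0.
by rewrite -(cvg_lim (@ereal_hausdorff R) cv) (funext adj) lim_cst.
Unshelve. all: by end_near. Qed.

End adjoint_kernel.

(** * Comparison at Lebesgue points *)

Section lebesgue_points.
Context {R : realType}.
Local Notation mu := (@lebesgue_measure R).

Lemma bounded_integrable_ball (f : R -> R) (M x h : R) : measurable_fun setT f ->
  (forall y, `|f y| <= M) -> mu.-integrable (ball x h) (EFin \o f).
Proof.
move=> mf fM; apply: measurable_bounded_integrable.
- exact: measurable_ball.
- rewrite ball_itv/= lebesgue_measure_itv/=; case: ifP => // _.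
  by rewrite -EFinD ltry.
- exact: measurable_funTS.
- exists M; split; first exact: num_real.
  by move=> N MN y _; exact: le_trans (fM y) (ltW MN).
Qed.

(** At a Lebesgue point the average of the distance to the value tends to 0, a
fortiori the averages tend to the value. *)
Lemma cvg_average_lebesgue_pt (f : R -> R) (M x : R) : measurable_fun setT f ->
  (forall y, `|f y| <= M) -> lebesgue_pt f x ->
  (h *+ 2)^-1 * \int[mu]_(y in ball x h) f y @[h --> (0:R)^'+] --> f x.
Proof.
move=> mf fM lf; apply/cvgrPdist_le => e e0; near=> h.
have h0 : 0 < h by near: h; exact: nbhs_right_gt.
have h20 : 0 < h *+ 2 by rewrite mulrn_wgt0.
have : (davg f x h < e%:E)%E.
  near: h; have n0 : nbhs (0%:E : \bar R) [set y | (y < e%:E)%E].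
    exact: (@nbhs_open_ereal_lt _ 0 (fun=> e)).
  exact: lf n0.
have fin : (mu (ball x h) = (h *+ 2)%:E)%E by rewrite lebesgue_measure_ball// ltW.
rewrite /davg /iavg fin inver gt_eqF//.
have ic := bounded_integrable_ball x h mf fM.
have i1 : mu.-integrable (ball x h) (EFin \o (fun=> f x)).
  by apply: (@bounded_integrable_ball _ `|f x|) => //; exact: measurable_cst.
have iB : mu.-integrable (ball x h) (EFin \o (fun y => f y - f x)).
  rewrite (_ : EFin \o _ = (EFin \o f) \- (EFin \o (fun=> f x)))%E//.
  by apply: integrableB => //; exact: measurable_ball.
have iN : mu.-integrable (ball x h) (EFin \o (fun y => `|f y - f x|)).
  exact: integrable_norm.
have -> : (\int[mu]_(y in ball x h) `|((center (f x) \o f) y)%:E|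
     = (\int[mu]_(y in ball x h) `|f y - f x|)%:E)%E.
  by rewrite /Rintegral fineK//; apply: integrable_fin_num iN; exact: measurable_ball.
rewrite -EFinM lte_fin => /ltW; apply: le_trans.
have cstI : \int[mu]_(y in ball x h) f x = f x * (h *+ 2).
  rewrite /Rintegral integral_cst; last exact: measurable_ball.
  by rewrite [X in (_ * X)%E]fin -EFinM.
have -> : f x - (h *+ 2)^-1 * \int[mu]_(y in ball x h) f y =
   - ((h *+ 2)^-1 * \int[mu]_(y in ball x h) (f y - f x)).
  rewrite RintegralB//; last exact: measurable_ball.
  rewrite cstI; field; exact: lt0r_neq0.
have ih0 : 0 <= (h *+ 2)^-1 by rewrite invr_ge0 ltW.
rewrite normrN normrM (ger0_norm ih0); apply: ler_wpM2l => //.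
by apply: le_normr_Rintegral => //; exact: measurable_ball.
Unshelve. all: by end_near. Qed.

Lemma ae_lebesgue_pt_bounded (f : R -> R) (M : R) : measurable_fun setT f ->
  (forall y, `|f y| <= M) -> {ae mu, forall x, lebesgue_pt f x}.
Proof.
move=> mf fM; apply: lebesgue_differentiation; split => //; first exact: openT.
move=> K _ cK; have := @measurable_bounded_integrable _ _ R mu f K.
have mK : measurable K by exact: compact_measurable.
move=> /(_ mK (compact_finite_measure cK) (measurable_funTS mf)).
have bf : [bounded f x | x in K].
  exists M; split; first exact: num_real.
  by move=> N MN y _; exact: le_trans (fM y) (ltW MN).
by move=> /(_ bf)/integrableP[_].
Qed.

Lemma le_of_window_averages (f : R -> R) (M s1 s2 e : R) : 0 < e -> measurable_fun setT f ->
  (forall y, `|f y| <= M) -> lebesgue_pt f s1 -> lebesgue_pt f s2 ->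
  (forall h, 0 < h -> h < e ->
    \int[mu]_(y in ball s1 h) f y <= \int[mu]_(y in ball s2 h) f y) ->
  f s1 <= f s2.
Proof.
move=> e0 mf fM l1 l2 win.
apply: (ler_cvg_to (cvg_average_lebesgue_pt mf fM l1) (cvg_average_lebesgue_pt mf fM l2)).
near=> h; have h0 : 0 < h by near: h; exact: nbhs_right_gt.
apply: ler_wpM2l; first by rewrite invr_ge0 mulrn_wge0// ltW.
by apply: win => //; near: h; exact: nbhs_right_lt.
Unshelve. all: by end_near. Qed.

End lebesgue_points.

(** * Means of a supersolution are monotone in time *)

Section supersolution_means.
Context {R : realType} {d : nat}.
Local Notation space := 'rV[R]_d.
Local Notation spacetime := (R * 'rV[R]_d)%type.
Local Notation mu := (@lebesgue_measure R).
Variables (a : spacetime -> 'M[R]_d) (lambda Lambda : R).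
Variables (Gamma : R -> space -> R -> space -> R) (t : R) (x : space).
Hypotheses (lambda_gt0 : 0 < lambda) (ella : elliptic lambda Lambda a).
Hypothesis fsG : fundamental_solution a Gamma.
Variable psi : spacetime -> R.
Hypotheses (tpsi : tame (fun=> psi) psi) (psi01 : forall X, 0 <= psi X <= 1).
Hypothesis psi_super : forall X, 0 <= P_smooth a psi X.
Local Notation K := (kern Gamma t x).

Definition kmean (s : R) : R := \int[leb d]_z (K (s, z) * psi (s, z)).

Lemma kern_psi_ge0 X : 0 <= K X * psi X.
Proof. by have /andP[p0 _] := psi01 X; rewrite mulr_ge0// (kern_ge0 _ _ fsG). Qed.

Lemma measurable_kern_psi : measurable_fun setT (fun X => (K X * psi X)%:E).
Proof.
apply/measurable_EFinP; apply: measurable_funM; first exact: measurable_kern fsG.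
by apply: measurable_continuous_prod; exact: tame_continuous tpsi 0%N.
Qed.

Lemma kern_psi_le1 s : (\int[leb d]_z (K (s, z) * psi (s, z))%:E <= 1)%E.
Proof.
apply: le_trans (kern_mass_le1 t x fsG s); apply: ge0_le_integral => //=.
- by move=> z _; rewrite lee_fin kern_psi_ge0.
- by apply: (measurableT_comp measurable_kern_psi); exact: pair1_measurable.
- by apply/measurable_EFinP; exact: measurable_kern_slice fsG _.
- move=> z _; rewrite lee_fin ler_piMr ?(kern_ge0 _ _ fsG)//.
  by have /andP[] := psi01 (s, z).
Qed.

Lemma kmeanE s : ((kmean s)%:E = \int[leb d]_z (K (s, z) * psi (s, z))%:E)%E.
Proof.
rewrite /kmean /Rintegral fineK// fin_numElt; apply/andP; split.
  by apply: (@lt_le_trans _ _ 0%E) => //; apply: integral_ge0 => z _; rewrite lee_fin kern_psi_ge0.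
by apply: le_lt_trans (kern_psi_le1 s) _; rewrite ltry.
Qed.

Lemma kmean01 s : 0 <= kmean s <= 1.
Proof.
rewrite -!lee_fin kmeanE kern_psi_le1 andbT.
by apply: integral_ge0 => z _; rewrite lee_fin kern_psi_ge0.
Qed.

Lemma measurable_kmean : measurable_fun setT kmean.
Proof.
apply/measurable_EFinP; rewrite (_ : EFin \o kmean = fun s => \int[leb d]_z (K (s, z) * psi (s, z))%:E)%E.
  by apply: (measurable_slice_integral measurable_kern_psi) => X;
    rewrite lee_fin kern_psi_ge0.
by apply/funext => s; rewrite /= kmeanE.
Qed.

Lemma normr_kmean s : `|kmean s| <= 1.
Proof. by have /andP[k0 k1] := kmean01 s; rewrite ger0_norm. Qed.

Lemma integrable_window_kmean h n s1 : 0 < h ->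
  mu.-integrable setT (EFin \o (fun s => window h n (s - s1) * kmean s)).
Proof.
move=> h0; apply: (@integrable_bounded_support _ _ _ mu `[s1 - h, s1 + h]%classic _ 1) => //.
- by rewrite /= lebesgue_measure_itv/=; case: ifP => // _; rewrite -EFinD ltry.
- apply: measurable_funM; last exact: measurable_kmean.
  apply: continuous_measurable_fun => s.
  apply: (@continuous_comp _ _ _ (fun s => s - s1) (window h n)).
    by apply: cvgB; [exact: cvg_id|exact: cvg_cst].
  exact: bsmooth_continuous (window_bsmooth h n) _.
- move=> s; rewrite normrM ger0_norm ?window_ge0// -[leRHS]mulr1.
  by apply: ler_pM; rewrite ?window_ge0 ?window_le1 ?normr_kmean.
- move=> s; rewrite /= in_itv/= => /negP hs; rewrite window_eq0 ?mul0r//.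
  rewrite leNgt ltr_distl; apply/negP => /andP[s2 s3]; move: hs => /negP; apply.
  by apply/andP; split; lra.
Qed.

(** Test the adjoint equation with eta psi, where eta >= 0 is the difference of the
smooth steps at s1 and s2. As the kernel and P psi are nonnegative, the term
with eta P psi is nonnegative, so the term with eta' psi, which is the
difference of the two window averages, is not positive. *)
Lemma window_kmean_le h n s1 s2 : 0 < h -> s1 <= s2 -> s2 + h < t ->
  (\int[mu]_s (window h n (s - s1) * kmean s)%:E
    <= \int[mu]_s (window h n (s - s2) * kmean s)%:E)%E.
Proof.
move=> h0 s12 s2t.
pose eta s := smooth_step h n (s - s1) - smooth_step h n (s - s2).
pose eta' s := window h n (s - s1) - window h n (s - s2).
have shift_bsmooth g c : bsmooth g -> bsmooth (fun s : R => g (s - c)).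
  move=> bg; rewrite (_ : (fun s => _) = (fun s => g (- c + 1 * s))); first exact: bsmooth_affine.
  by apply/funext => s; congr g; ring.
have shift_derive c (s : R) : is_derive s 1 (fun s => smooth_step h n (s - c)) (window h n (s - c)).
  apply: (@is_derive_line _ _ _ (smooth_step h n) _ (s - c) 1 s 1).
    by move=> k; congr (smooth_step h n); rewrite addrA.
  exact: is_derive_smooth_step.
have beta : bsmooth eta by apply: bsmooth_sub; apply: shift_bsmooth; exact: smooth_step_bsmooth.
have deta (s : R) : is_derive s 1 eta (eta' s) by apply: is_deriveB; exact: shift_derive.
have eta_ge0 s : 0 <= eta s by rewrite subr_ge0 smooth_step_le// lerB.
have eta0 s : s \notin `[s1 - h, s2 + h] -> eta s = 0 /\ eta' s = 0.
  rewrite in_itv/= negb_and -!ltNge => /orP[sl|sr].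
    rewrite /eta /eta' !smooth_step_eq0 ?subrr//; try lra.
    by rewrite !window_eq0 ?subrr// ler_normr; apply/orP; right; lra.
  rewrite /eta /eta' (@smooth_step_eq _ h n (s - s1)) ?(@smooth_step_eq _ h n (s - s2)) ?subrr//; try lra.
  by rewrite !window_eq0 ?subrr// ler_normr; apply/orP; left; lra.
have adj := @kern_adjoint R d a lambda Lambda Gamma t x lambda_gt0 ella fsG eta eta' psi
  (s1 - h) (s2 + h) s2t beta deta eta0 tpsi.
have cpsi : measurable_fun setT psi.
  by apply: measurable_continuous_prod; exact: tame_continuous tpsi 0%N.
have bg g : bsmooth g -> measurable_fun setT (fun X : spacetime => g X.1).
  move=> gs; apply: measurableT_comp => //; apply: continuous_measurable_fun.
  exact: bsmooth_continuous.
have i1 : (stleb d).-integrable setT (fun X => (K X * (eta' X.1 * psi X))%:E).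
  apply: (@integrable_kern_mul _ _ a Gamma t x fsG _ 1 (s1 - h) (s2 + h)).
  - apply: measurable_funM => //; apply: bg.
    by apply: bsmooth_sub; apply: shift_bsmooth; exact: window_bsmooth.
  - move=> X; rewrite normrM -[leRHS]mulr1; apply: ler_pM => //.
      rewrite /eta'; have := window_ge0 h n (X.1 - s1); have := window_ge0 h n (X.1 - s2).
      have := window_le1 h n (X.1 - s1); have := window_le1 h n (X.1 - s2).
      by move=> *; rewrite ler_norml; apply/andP; split; lra.
    by have /andP[p0 p1] := psi01 X; rewrite ger0_norm.
  - by move=> X /eta0[_ ->]; rewrite mul0r.
have [M hM] := P_smooth_bounded lambda_gt0 ella tpsi.
have [Me he] : exists M, forall s, `|eta s| <= M by case: beta => G [<- _ /(_ 0%N)].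
have i2 : (stleb d).-integrable setT (fun X => (K X * (eta X.1 * P_smooth a psi X))%:E).
  apply: (@integrable_kern_mul _ _ a Gamma t x fsG _ (Me * M) (s1 - h) (s2 + h)).
  - by apply: measurable_funM; [exact: bg|exact: measurable_P_smooth ella tpsi].
  - by move=> X; rewrite normrM; apply: ler_pM => //; exact: (hM 0%N).
  - by move=> X /eta0[-> _]; rewrite mul0r.
have le0 : (\int[stleb d]_X (K X * (eta' X.1 * psi X))%:E <= 0)%E.
  have := integralD measurableT i1 i2.
  rewrite (_ : integral _ _ _ = 0%E); last first.
    rewrite -adj; apply: eq_integral => X _; rewrite -EFinD; congr (_%:E); ring.
  move=> /esym e; rewrite -e leeDl//; apply: integral_ge0 => X _.
  by rewrite lee_fin mulr_ge0 ?(kern_ge0 _ _ fsG)// mulr_ge0.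
move: le0; rewrite (stleb_fubini i1)/=.
have -> : (\int[mu]_s \int[leb d]_z (K (s, z) * (eta' s * psi (s, z)))%:E =
           \int[mu]_s ((window h n (s - s1) * kmean s)%:E - (window h n (s - s2) * kmean s)%:E))%E.
  apply: eq_integral => s _.
  rewrite -EFinB -mulrBl -/(eta' s) EFinM kmeanE.
  under eq_integral do rewrite mulrCA EFinM.
  rewrite integralZl//; apply/integrableP; split.
    by apply: (measurableT_comp measurable_kern_psi); exact: pair1_measurable.
  under eq_integral do rewrite gee0_abs ?lee_fin ?kern_psi_ge0//.
  by apply: le_lt_trans (kern_psi_le1 s) _; rewrite ltry.
rewrite (integralB_EFin measurableT (integrable_window_kmean n s1 h0)
  (integrable_window_kmean n s2 h0)).
rewrite leeBlDr ?add0e//.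
by apply: integrable_fin_num => //; exact: integrable_window_kmean.
Qed.

(** The windows converge boundedly to the indicator of the interval. *)
Lemma ball_kmean_le h s1 s2 : 0 < h -> s1 <= s2 -> s2 + h < t ->
  \int[mu]_(s in ball s1 h) kmean s <= \int[mu]_(s in ball s2 h) kmean s.
Proof.
move=> h0 s12 s2t.
have cv c : (\int[mu]_s (window h n (s - c) * kmean s)%:E)%E @[n --> \oo]
    --> (\int[mu]_(s in ball c h) (kmean s)%:E)%E.
  have ind (s : R) : (\1_(`]- h, h[%classic : set R) (s - c) : R) = (`|c - s| < h)%R%:R.
    by rewrite indicE mem_setE in_itv/= -ltr_norml -normrN opprB.
  rewrite integral_mkcond.
  apply: (@dominated_cvg _ _ _ mu _ measurableT _ _
     (EFin \o \1_(`[c - h, c + h]%classic : set R))).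
  - by move=> n; have /integrableP[] := integrable_window_kmean n c h0.
  - move=> s _; rewrite patchE.
    rewrite (_ : (if _ then _ else _) = (\1_(`]- h, h[%classic) (s - c) * kmean s)%:E); last first.
      rewrite ind.
      case: (boolP (`|c - s| < h)) => sc; first by rewrite mem_set//= mul1r.
      by rewrite memNset ?mul0r//; exact/negP.
    apply: cvg_EFin; first by near=> n.
    by apply: cvgM; [exact: cvg_window|exact: cvg_cst].
  - by [].
  - apply: (@integrable_bounded_support _ _ _ mu `[c - h, c + h]%classic _ 1) => //.
    + by rewrite /= lebesgue_measure_itv/=; case: ifP => // _; rewrite -EFinD ltry.
    + by move=> s; rewrite indicE; case: (_ \in _); rewrite ?normr1 ?normr0.
    + by move=> s ns; rewrite indicE memNset.
  - move=> n s _; rewrite lee_fin normrM ger0_norm ?window_ge0//.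
    rewrite indicE mem_setE in_itv/=; case: (boolP (_ <= _ <= _)) => /= hs.
      rewrite -[leRHS]mulr1.
      by apply: ler_pM; rewrite ?window_ge0 ?window_le1 ?normr_kmean.
    rewrite window_eq0 ?mul0r// leNgt ltr_distl; apply/negP => /andP[? ?].
    by move: hs => /negP; apply; apply/andP; split; lra.
have fin c : (\int[mu]_(s in ball c h) (kmean s)%:E)%E \is a fin_num.
  apply: integrable_fin_num; first exact: measurable_ball.
  by apply: (@bounded_integrable_ball _ _ 1); [exact: measurable_kmean|exact: normr_kmean].
apply: (fine_le (fin s1) (fin s2)).
apply: (lee_cvg_to (cv s1) (cv s2)); near=> n; exact: window_kmean_le.
Unshelve. all: by end_near. Qed.

Lemma ae_lebesgue_pt_kmean : {ae mu, forall s, lebesgue_pt kmean s}.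
Proof. exact: ae_lebesgue_pt_bounded measurable_kmean normr_kmean. Qed.

(** The weak form of d/ds \int K psi >= 0: it is an inequality between Lebesgue
points, the times where the mean is the limit of its averages. *)
Lemma kmean_le s1 s2 : lebesgue_pt kmean s1 -> lebesgue_pt kmean s2 ->
  s1 <= s2 -> s2 < t -> kmean s1 <= kmean s2.
Proof.
move=> l1 l2 s12 s2t; have e0 : 0 < t - s2 by rewrite subr_gt0.
apply: (le_of_window_averages e0 measurable_kmean normr_kmean l1 l2) => h h0 ht.
by apply: ball_kmean_le => //; lra.
Qed.

End supersolution_means.

(** * Almost everywhere statements *)

Section almost_everywhere.
Context {R : realType}.
Local Notation mu := (@lebesgue_measure R).

Lemma ae_countable d (T : measurableType d) (m : {measure set T -> \bar R})
    (I : countType) (P : I -> T -> Prop) :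
  (forall i, {ae m, forall x, P i x}) -> {ae m, forall x, forall i, P i x}.
Proof.
move=> aeP; pose F n := if @unpickle I n is Some i then ~` [set x | P i x] else set0.
have nF : m.-negligible (\bigcup_n F n).
  apply: negligible_bigcup => n; rewrite /F.
  by case: unpickle => [i|]; [exact: aeP|exact: negligible_set0].
apply: negligibleS nF => x /existsNP[i nP]; exists (pickle i) => //.
by rewrite /F pickleK.
Qed.

Lemma ae_itv_exists (P : R -> Prop) (l r : R) : l < r -> {ae mu, forall x, P x} ->
  exists2 x, l < x < r & P x.
Proof.
move=> lr aeP; apply: contrapT => nex.
have sub : `]l, r[%classic `<=` ~` [set x | P x].
  by move=> x /=; rewrite in_itv/= => xlr Px; apply: nex; exists x.
have nP : mu.-negligible (~` [set x | P x]) by exact: aeP.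
have := @negligibleS _ _ _ mu _ _ sub nP.
move=> /negligibleP; rewrite /= lebesgue_measure_itv/= lte_fin lr => /(_ (measurable_itv _)) /eqP.
by rewrite -EFinD eqe subr_eq0 gt_eqF.
Qed.

End almost_everywhere.

(** * The barrier *)

Section sigmoid_barrier.
Context {R : realType} {d : nat}.
Local Notation space := 'rV[R]_d.
Local Notation spacetime := (R * 'rV[R]_d)%type.
Local Notation mu := (@lebesgue_measure R).
Variables (a : spacetime -> 'M[R]_d) (lambda Lambda : R).
Hypotheses (lambda_gt0 : 0 < lambda) (ella : elliptic lambda Lambda a).

(** A bounded substitute for the supersolution exp (b + al.z + Lambda |al|^2 s). *)
Definition barrier (b : R) (al : space) (X : spacetime) : R :=
  sigmoid (b + spacetime_form (Lambda * enorm al ^+ 2) al X).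

Lemma Lambda_ge0 : (0 < d)%N -> 0 <= Lambda.
Proof.
move=> d0; have [_ _ /(_ (0, 0) (delta_mx ord0 (Ordinal d0)))/andP[h1 h2]] := ella.
rewrite enorm_delta !mulr1 in h1 h2.
by apply: ltW; apply: lt_le_trans lambda_gt0 (le_trans h1 h2).
Qed.

Lemma barrier01 b al X : 0 <= barrier b al X <= 1.
Proof. by rewrite /barrier ltW ?sigmoid_gt0// ltW// sigmoid_lt1. Qed.

Lemma tame_barrier b al : tame (fun=> barrier b al) (barrier b al).
Proof.
exact: tame_functional (@bsmooth_sigmoid R) (functional_spacetime_form _ _).
Qed.

Lemma spacetime_form_dir_t c (al : space) : spacetime_form c al dir_t = c.
Proof. by rewrite /spacetime_form/= mulr1 big1 ?addr0// => i _; rewrite mxE mulr0. Qed.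

Lemma spacetime_form_dir_x c (al : space) i : spacetime_form c al (dir_x i) = al ord0 i.
Proof.
rewrite /spacetime_form/= mulr0 add0r (bigD1 i)//= mxE !eqxx mulr1 big1 ?addr0//.
by move=> j /negbTE ji; rewrite mxE ji/= mulr0.
Qed.

(** With Q the value of the quadratic form at al and c = Lambda |al|^2 >= Q,
the derivatives of the logistic function s give
P psi = c s (1 - s) - Q s (1 - s) (1 - 2 s) >= 0. *)
Lemma P_smooth_barrier_ge0 b al X : 0 <= P_smooth a (barrier b al) X.
Proof.
set c := Lambda * enorm al ^+ 2.
pose s Y := barrier b al Y.
have D1 v Y : 'D_v (barrier b al) Y = spacetime_form c al v * (s Y * (1 - s Y)).
  have [] := is_derive_affine v (functional_spacetime_form c al) (is_derive_sigmoid (b + spacetime_form c al Y)).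
  by [].
pose g p : R := sigmoid p * (1 - sigmoid p).
have dg (p : R) : is_derive p 1 g (g p * (1 - 2 * sigmoid p)).
  have ds := is_derive_sigmoid p.
  have d1 : is_derive p 1 (cst (1 : R) - sigmoid) (0 - sigmoid p * (1 - sigmoid p)).
    by apply: is_deriveB.
  have := is_deriveM ds d1.
  rewrite (_ : _ + _ = g p * (1 - 2 * sigmoid p))//.
  by rewrite -[(cst 1 - sigmoid) p]/(1 - sigmoid p) /g /GRing.scale/=; ring.
have D2 i j Y : 'D_(dir_x i) ('D_(dir_x j) (barrier b al)) Y =
    al ord0 i * al ord0 j * (s Y * (1 - s Y) * (1 - 2 * s Y)).
  rewrite (_ : 'D_(dir_x j) _ = (fun Y => al ord0 j * g (b + spacetime_form c al Y))); last first.
    by apply/funext => Z; rewrite D1 spacetime_form_dir_x.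
  have dgj : is_derive (b + spacetime_form c al Y) 1 (cst (al ord0 j) * g)
     (al ord0 j *: (g (b + spacetime_form c al Y) * (1 - 2 * sigmoid (b + spacetime_form c al Y))) + g (b + spacetime_form c al Y) *: 0).
    by apply: is_deriveM.
  have [_ ->] := is_derive_affine (dir_x i) (functional_spacetime_form c al) dgj.
  rewrite spacetime_form_dir_x scaler0 addr0 /GRing.scale/= /s /g /barrier -/c; ring.
rewrite /P_smooth D1 spacetime_form_dir_t.
rewrite [X in _ - X](_ : _ = (\sum_i \sum_j a X i j * al ord0 i * al ord0 j) *
  (s X * (1 - s X) * (1 - 2 * s X))); last first.
  rewrite mulr_suml; apply: eq_bigr => i _; rewrite mulr_suml; apply: eq_bigr => j _.
  by rewrite D2; ring.
have [_ _ /(_ X al)/andP[q1 q2]] := ella.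
set Q := \sum_i _ in q1 q2 *; rewrite -/c in q2.
have Q0 : 0 <= Q by apply: le_trans q1; rewrite mulr_ge0 ?sqr_ge0// ltW.
have /andP[s0 s1] := barrier01 b al X; rewrite -/(s X) in s0 s1.
have -> : c * (s X * (1 - s X)) - Q * (s X * (1 - s X) * (1 - 2 * s X)) =
  s X * (1 - s X) * (c - Q + 2 * s X * Q) by ring.
by rewrite !mulr_ge0// ?subr_ge0// addr_ge0 ?subr_ge0// !mulr_ge0.
Qed.

End sigmoid_barrier.

(** * The mean of the barrier is at most its value at the pole *)

Section gaussian_mass.
Context {R : realType} {d : nat}.
Local Notation space := 'rV[R]_d.
Local Notation spacetime := (R * 'rV[R]_d)%type.
Local Notation mu := (@lebesgue_measure R).
Variables (a : spacetime -> 'M[R]_d) (lambda Lambda : R).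
Variables (Gamma : R -> space -> R -> space -> R).
Hypotheses (d_gt0 : (0 < d)%N).
Hypotheses (lambda_gt0 : 0 < lambda) (ella : elliptic lambda Lambda a).
Hypothesis fsG : fundamental_solution a Gamma.

Lemma kmean_past t x psi s : s < t ->
  kmean Gamma t x psi s = \int[leb d]_z (Gamma t x s z * psi (s, z)).
Proof. by move=> st; apply: eq_Rintegral => z _; rewrite /kern/= st. Qed.

Lemma barrier_datum b (al : space) s : initial_datum (fun z : space => barrier Lambda b al (s, z)).
Proof.
have cb : continuous (fun z : space => barrier Lambda b al (s, z)).
  move=> z; apply: (@continuous_comp _ _ _ (fun z => (s, z)) (barrier Lambda b al)).
    exact: pairr_continuous.
  exact: tame_continuous (tame_barrier Lambda b al) 0%N _.
split; first exact: measurable_continuous_rV.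
  by exists 1 => z; have /andP[h0 h1] := barrier01 Lambda b al (s, z); rewrite ger0_norm.
by apply: aeW => z; exact: cb.
Qed.

Lemma barrier_mono b (al : space) s t x : s <= t ->
  barrier Lambda b al (s, x) <= barrier Lambda b al (t, x).
Proof.
move=> st; rewrite /barrier /sigmoid lef_pV2 ?posrE ?ltr_pwDl ?expR_ge0//.
rewrite lerD2l ler_expR lerN2 lerD2l /spacetime_form/= lerD2r.
by rewrite ler_wpM2l// mulr_ge0 ?sqr_ge0// (Lambda_ge0 lambda_gt0 ella d_gt0).
Qed.

Lemma le_of_close_chain (e p1 p2 p3 p4 p5 : R) : `|p1 - p2| < e / 2 -> p2 <= p3 ->
  `|p4 - p3| < e / 2 -> p4 <= p5 -> p1 <= e + p5.
Proof. by rewrite !ltr_norml => /andP[_ ?] ? /andP[? _] ?; lra. Qed.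

(** The monotonicity of the mean is combined with the continuity of the Cauchy
solution at its initial time and at time t. The exceptional null set of
Lebesgue points depends on the pole, so only countably many of them, the
rational times q, are used: for s < s' < q < t with s' and q close to t,
the mean at time s for the pole t is close to that for the pole q, which is at
most the mean at time s' for the pole q, itself close to
psi(s',x) <= psi(t,x). *)
Lemma ae_barrier_le x b (al : space) :
  {ae mu, forall s, forall t, s < t ->
    \int[leb d]_z (Gamma t x s z * barrier Lambda b al (s, z)) <= barrier Lambda b al (t, x)}.
Proof.
set psi := barrier Lambda b al.
have tpsi := tame_barrier Lambda b al; have psi01 := barrier01 Lambda b al.
have Ppsi := P_smooth_barrier_ge0 lambda_gt0 ella b al.
pose good s := forall q : rat, lebesgue_pt (kmean Gamma (ratr q) x psi) s.
have aeg : {ae mu, forall s, good s}.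
  apply: ae_countable => q; exact: (ae_lebesgue_pt_kmean _ _ fsG tpsi psi01).
have mono q s s' : good s -> good s' -> s <= s' -> s' < ratr q ->
    kmean Gamma (ratr q) x psi s <= kmean Gamma (ratr q) x psi s'.
  by move=> gs gs'; apply: (kmean_le lambda_gt0 ella fsG tpsi psi01 Ppsi).
pose u s (X : spacetime) := \int[leb d]_z (Gamma X.1 X.2 s z * psi (s, z)).
have uq q s : s < ratr q -> kmean Gamma (ratr q) x psi s = u s (ratr q, x).
  by move=> sq; rewrite kmean_past.
apply: (@filterS _ _ (ae_filter_ringOfSetsType mu) _ _ _ aeg) => s gs t st; apply/ler_addgt0Pl => e e0.
have e20 : 0 < e / 2 by rewrite divr_gt0.
have [[[cu _] _ _] _] := fs_cauchy fsG s (barrier_datum b al s).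
have cut : {for t, continuous (fun r => u s (r, x))}.
  apply: (@continuous_comp _ _ _ (fun r => (r, x)) (u s)); first exact: pairl_continuous.
  by apply: cu => /=.
have [del del0 hdel] : exists2 del : R, 0 < del &
    forall r, `|t - r| < del -> `|u s (t, x) - u s (r, x)| < e / 2.
  have /cvgrPdist_lt/(_ _ e20)/nbhs_ballP[del del0 hd] := cut.
  by exists del => // r hr; exact: hd.
have [s' /andP[s's s't] gs'] : exists2 s', Num.max s (t - del) < s' < t & good s'.
  by apply: ae_itv_exists aeg; rewrite gt_max st/= ltrBlDr ltrDl.
move: s's; rewrite gt_max => /andP[ss' s'del].
have [[_ _ ini] _] := fs_cauchy fsG s' (barrier_datum b al s').
have cs' : {for x, continuous (fun z : space => psi (s', z))}.
  apply: (@continuous_comp _ _ _ (fun z => (s', z)) psi).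
    exact: pairr_continuous.
  exact: tame_continuous tpsi 0%N _.
have [del' del'0 hdel'] : exists2 del : R, 0 < del &
    forall r, s' < r -> r < s' + del -> `|psi (s', x) - u s' (r, x)| < e / 2.
  have /cvgrPdist_lt/(_ _ e20) := ini x cs'.
  rewrite /within/= => h.
  have := @pairl_continuous R space x s' _ h.
  move=> /nbhs_ballP[k k0 hd]; exists k => // r sr rd.
  by apply: hd => //; rewrite /ball/= ltr_distlC; apply/andP; split; lra.
have [q /itvP qI] : exists q, ratr q \in `]s', (Num.min t (s' + del'))[.
  by apply: rat_in_itvoo; rewrite lt_min s't ltrDl.
have s'q : s' < ratr q by rewrite qI.
have : ratr q < Num.min t (s' + del') by rewrite qI.
rewrite lt_min => /andP[qt qdel'].
have h1 := hdel (ratr q); have h2 := hdel' _ s'q qdel'.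
have {}h1 : `|u s (t, x) - u s (ratr q, x)| < e / 2.
  by apply: h1; rewrite ltr_distlC; apply/andP; split; lra.
have h3 := mono q s s' gs gs' (ltW ss') s'q.
rewrite !uq// in h3; last exact: lt_trans ss' s'q.
have h4 := barrier_mono b al x (ltW s't); rewrite -/psi in h4.
exact: (le_of_close_chain h1 h3 h2 h4).
Qed.

End gaussian_mass.

(** * Euclidean balls and cylinders *)

Section euclidean_balls.
Context {R : realType} {d : nat}.
Local Notation space := 'rV[R]_d.
Local Notation spacetime := (R * 'rV[R]_d)%type.

Lemma ltr_sqr_ge0 (p q : R) : 0 <= p -> 0 <= q -> (p ^+ 2 < q ^+ 2) = (p < q).
Proof. by move=> p0 q0; rewrite ltr_pXn2r// nnegrE. Qed.

Lemma enorm_ge0 (z : space) : 0 <= enorm z.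
Proof. exact: sqrtr_ge0. Qed.

Lemma eballE (y z : space) r : 0 < r ->
  eball y r z <-> \sum_i (z ord0 i - y ord0 i) ^+ 2 < r ^+ 2.
Proof.
move=> r0; have e : enorm (z - y) ^+ 2 = \sum_i (z ord0 i - y ord0 i) ^+ 2.
  by rewrite enorm_sqr; apply: eq_bigr => i _; rewrite !mxE.
by rewrite -e /eball/= ltr_sqr_ge0 ?enorm_ge0// ltW.
Qed.

Lemma measurable_enorm_sqr (y : space) :
  measurable_fun setT (fun z : space => enorm (z - y) ^+ 2).
Proof.
rewrite (_ : (fun z => _) = (fun z : space => \sum_i (z ord0 i - y ord0 i) ^+ 2)).
  apply: measurable_sum => i; apply: measurable_funX; apply: measurable_funB => //.
  exact: measurable_coord.
by apply/funext => z; rewrite enorm_sqr; apply: eq_bigr => i _; rewrite !mxE.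
Qed.

Lemma measurable_eball (y : space) r : 0 < r -> measurable (eball y r).
Proof.
move=> r0; rewrite (_ : eball y r = (fun z : space => enorm (z - y) ^+ 2) @^-1` `]-oo, r ^+ 2[%classic).
  by rewrite -[X in measurable X]setTI; apply: measurable_enorm_sqr.
by apply/seteqP; split => z; rewrite /= in_itv/= ltr_sqr_ge0 ?enorm_ge0// ltW.
Qed.

Lemma measurable_cylinder (X0 : spacetime) r : 0 < r -> measurable (cylinder X0 r).
Proof. by move=> r0; apply: measurableX => //; exact: measurable_eball. Qed.

Lemma cube_sub_eball (y : space) r : (0 < d)%N -> 0 < r -> cube y (r / d%:R) `<=` eball y r.
Proof.
move=> d0 r0 z zy; apply/eballE => //.
have dR : 0 < d%:R :> R by rewrite ltr0n.
have rd : 0 < r / d%:R by rewrite divr_gt0.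
apply: (@lt_le_trans _ _ (\sum_(i < d) (r / d%:R) ^+ 2)).
  apply: ltr_sum.
    by apply/hasP; exists (Ordinal d0); rewrite ?mem_index_enum.
  move=> i _; rewrite -[_ ^+ 2]ger0_norm ?sqr_ge0// normrX ltr_sqr_ge0 ?normr_ge0// ?ltW//.
rewrite sumr_const card_ord -[_ *+ d]mulr_natl.
rewrite (_ : d%:R * _ = r ^+ 2 / d%:R); last by field; rewrite gt_eqF.
by rewrite ler_pdivrMr// ler_peMr ?sqr_ge0// ler1n.
Qed.

Lemma leb_eball_ge (y : space) r : (0 < d)%N -> 0 < r ->
  (((2 * (r / d%:R)) ^+ d)%:E <= leb d (eball y r))%E.
Proof.
move=> d0 r0; rewrite -(leb_cube y); last by rewrite divr_gt0// ltr0n.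
apply: le_measure; rewrite ?inE; [exact: measurable_cube|exact: measurable_eball|].
exact: cube_sub_eball.
Qed.

Lemma leb_eball_lty (y : space) r : 0 < r -> (leb d (eball y r) < +oo)%E.
Proof.
move=> r0; apply: (@le_lt_trans _ _ (leb d (cube y r))); last by rewrite leb_cube// ltry.
apply: le_measure; rewrite ?inE; [exact: measurable_eball|exact: measurable_cube|].
move=> z /(eballE _ _ r0) zr i; rewrite -ltr_sqr_ge0 ?normr_ge0 ?ltW//.
rewrite -normrX ger0_norm ?sqr_ge0//; apply: le_lt_trans zr.
by rewrite (bigD1 i)//= lerDl sumr_ge0// => j _; exact: sqr_ge0.
Qed.

Lemma stleb_cylinder (X0 : spacetime) r : 0 < r ->
  (stleb d (cylinder X0 r) = (r ^+ 2)%:E * leb d (eball X0.2 r))%E.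
Proof.
move=> r0; rewrite /stleb/= product_measure1E//; last exact: measurable_eball.
rewrite /= lebesgue_measure_itv/= lte_fin ltrDl exprn_gt0//.
by rewrite -EFinD addrC addKr.
Qed.

Lemma enorm_scale_sqr (c : R) (z : space) : enorm (c *: z) ^+ 2 = c ^+ 2 * enorm z ^+ 2.
Proof.
rewrite !enorm_sqr mulr_sumr; apply: eq_bigr => i _.
by rewrite mxE exprMn.
Qed.

Lemma enormB (x y : space) : enorm (x - y) = enorm (y - x).
Proof.
rewrite /enorm; congr (Num.sqrt _); apply: eq_bigr => i _.
by rewrite !mxE -[RHS]sqrrN opprB.
Qed.

(** Young's inequality; the parameter k balances the two terms. *)
Lemma dot_ge (u v : space) (k : R) : 0 < k ->
  - (k * enorm u ^+ 2 / 2 + enorm v ^+ 2 / (2 * k)) <= \sum_i u ord0 i * v ord0 i.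
Proof.
move=> k0; rewrite !enorm_sqr mulr_sumr !mulr_suml -big_split/= -sumrN.
apply: ler_sum => i _; set p := u _ _; set q := v _ _.
have k20 : 0 < 2 * k by rewrite mulr_gt0.
rewrite -subr_ge0.
have -> : p * q - - (k * p ^+ 2 / 2 + q ^+ 2 / (2 * k)) = (k * p + q) ^+ 2 / (2 * k).
  by field; rewrite gt_eqF.
by rewrite divr_ge0 ?sqr_ge0 ?ltW.
Qed.

Lemma enormD_sqr (u v : space) : enorm (u + v) ^+ 2 <= 2 * (enorm u ^+ 2 + enorm v ^+ 2).
Proof.
rewrite !enorm_sqr -big_split mulr_sumr/=; apply: ler_sum => i _; rewrite mxE.
set p := u _ _; set q := v _ _; rewrite -subr_ge0.
have -> : 2 * (p ^+ 2 + q ^+ 2) - (p + q) ^+ 2 = (p - q) ^+ 2 by ring.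
exact: sqr_ge0.
Qed.

End euclidean_balls.

(** * Gaussian decay of the mass of balls *)

Section ball_mass.
Context {R : realType} {d : nat}.
Local Notation space := 'rV[R]_d.
Local Notation spacetime := (R * 'rV[R]_d)%type.
Local Notation mu := (@lebesgue_measure R).
Variables (a : spacetime -> 'M[R]_d) (lambda Lambda : R).
Variables (Gamma : R -> space -> R -> space -> R).
Hypotheses (d_gt0 : (0 < d)%N) (Lambda_gt0 : 0 < Lambda).
Hypotheses (lambda_gt0 : 0 < lambda) (ella : elliptic lambda Lambda a).
Hypothesis fsG : fundamental_solution a Gamma.

(** Twice the exponential that bounds, at the pole, the barrier adapted to y. *)
Definition mass_bound (tau : R) (x y : space) : R :=
  2 * (expR (2 * Lambda)^-1 * expR (- (enorm (x - y) ^+ 2 / (8 * Lambda * tau)))).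

(** The barrier is at least 1/2 on the ball, so its mean is at least half the mass
of the ball; at the pole it is bounded by the exponential of its exponent,
which the choice of al makes Gaussian. *)
Lemma ae_ball_mass (t s0 : R) (x y0 : space) : s0 < t ->
  {ae mu, forall s, s0 <= s < t ->
    (\int[leb d]_(z in eball y0 (Num.sqrt (t - s0))) (Gamma t x s z)%:E
       <= (mass_bound (t - s0) x y0)%:E)%E}.
Proof.
move=> s0t; set tau := t - s0; have tau0 : 0 < tau by rewrite subr_gt0.
set D2 := enorm (x - y0) ^+ 2.
pose c := (2 * Lambda * tau)^-1.
pose al : space := c *: (y0 - x).
have al2 : enorm al ^+ 2 = c ^+ 2 * D2 by rewrite enorm_scale_sqr enormB.
(* On the ball al.(z - x) >= theta by Young's inequality, so that the exponent
   is nonnegative there, while at (t,x) it is Lambda |al|^2 tau - theta, which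
   equals 1/(2 Lambda) - D2/(8 Lambda tau) for this choice of c. *)
pose theta := 3 * D2 / (8 * Lambda * tau) - (2 * Lambda)^-1.
pose b := - (\sum_i al ord0 i * x ord0 i) - Lambda * enorm al ^+ 2 * s0 - theta.
have Ln : Lambda != 0 by rewrite gt_eqF.
have taun : tau != 0 by rewrite gt_eqF.
have pE s z : b + spacetime_form (Lambda * enorm al ^+ 2) al (s, z) =
    \sum_i al ord0 i * (z ord0 i - x ord0 i) + Lambda * enorm al ^+ 2 * (s - s0) - theta.
  rewrite /b /spacetime_form/=.
  have -> : \sum_i al ord0 i * (z ord0 i - x ord0 i) =
      \sum_i al ord0 i * z ord0 i - \sum_i al ord0 i * x ord0 i.
    by rewrite -sumrB; apply: eq_bigr => i _; rewrite mulrBr.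
  ring.
have ptx : barrier Lambda b al (t, x) <=
    expR (2 * Lambda)^-1 * expR (- (D2 / (8 * Lambda * tau))).
  apply: le_trans (sigmoid_le_expR _) _; rewrite -expRD ler_expR pE.
  rewrite big1 ?add0r; last by move=> i _; rewrite subrr mulr0.
  rewrite al2 /theta /c -/tau le_eqVlt; apply/orP; left; apply/eqP.
  by field; rewrite Ln taun.
have pball s z : s0 <= s -> eball y0 (Num.sqrt tau) z ->
    0 <= b + spacetime_form (Lambda * enorm al ^+ 2) al (s, z).
  move=> s0s zb; rewrite pE.
  have sq0 : 0 < Num.sqrt tau by rewrite sqrtr_gt0.
  have v2 : enorm (z - y0) ^+ 2 < tau.
    by rewrite -[ltRHS](sqr_sqrtr (ltW tau0)) ltr_sqr_ge0 ?enorm_ge0 ?sqrtr_ge0.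
  have k0 : 0 < Lambda * tau by rewrite mulr_gt0.
  have dot := dot_ge al (z - y0) k0.
  have -> : \sum_i al ord0 i * (z ord0 i - x ord0 i) =
     c * D2 + \sum_i al ord0 i * (z - y0) ord0 i.
    rewrite /D2 enormB enorm_sqr mulr_sumr -big_split/=; apply: eq_bigr => i _.
    by rewrite /al !mxE; ring.
  have h1 : enorm (z - y0) ^+ 2 / (2 * (Lambda * tau)) <= (2 * Lambda)^-1.
    rewrite ler_pdivrMr ?mulr_gt0//.
    by rewrite (_ : (2 * Lambda)^-1 * (2 * (Lambda * tau)) = tau); [exact: ltW|field].
  have h2 : 0 <= Lambda * enorm al ^+ 2 * (s - s0).
    by apply: mulr_ge0; [apply: mulr_ge0; [exact: ltW|exact: sqr_ge0]|rewrite subr_ge0].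
  have h3 : c * D2 - Lambda * tau * enorm al ^+ 2 / 2 = 3 * D2 / (8 * Lambda * tau).
    by rewrite al2 /c; field; rewrite Ln taun.
  rewrite /theta; lra.
have := ae_barrier_le d_gt0 lambda_gt0 ella fsG x b al.
apply: (@filterS _ _ (ae_filter_ringOfSetsType mu)) => s /(_ t) hs /andP[s0s st].
have sq0 : 0 < Num.sqrt tau by rewrite sqrtr_gt0.
have mG : measurable_fun setT (fun z => (Gamma t x s z)%:E).
  by have /integrableP[] := fs_integrable fsG x st.
have G0 z := fs_ge0 fsG t x s z.
have mb : measurable_fun setT (fun z : space => barrier Lambda b al (s, z)).
  by have [] := barrier_datum Lambda b al s.
have b01 := barrier01 Lambda b al.
have mGb : measurable_fun setT (fun z => (Gamma t x s z * barrier Lambda b al (s, z))%:E).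
  by apply/measurable_EFinP; apply: measurable_funM => //; exact/measurable_EFinP.
have Gb0 z : 0 <= Gamma t x s z * barrier Lambda b al (s, z).
  by rewrite mulr_ge0//; have /andP[] := b01 (s, z).
have iGb : (leb d).-integrable setT (fun z => (Gamma t x s z * barrier Lambda b al (s, z))%:E).
  apply: (le_integrable _ _ _ (fs_integrable fsG x st)) => //.
  move=> z _; rewrite lee_fin !ger0_norm// ler_piMr//.
  by have /andP[] := b01 (s, z).
apply: (@le_trans _ _ (\int[leb d]_z (2 * (Gamma t x s z * barrier Lambda b al (s, z)))%:E)%E).
  rewrite integral_mkcond; apply: ge0_le_integral => //=.
  - by move=> z _; rewrite patchE; case: ifP => // _; rewrite lee_fin.
  - apply: (measurable_restrictT _ (measurable_eball y0 sq0)).1.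
    exact: measurable_funTS.
  - by apply/measurable_EFinP; apply: measurable_funM => //; exact/measurable_EFinP.
  - move=> z _; rewrite patchE; case: ifPn => [|_]; last by rewrite lee_fin mulr_ge0.
    rewrite inE => zb; rewrite lee_fin mulrCA ler_peMr//.
    by have := ge0_sigmoid (pball s z s0s zb); rewrite -/(barrier _ _ _ _); lra.
under eq_integral do rewrite EFinM.
rewrite ge0_integralZl_EFin//; last by move=> z _; rewrite lee_fin.
rewrite EFinM lee_pmul2l// -(fineK (integrable_fin_num measurableT iGb)) lee_fin.
exact: le_trans (hs st) ptx.
Qed.

End ball_mass.

(** * From mass to a bound almost everywhere *)

Section restriction.
Context {R : realType} {d : nat}.
Local Notation space := 'rV[R]_d.
Local Notation spacetime := (R * 'rV[R]_d)%type.
Implicit Types (a : spacetime -> 'M[R]_d) (U W : set spacetime) (u : spacetime -> R).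

Lemma Lp_loc_sub p U W u : measurable U -> measurable W -> W `<=` U ->
  Lp_loc p U u -> Lp_loc p W u.
Proof.
move=> mU mW WU [mu fu]; split; first exact: measurable_funS mu.
by move=> K cK KW; apply: fu => // X /KW/WU.
Qed.

Lemma test_function_sub U W phi : W `<=` U -> test_function W phi -> test_function U phi.
Proof.
by move=> WU [sphi [K [cK KW p0]]]; split => //; exists K; split => // X /KW/WU.
Qed.

(** Both integrals are those of a function supported in the support of the test
function. *)
Lemma adjoint_solution_sub a U W u : measurable U -> measurable W -> W `<=` U ->
  adjoint_solution a U u -> adjoint_solution a W u.
Proof.
move=> mU mW WU [Lu eu]; split; first exact: Lp_loc_sub Lu.
move=> phi tphi; rewrite -[RHS](eu phi (test_function_sub WU tphi)).
have [sphi [K [cK KW phi0]]] := tphi.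
have P0 X : ~ K X -> P_smooth a phi X = 0.
  move=> nK; rewrite /P_smooth (derive_off_support _ cK phi0)// big1 ?subr0// => i _.
  rewrite big1// => j _; rewrite (derive_off_support _ cK _ nK) ?mulr0//.
  by move=> Y; exact: derive_off_support.
rewrite [LHS]Rintegral_support; last by move=> X nW; rewrite P0 ?mulr0// => /KW.
by rewrite [RHS]Rintegral_support// => X nU; rewrite P0 ?mulr0// => /KW/WU.
Qed.

End restriction.

Section gaussian_bound.
Context {R : realType} {d : nat}.
Local Notation space := 'rV[R]_d.
Local Notation spacetime := (R * 'rV[R]_d)%type.
Local Notation mu := (@lebesgue_measure R).
Variables (a : spacetime -> 'M[R]_d) (lambda Lambda N0 T : R).
Variables (Gamma : R -> space -> R -> space -> R) (t : R) (x : space).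
Hypotheses (d_gt0 : (0 < d)%N) (Lambda_gt0 : 0 < Lambda) (N0_gt0 : 0 < N0) (T_gt0 : 0 < T).
Hypotheses (lambda_gt0 : 0 < lambda) (ella : elliptic lambda Lambda a).
Hypothesis fsG : fundamental_solution a Gamma.
Hypothesis lbN0 : local_boundedness a (Num.sqrt T) N0.

(** The mass of balls decays with the constant 1/(8 Lambda). Replacing the centre
y0 by a point y of the ball costs a factor 2, and replacing t - s0 by
t - s >= (t - s0)/2 costs another. *)
Definition kappa0 : R := (32 * Lambda)^-1.

(** The factors are those of local boundedness, of [mass_bound], of the change of
centre, and of the comparison of the ball with an inscribed cube. *)
Definition gauss_const : R :=
  N0 * (2 * expR (2 * Lambda)^-1 * expR (32 * Lambda)^-1 * (d%:R / 2) ^+ d).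

(** Fubini, with the bound on the mass of the ball at almost every time. *)
Lemma cylinder_integral_le (s0 : R) (y0 : space) : s0 < t ->
  (\int[stleb d]_(Y in cylinder (s0, y0) (Num.sqrt (t - s0))) (`|Gamma t x Y.1 Y.2|)%:E
    <= ((t - s0) * mass_bound Lambda (t - s0) x y0)%:E)%E.
Proof.
move=> s0t; have tau0 : 0 < t - s0 by rewrite subr_gt0.
have sq0 : 0 < Num.sqrt (t - s0) by rewrite sqrtr_gt0.
set C := cylinder _ _; set mb := mass_bound _ _ _ _.
have mC : measurable C by exact: measurable_cylinder.
have Ct Y : C Y -> Y.1 < t.
  by move=> [/= + _]; rewrite in_itv/= sqr_sqrtr 1?ltW// => /andP[_]; rewrite addrC subrK.
pose f (Y : spacetime) : \bar R := (kern Gamma t x Y * \1_C Y)%:E.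
have f0 Y : (0 <= f Y)%E by rewrite lee_fin mulr_ge0 ?(kern_ge0 _ _ fsG).
have mf : measurable_fun setT f.
  apply/measurable_EFinP; apply: measurable_funM; first exact: measurable_kern fsG.
  exact: measurable_indic.
have -> : (\int[stleb d]_(Y in C) (`|Gamma t x Y.1 Y.2|)%:E = \int[stleb d]_Y f Y)%E.
  rewrite integral_mkcond; apply: eq_integral => Y _; rewrite patchE /f indicE.
  case: ifPn => [|_]; last by rewrite mulr0.
  by rewrite inE => /Ct Yt; rewrite mulr1 /kern Yt ger0_norm ?(fs_ge0 fsG).
rewrite (stleb_tonelli mf f0).
apply: (@le_trans _ _ (\int[mu]_s (mb * \1_(`]s0, t[%classic) s)%:E)%E); last first.
  under eq_integral do rewrite EFinM.
  rewrite ge0_integralZl_EFin//; last 2 first.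
  - exact/measurable_EFinP.
  - by rewrite /mb /mass_bound !mulr_ge0 ?expR_ge0.
  rewrite integral_indic// setIT/= lebesgue_measure_itv/= lte_fin s0t.
  by rewrite -EFinD -EFinM mulrC.
apply: ae_ge0_le_integral => //=.
- by move=> s _; apply: integral_ge0 => z _; exact: f0.
- exact: measurable_slice_integral.
- by move=> s _; rewrite lee_fin mulr_ge0// /mb /mass_bound !mulr_ge0 ?expR_ge0.
- by apply/measurable_EFinP; apply: measurable_funM.
have := ae_ball_mass d_gt0 Lambda_gt0 lambda_gt0 ella fsG x y0 s0t.
apply: (@filterS _ _ (ae_filter_ringOfSetsType mu)) => s hs _.
rewrite /f; case: (boolP (s0 < s < t)) => /andP st; last first.
  under eq_integral => z _.
    rewrite (_ : \1_C (s, z) = 0); last first.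
      rewrite indicE memNset// => -[/= + _]; rewrite in_itv/= sqr_sqrtr 1?ltW//.
      by rewrite (addrC s0) subrK => /andP.
    rewrite mulr0; over.
  rewrite integral0 indicE memNset ?mulr0//=.
  by rewrite in_itv/= => /andP.
have [s0s st'] := st.
rewrite indicE mem_set/= ?in_itv/= ?s0s ?st'// mulr1.
apply: le_trans (hs _); last by rewrite st' ltW.
rewrite le_eqVlt; apply/orP; left; apply/eqP.
rewrite [RHS]integral_mkcond; apply: eq_integral => z _; rewrite patchE /kern/= st' indicE.
case: (boolP (z \in _)) => [|/negP]; rewrite inE => zb.
  rewrite mem_set ?mulr1//; split => //=.
  by rewrite in_itv/= sqr_sqrtr 1?ltW// s0s (addrC s0) subrK.
by rewrite memNset ?mulr0// => -[_].
Qed.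

(** Local boundedness on the cylinder of radius sqrt(t - s0), which is the
largest one based at time s0 that stays in the past of t. *)
Lemma ae_cylinder_bound (s0 : R) (y0 : space) : s0 < t -> t - s0 < T ->
  {ae stleb d, forall Y, cylinder (s0, y0) (Num.sqrt (t - s0) / 2) Y ->
    Gamma t x Y.1 Y.2 <=
      N0 * (mass_bound Lambda (t - s0) x y0 / (2 * (Num.sqrt (t - s0) / d%:R)) ^+ d)}.
Proof.
move=> s0t s0T; have tau0 : 0 < t - s0 by rewrite subr_gt0.
have sq0 : 0 < Num.sqrt (t - s0) by rewrite sqrtr_gt0.
set r := Num.sqrt (t - s0) / 2.
have r2 : 2 * r = Num.sqrt (t - s0) by rewrite /r; field.
have r0 : 0 < r by rewrite divr_gt0.
have rT : 0 < r < Num.sqrt T.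
  rewrite r0/=; apply: (@lt_trans _ _ (Num.sqrt (t - s0))); first by rewrite /r; lra.
  by rewrite ltr_sqrt.
set C := cylinder (s0, y0) (2 * r).
have mC : measurable C by apply: measurable_cylinder; rewrite r2.
have Ct : C `<=` [set Y | Y.1 < t].
  move=> Y [/= + _]; rewrite r2 in_itv/= sqr_sqrtr 1?ltW// => /andP[_].
  by rewrite (addrC s0) subrK.
have adj := adjoint_solution_sub (measurable_past t) mC Ct (fs_adjoint fsG t x).
have := lbN0 rT adj; set c := (_ * average _ _)%E => /ess_supP bnd.
have cle : (c <= (N0 * (mass_bound Lambda (t - s0) x y0 / (2 * (Num.sqrt (t - s0) / d%:R)) ^+ d))%:E)%E.
  rewrite /c /average EFinM; apply: lee_wpmul2l; first by rewrite lee_fin ltW.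
  rewrite /C r2 stleb_cylinder//= sqr_sqrtr; last exact: ltW.
  have lfin := leb_eball_lty y0 sq0; have lge := leb_eball_ge y0 d_gt0 sq0.
  set m := (2 * _) ^+ d in lge *.
  have m0 : 0 < m by rewrite exprn_gt0// mulr_gt0// divr_gt0// ltr0n.
  have lE : leb d (eball y0 (Num.sqrt (t - s0))) = (fine (leb d (eball y0 (Num.sqrt (t - s0)))))%:E.
    by rewrite fineK// ge0_fin_numE.
  rewrite lE in lge *; set V := fine _ in lge *; rewrite lee_fin in lge.
  have V0 : 0 < V by exact: lt_le_trans lge.
  rewrite -EFinM inver gt_eqF ?mulr_gt0//.
  apply: (@le_trans _ _ (((t - s0) * V)^-1%:E * ((t - s0) * mass_bound Lambda (t - s0) x y0)%:E)%E).
    apply: lee_wpmul2l; first by rewrite lee_fin invr_ge0 mulr_ge0 ?ltW.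
    exact: cylinder_integral_le.
  rewrite -EFinM lee_fin.
  have -> : ((t - s0) * V)^-1 * ((t - s0) * mass_bound Lambda (t - s0) x y0) =
     mass_bound Lambda (t - s0) x y0 / V by field; rewrite !gt_eqF.
  by rewrite ler_wpM2l ?lef_pV2// /mass_bound !mulr_ge0 ?expR_ge0.
apply: (@filterS _ _ (ae_filter_ringOfSetsType (stleb d)) _ _ _ bnd) => Y hY CY.
have := le_trans hY cle; rewrite patchE mem_set// lee_fin.
by apply: le_trans; exact: ler_norm.
Qed.

Lemma cylinder_bound_gaussian (s0 : R) (y0 : space) Y : s0 < t ->
  cylinder (s0, y0) (Num.sqrt (t - s0) / 2) Y ->
  N0 * (mass_bound Lambda (t - s0) x y0 / (2 * (Num.sqrt (t - s0) / d%:R)) ^+ d)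
    <= gaussian gauss_const kappa0 t x Y.1 Y.2.
Proof.
case: Y => s y s0t [/=]; set tau := t - s0; have tau0 : 0 < tau by rewrite subr_gt0.
have sq0 : 0 < Num.sqrt tau by rewrite sqrtr_gt0.
rewrite in_itv/= expr_div_n (sqr_sqrtr (ltW tau0)) => /andP[s0s stau] yy0.
have {}stau : s < s0 + tau / 4 by apply: lt_le_trans stau _; rewrite lerD2l le_eqVlt; apply/orP; left; apply/eqP; field.
have ts : 0 < t - s by rewrite /tau in stau; lra.
have ts1 : t - s <= tau by rewrite /tau; lra.
(* In the half cylinder t - s is comparable with tau, which allows passing from
   the base point to the current point. *)
have ts2 : tau <= 2 * (t - s) by rewrite /tau in stau *; lra.
have yy2 : enorm (y - y0) ^+ 2 <= tau / 4.
  have : enorm (y - y0) ^+ 2 < (Num.sqrt tau / 2) ^+ 2.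
    by rewrite ltr_sqr_ge0 ?enorm_ge0 ?divr_ge0 ?sqrtr_ge0//; exact: yy0.
  rewrite expr_div_n (sqr_sqrtr (ltW tau0)) => /ltW/le_trans; apply.
  by rewrite le_eqVlt; apply/orP; left; apply/eqP; field.
have tri : enorm (x - y) ^+ 2 <= 2 * (enorm (x - y0) ^+ 2 + enorm (y - y0) ^+ 2).
  by rewrite (enormB y y0) -[x - y](subrKA y0); exact: enormD_sqr.
have dR : 0 < d%:R :> R by rewrite ltr0n.
have Ln : Lambda != 0 by rewrite gt_eqF.
have taun : tau != 0 by rewrite gt_eqF.
have tsn : t - s != 0 by rewrite gt_eqF.
rewrite /gaussian /gauss_const /mass_bound.
set A := enorm (x - y) ^+ 2 in tri *; set B := enorm (x - y0) ^+ 2 in tri *.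
have A0 : 0 <= A by exact: sqr_ge0.
clearbody A B.
rewrite -!mulrA (ler_wpM2l (ltW N0_gt0))// ler_wpM2l//.
rewrite ler_wpM2l ?expR_ge0//.
have pw : (Num.sqrt tau) ^+ d = tau `^ (d%:R / 2).
  by rewrite -(powR12_sqrt (ltW tau0)) -powR_mulrn ?powR_ge0// -powRrM mulrC.
have -> : ((2 * (Num.sqrt tau / d%:R)) ^+ d)^-1 = (d%:R / 2) ^+ d / tau `^ (d%:R / 2).
  rewrite -pw -exprVn -[in RHS]exprVn -exprMn; congr (_ ^+ d).
  by field; rewrite !gt_eqF.
rewrite [leLHS]mulrCA [leRHS]mulrCA ler_wpM2l ?exprn_ge0 ?divr_ge0//.
rewrite [leLHS]mulrC [leRHS]mulrCA.
apply: ler_pM; rewrite ?invr_ge0 ?powR_ge0 ?expR_ge0//.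
  rewrite lef_pV2 ?posrE ?powR_gt0//.
  by apply: ge0_ler_powR; rewrite ?nnegrE ?divr_ge0// ltW.
rewrite -expRD ler_expR /kappa0.
have h1 : (A / 2 - tau / 4) / (8 * Lambda * tau) <= B / (8 * Lambda * tau).
  rewrite ler_pM2r ?invr_gt0 ?mulr_gt0//; lra.
have h2 : (A / 2 - tau / 4) / (8 * Lambda * tau) = A / (16 * Lambda * tau) - (32 * Lambda)^-1.
  by field; rewrite Ln taun.
have h3 : (32 * Lambda)^-1 * (A / (t - s)) <= A / (16 * Lambda * tau).
  rewrite mulrCA ler_wpM2l// -invfM lef_pV2 ?posrE ?mulr_gt0//.
  have -> : 32 * Lambda * (t - s) = 16 * Lambda * (2 * (t - s)) by ring.
  by rewrite ler_wpM2l// mulr_ge0// ltW.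
rewrite h2 in h1; lra.
Qed.

(** The cylinders of the previous bounds with rational base points cover the slab
of times at distance less than T from t, so a countable union of null sets is
discarded. *)
Lemma ae_gaussian :
  {ae stleb d, forall Y, 0 < t - Y.1 < T ->
    Gamma t x Y.1 Y.2 <= gaussian gauss_const kappa0 t x Y.1 Y.2}.
Proof.
pose center (w : 'rV[rat]_d) : space := \row_i ratr (w ord0 i).
pose P (qw : rat * 'rV[rat]_d) (Y : spacetime) :=
  ratr qw.1 < t -> t - ratr qw.1 < T ->
  cylinder (ratr qw.1, center qw.2) (Num.sqrt (t - ratr qw.1) / 2) Y ->
  Gamma t x Y.1 Y.2 <= gaussian gauss_const kappa0 t x Y.1 Y.2.
have aeP : {ae stleb d, forall Y, forall qw, P qw Y}.
  apply: ae_countable => qw.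
  case: (ltP (ratr qw.1) t) => [qt|tq]; last first.
    by apply: aeW => Y; rewrite /P ltNge tq.
  case: (ltP (t - ratr qw.1) T) => [qT|Tq]; last first.
    by apply: aeW => Y; rewrite /P (ltNge _ T) Tq.
  have := ae_cylinder_bound (center qw.2) qt qT.
  apply: (@filterS _ _ (ae_filter_ringOfSetsType (stleb d))) => Y hY _ _ CY.
  apply: le_trans (hY CY) _; exact: cylinder_bound_gaussian.
apply: (@filterS _ _ (ae_filter_ringOfSetsType (stleb d)) _ _ _ aeP) => -[s y] hP /= /andP[ts0 tsT].
(* The half cylinder based at q lasts (t - q)/4, so it contains the time s when
   q > (4 s - t)/3. *)
have [q /itvP qI] : exists q, ratr q \in `](Num.max ((4 * s - t) / 3) (t - T)), s[.
  apply: rat_in_itvoo; rewrite gt_max; apply/andP; split; lra.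
have qs : ratr q < s by rewrite qI.
have : Num.max ((4 * s - t) / 3) (t - T) < ratr q by rewrite qI.
rewrite gt_max => /andP[q1 q2].
have qt : ratr q < t by lra.
have tau0 : 0 < t - ratr q by rewrite subr_gt0.
set r := Num.sqrt (t - ratr q) / 2; have r0 : 0 < r by rewrite divr_gt0// sqrtr_gt0.
have rd : 0 < r / d%:R by rewrite divr_gt0// ltr0n.
have ex i : exists w : rat, `|y ord0 i - ratr w| < r / d%:R.
  have [w /itvP wI] : exists w, ratr w \in `](y ord0 i - r / d%:R), (y ord0 i + r / d%:R)[.
    by apply: rat_in_itvoo; lra.
  exists w; rewrite ltr_distlC; apply/andP; split.
    by rewrite wI.
  by rewrite wI.
have [w hw] := choice ex.
have hq2 : t - ratr q < T by lra.
apply: (hP (q, \row_i w i)) => //=; split => /=.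
  rewrite in_itv/= qs/= -/r /r expr_div_n (sqr_sqrtr (ltW tau0)); lra.
apply: cube_sub_eball => // i; rewrite !mxE; exact: hw.
Qed.

End gaussian_bound.

(** * Integrability of the Gaussian *)

Section gaussian_integrability.
Context {R : realType}.
Local Notation mu := (@lebesgue_measure R).

(** Up to a factor this is the density of a normal law. *)
Lemma integral_gauss1_lty (c q : R) : 0 < c ->
  (\int[mu]_p (expR (- (c * (p - q) ^+ 2)))%:E < +oo)%E.
Proof.
move=> c0; pose sg := Num.sqrt (2 * c)^-1.
have c20 : 0 < (2 * c)^-1 by rewrite invr_gt0 mulr_gt0.
have sg0 : sg != 0 by rewrite gt_eqF// sqrtr_gt0.
have pk0 : 0 < normal_peak sg by exact: normal_peak_gt0.
have e p : expR (- (c * (p - q) ^+ 2)) = (normal_peak sg)^-1 * normal_pdf q sg p.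
  rewrite /normal_pdf (negbTE sg0) mulrA mulVf ?mul1r ?gt_eqF// /normal_fun.
  rewrite /sg sqr_sqrtr ?(ltW c20)//; congr expR.
  by rewrite -mulr_natl; field; rewrite gt_eqF.
under eq_integral do rewrite e EFinM.
rewrite integralZl//; last exact: integrable_normal_pdf.
by rewrite integral_normal_pdf mule1 ltry.
Qed.

Lemma integral_gauss_lty n (c : R) (x : 'rV[R]_n) : 0 < c ->
  (\int[leb n]_z (expR (- (c * enorm (x - z) ^+ 2)))%:E < +oo)%E.
Proof.
move=> c0; have mE m (y : 'rV[R]_m) :
    measurable_fun setT (fun z : 'rV[R]_m => (expR (- (c * enorm (y - z) ^+ 2)))%:E).
  under eq_fun do rewrite enormB.
  apply/measurable_EFinP; apply: measurableT_comp; first exact: measurable_expR.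
  apply: measurable_funN; apply: measurable_funM => //; exact: measurable_enorm_sqr.
elim: n x => [|n IH] x.
  rewrite /= integral_dirac//=; last exact: mE.
  by rewrite [X in (X * _)%E](_ : _ = 1%E) ?mul1e ?ltry//; exact: diracT.
rewrite /= /leb_succ ge0_integral_pushforward//; last 2 first.
- exact: measurable_rV_cons.
- exact: mE.
pose tl : 'rV[R]_n := \row_j x ord0 (lift ord0 j).
pose f (p : R * 'rV[R]_n) := (expR (- (c * (p.1 - x ord0 ord0) ^+ 2)) *
   expR (- (c * enorm (tl - p.2) ^+ 2)))%:E.
have en p : enorm (x - rV_cons p) ^+ 2 = (p.1 - x ord0 ord0) ^+ 2 + enorm (tl - p.2) ^+ 2.
  rewrite !enorm_sqr big_ord_recl; congr (_ + _).
    by rewrite !mxE unlift_none -sqrrN opprB.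
  by apply: eq_bigr => i _; rewrite !mxE liftK.
have fE p : (expR (- (c * enorm (x - rV_cons p) ^+ 2)))%:E = f p.
  by rewrite /f en -expRD mulrDr opprD.
rewrite preimage_setT; under eq_integral do rewrite /= fE.
have mf : measurable_fun setT f.
  rewrite (_ : f = (fun z => (expR (- (c * enorm (x - z) ^+ 2)))%:E) \o @rV_cons R n).
    by apply: measurableT_comp; [exact: mE|exact: measurable_rV_cons].
  by apply/funext => p; rewrite /= fE.
have f0 p : (0 <= f p)%E by rewrite lee_fin mulr_ge0 ?expR_ge0.
rewrite (stleb_tonelli mf f0) /f/=.
pose I := (\int[leb n]_z (expR (- (c * enorm (tl - z) ^+ 2)))%:E)%E.
have I0 : (0 <= I)%E by apply: integral_ge0 => z _; rewrite lee_fin expR_ge0.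
have IE : I = (fine I)%:E by rewrite fineK// ge0_fin_numE//; exact: IH.
have e p : (\int[leb n]_z (expR (- (c * (p - x ord0 ord0) ^+ 2)) * expR (- (c * enorm (tl - z) ^+ 2)))%:E
    = (fine I)%:E * (expR (- (c * (p - x ord0 ord0) ^+ 2)))%:E)%E.
  under eq_integral do rewrite EFinM.
  rewrite ge0_integralZl_EFin ?expR_ge0//; first by rewrite -/I IE muleC.
  exact: mE.
under eq_integral do rewrite e.
rewrite ge0_integralZl_EFin//; last 2 first.
- apply/measurable_EFinP; apply: measurableT_comp; first exact: measurable_expR.
  apply: measurable_funN; apply: measurable_funM => //; apply: measurable_funX.
  exact: measurable_funB.
- by rewrite fine_ge0.
apply: lte_mul_pinfty; rewrite ?lee_fin ?fine_ge0//.
exact: integral_gauss1_lty.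
Qed.

End gaussian_integrability.

(** * Comparing densities by continuous functions *)

Section continuous_approximation.
Context {R : realType} {n : nat}.
Local Notation space := 'rV[R]_n.
Implicit Types f g : space -> R.
Variable w : space -> R.
Hypotheses (w_ge0 : forall z, 0 <= w z) (iw : (leb n).-integrable setT (EFin \o w)).

Definition weighted_L1 (g : space -> R) : \bar R := (\int[leb n]_z (`|g z| * w z)%:E)%E.

(** The sets whose indicator is a limit of continuous functions with values in
[0,1], for the weighted norm. They form a sigma-algebra that contains the
half-spaces, hence every Borel set. *)
Definition approximable (A : set space) : Prop := measurable A /\
  forall e : R, 0 < e -> exists f : space -> R,
    [/\ continuous f, forall z, 0 <= f z <= 1 &
      (weighted_L1 (fun z => f z - \1_A z)%R <= e%:E)%E].

Lemma measurable_weight : measurable_fun setT w.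
Proof. by have /integrableP[/measurable_EFinP] := iw. Qed.

Lemma measurable_weighted_L1 g : measurable_fun setT g ->
  measurable_fun setT (fun z => (`|g z| * w z)%:E).
Proof.
move=> mg; apply/measurable_EFinP; apply: measurable_funM; last exact: measurable_weight.
exact: measurableT_comp.
Qed.

Lemma weighted_L1D (g1 g2 g : space -> R) : measurable_fun setT g1 -> measurable_fun setT g2 ->
  measurable_fun setT g -> (forall z, `|g z| <= `|g1 z| + `|g2 z|) ->
  (weighted_L1 g <= weighted_L1 g1 + weighted_L1 g2)%E.
Proof.
move=> m1 m2 mg g12; rewrite /weighted_L1 -ge0_integralD//=; last 4 first.
- by move=> z _; rewrite lee_fin mulr_ge0.
- exact: measurable_weighted_L1.
- by move=> z _; rewrite lee_fin mulr_ge0.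
- exact: measurable_weighted_L1.
apply: ge0_le_integral => //=.
- by move=> z _; rewrite lee_fin mulr_ge0.
- exact: measurable_weighted_L1.
- by apply: emeasurable_funD; exact: measurable_weighted_L1.
- by move=> z _; rewrite -EFinD lee_fin -mulrDl ler_wpM2r.
Qed.

Lemma cvg_weighted_L1 (g : nat -> space -> R) : (forall k, measurable_fun setT (g k)) ->
  (forall k z, `|g k z| <= 1) -> (forall z, g k z @[k --> \oo] --> 0) ->
  weighted_L1 (g k) @[k --> \oo] --> 0%E.
Proof.
move=> mg g1 g0.
have <- : (\int[leb n]_z cst 0 z = 0 :> \bar R)%E by rewrite integral_cst//= mul0e.
apply: (@dominated_cvg _ _ _ (leb n) _ measurableT _ _ (EFin \o w)) => //.
- by move=> k; exact: measurable_weighted_L1.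
- move=> z _; rewrite (_ : cst 0%E z = (`|0 : R| * w z)%:E); last by rewrite normr0 mul0r.
  apply: cvg_EFin; first by near=> k.
  by apply: cvgM; [apply: cvg_norm; exact: g0|exact: cvg_cst].
- by move=> k z _; rewrite lee_fin normrM normr_id (ger0_norm (w_ge0 z)) ler_piMl.
Unshelve. all: by end_near. Qed.

Lemma weighted_L1_eventually_le (g : nat -> space -> R) (e : R) : 0 < e ->
  (forall k, measurable_fun setT (g k)) ->
  (forall k z, `|g k z| <= 1) -> (forall z, g k z @[k --> \oo] --> 0) ->
  exists k, (weighted_L1 (g k) <= e%:E)%E.
Proof.
move=> e0 mg g1 g0; have cv := cvg_weighted_L1 mg g1 g0.
have n0 : nbhs (0%:E : \bar R) [set y | (y < e%:E)%E].
  exact: (@nbhs_open_ereal_lt _ 0 (fun=> e)).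
by have [k _ /(_ k (leqnn k))/= h] := cv _ n0; exists k; exact: ltW.
Qed.

Lemma indic_bounds (A : set space) z : 0 <= (\1_A z : R) <= 1.
Proof. by rewrite indicE; case: (_ \in _); rewrite /= ?lexx ?ler01. Qed.

Lemma approximable_setC A : approximable A -> approximable (~` A).
Proof.
move=> [mA hA]; split; first exact: measurableC.
move=> e /hA[f [cf f01 fe]]; exists (fun z => 1 - f z); split.
- have c1 : continuous (fun _ : space => 1 : R) by exact: cst_continuous.
  by move=> z; exact: (cvgB (c1 z) (cf z)).
- by move=> z; have /andP[f0 f1] := f01 z; apply/andP; split; lra.
- apply: le_trans fe; rewrite le_eqVlt; apply/orP; left; apply/eqP.
  apply: eq_integral => z _; congr ((_ * _)%:E).
  rewrite -normrN; congr `|_|; rewrite !indicE in_setC.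
  by case: (z \in A) => /=; ring.
Qed.

Lemma approximable_set0 : approximable set0.
Proof.
split=> // e e0; exists (fun=> 0); split.
- exact: cst_continuous.
- by move=> z; rewrite lexx ler01.
- rewrite /weighted_L1 integral0_eq ?lee_fin ?ltW// => z _.
  by rewrite indic0 /= subrr normr0 mul0r.
Qed.

Lemma measurable_continuous_sub_indic f A : continuous f -> measurable A ->
  measurable_fun setT (fun z : space => f z - \1_A z).
Proof.
by move=> cf mA; apply: measurable_funB; [exact: measurable_continuous_rV|exact: measurable_indic].
Qed.

Lemma approximable_setU A B : approximable A -> approximable B -> approximable (A `|` B).
Proof.
move=> [mA hA] [mB hB]; split; first exact: measurableU.
move=> e e0; have e20 : 0 < e / 2 by rewrite divr_gt0.
have [f [cf f01 fe]] := hA _ e20; have [g [cg g01 ge]] := hB _ e20.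
(* f + g - f g = 1 - (1 - f) (1 - g) remains between 0 and 1. *)
have cfg : continuous (fun z => f z + g z - f z * g z).
  by move=> z; exact: (cvgB (cvgD (cf z) (cg z)) (cvgM (cf z) (cg z))).
exists (fun z => f z + g z - f z * g z); split => //.
- move=> z; have /andP[f0 f1] := f01 z; have /andP[g0 g1] := g01 z.
  by apply/andP; split; nra.
- apply: (@le_trans _ _ (weighted_L1 (fun z => f z - \1_A z)%R + weighted_L1 (fun z => g z - \1_B z)%R)%E); last first.
    by rewrite [e]splitr EFinD; exact: leeD.
  apply: weighted_L1D; try exact: measurable_continuous_sub_indic.
    by apply: measurable_continuous_sub_indic => //; exact: measurableU.
  move=> z; have /andP[f0 f1] := f01 z; have /andP[g0 g1] := g01 z.
  rewrite !indicE in_setU; case: (z \in A); case: (z \in B) => /=; rewrite ?subr0.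
  + rewrite ler_norml !(ler0_norm (_ : _ - 1 <= 0)) ?subr_le0//; apply/andP; split; nra.
  + rewrite ler_norml (ler0_norm (_ : _ - 1 <= 0)) ?subr_le0// (ger0_norm g0); apply/andP; split; nra.
  + rewrite ler_norml (ler0_norm (_ : _ - 1 <= 0)) ?subr_le0// (ger0_norm f0); apply/andP; split; nra.
  + rewrite ler_norml (ger0_norm f0) (ger0_norm g0); apply/andP; split; nra.
Qed.

(** A countable union is approximated by finite ones, by dominated convergence. *)
Lemma approximable_bigcup (F : (set space)^nat) :
  (forall k, approximable (F k)) -> approximable (\bigcup_k F k).
Proof.
move=> aF; have mU : measurable (\bigcup_k F k).
  by apply: bigcupT_measurable => k; have [] := aF k.
split=> // e e0; have e20 : 0 < e / 2 by rewrite divr_gt0.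
pose B k := \big[setU/set0]_(i < k) F i.
have aB k : approximable (B k).
  rewrite /B; elim: k => [|k IH]; first by rewrite big_ord0; exact: approximable_set0.
  by rewrite big_ord_recr; exact: approximable_setU.
have mB k : measurable (B k) by have [] := aB k.
have [k hk] : exists k, (weighted_L1 (fun z => \1_(B k) z - \1_(\bigcup_k F k) z)%R <= (e / 2)%:E)%E.
  apply: (@weighted_L1_eventually_le (fun k z => \1_(B k) z - \1_(\bigcup_k F k) z) (e / 2) e20).
  - by move=> k; apply: measurable_funB; exact: measurable_indic.
  - move=> k z; have /andP[a0 a1] := indic_bounds (B k) z.
    have /andP[b0 b1] := indic_bounds (\bigcup_k F k) z.
    by rewrite ler_norml; apply/andP; split; lra.
  - move=> z; apply: cvg_near_cst.
    have [[i _ Fi]|nF] := pselect ((\bigcup_k F k) z).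
      near=> k; rewrite !indicE mem_set; last first.
        have ik : (i < k)%N by near: k; exact: nbhs_infty_gt.
        by rewrite /B -bigcup_mkord; exists i.
      by rewrite mem_set ?subrr//; exists i.
    near=> k; rewrite !indicE memNset; last first.
      by rewrite /B -bigcup_mkord => -[i _ Fi]; apply: nF; exists i.
    by rewrite memNset ?subrr.
have [_ /(_ _ e20)[f [cf f01 fe]]] := aB k; exists f; split => //.
apply: (@le_trans _ _ (weighted_L1 (fun z => f z - \1_(B k) z)%R +
    weighted_L1 (fun z => \1_(B k) z - \1_(\bigcup_k F k) z)%R)%E); last first.
  by rewrite [e]splitr EFinD; exact: leeD.
apply: weighted_L1D; try exact: measurable_continuous_sub_indic.
  by apply: measurable_funB; exact: measurable_indic.
by move=> z; rewrite -[f z - _](subrKA (\1_(B k) z)); exact: ler_normD.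
Unshelve. all: by end_near. Qed.

Lemma approximable_halfspace i c : approximable [set z : space | c < z ord0 i].
Proof.
have mA : measurable [set z : space | c < z ord0 i].
  rewrite (_ : mkset _ = (fun z : space => z ord0 i) @^-1` `]c, +oo[%classic).
    by rewrite -[X in measurable X]setTI; exact: measurable_coord.
  by apply/seteqP; split => z /=; rewrite in_itv/= andbT.
split=> // e e0; pose f k (z : space) : R := flat 1 (k.+1%:R * (z ord0 i - c)).
have cf k : continuous (f k).
  move=> z; apply: (@continuous_comp _ _ _ (fun z : space => k.+1%:R * (z ord0 i - c)) (flat 1)).
    have c1 : continuous (fun _ : space => k.+1%:R : R) by exact: cst_continuous.
    have c2 : continuous (fun _ : space => c) by exact: cst_continuous.
    have c3 : continuous (fun z : space => z ord0 i) by exact: coord_continuous.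
    exact: (cvgM (c1 z) (cvgB (c3 z) (c2 z))).
  exact: bsmooth_continuous (bsmooth_flat 1) _.
have f01 k z : 0 <= f k z <= 1 by rewrite /f flat1_ge0 flat1_le1.
have [k hk] : exists k, (weighted_L1 (fun z => f k z - \1_[set z : space | (c < z ord0 i)%R] z)%R <= e%:E)%E.
  apply: (@weighted_L1_eventually_le (fun k z => f k z - \1_[set z : space | c < z ord0 i] z) e e0).
  - by move=> k; exact: measurable_continuous_sub_indic.
  - move=> k z; have /andP[a0 a1] := f01 k z.
    have /andP[b0 b1] := indic_bounds [set z : space | c < z ord0 i] z.
    by rewrite ler_norml; apply/andP; split; lra.
  - move=> z; rewrite indicE; have [cz|zc] := ltP c (z ord0 i).
      rewrite mem_set//= -(subrr (1 : R)).
      by apply: cvgB; [apply: cvg_flat1; rewrite subr_gt0|exact: cvg_cst].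
    rewrite memNset /=; last by rewrite ltNge zc.
    rewrite (_ : (fun k => _) = (fun=> 0)); first exact: cvg_cst.
    by apply/funext => k; rewrite subr0 /f flat1_eq0// mulr_ge0_le0// subr_le0.
by exists (f k).
Qed.

Lemma measurable_approximable A : measurable A -> approximable A.
Proof.
have sig : sigma_algebra setT approximable.
  split; first exact: approximable_set0.
    by move=> B aB; rewrite setTD; exact: approximable_setC.
  exact: approximable_bigcup.
suff: (measurable : set (set space)) `<=` approximable by exact.
apply: smallest_sub => //; rewrite -bigcup_seq => B [i _ [Y mY <-]] /=.
rewrite setTI.
suff: (@ocitv R).-sigma.-measurable `<=` [set Y | approximable ((fun z : space => z ord0 i) @^-1` Y)].
  exact.
rewrite RGenOInfty.measurableE; apply: smallest_sub => /=.
  split => /=.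
  - by rewrite preimage_set0; exact: approximable_set0.
  - by move=> B' aB; rewrite setTD preimage_setC; exact: approximable_setC.
  - by move=> F aF; rewrite preimage_bigcup; exact: approximable_bigcup.
move=> _ [c ->] /=; rewrite (_ : _ @^-1` _ = [set z : space | c < z ord0 i]).
  exact: approximable_halfspace.
by apply/seteqP; split => z /=; rewrite in_itv/= andbT.
Qed.

End continuous_approximation.

Section almost_everywhere_comparison.
Context {R : realType} {n : nat}.
Local Notation space := 'rV[R]_n.

(** Apply the hypothesis to continuous approximations of the indicator of
{g1 > g2}, with respect to the weight |g1 - g2|: the integral of g1 - g2 over
this set is not positive, so the set is null. *)
Lemma ae_le_of_continuous (g1 g2 : space -> R) :
  (leb n).-integrable setT (EFin \o g1) -> (leb n).-integrable setT (EFin \o g2) ->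
  (forall f : space -> R, continuous f -> (forall z, 0 <= f z <= 1) ->
    \int[leb n]_z (g1 z * f z) <= \int[leb n]_z (g2 z * f z)) ->
  {ae leb n, forall z, g1 z <= g2 z}.
Proof.
move=> i1 i2 le12; pose h z := g1 z - g2 z.
have ih : (leb n).-integrable setT (EFin \o h).
  rewrite (_ : EFin \o h = (EFin \o g1) \- (EFin \o g2))%E//; exact: integrableB.
have mh : measurable_fun setT h by have /integrableP[/measurable_EFinP] := ih.
(* This weight makes approximation in the weighted norm an approximation of
   the integral of h. *)
pose w z := `|h z|.
have w0 z : 0 <= w z by exact: normr_ge0.
have iw : (leb n).-integrable setT (EFin \o w) by exact: integrable_norm.
pose A := [set z | 0 < h z].
have mA : measurable A.
  rewrite (_ : A = h @^-1` `]0, +oo[%classic).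
    by rewrite -[X in measurable X]setTI; exact: mh.
  by apply/seteqP; split => z /=; rewrite in_itv/= andbT.
have bint (g f : space -> R) : (leb n).-integrable setT (EFin \o g) -> measurable_fun setT f ->
    (forall z, `|f z| <= 1) -> (leb n).-integrable setT (EFin \o (fun z => g z * f z)).
  move=> ig mf f1; apply: (le_integrable _ _ _ ig) => //.
    by apply/measurable_EFinP; apply: measurable_funM => //; have /integrableP[/measurable_EFinP] := ig.
  by move=> z _; rewrite lee_fin normrM ler_piMr.
have ind1 z : `|\1_A z : R| <= 1 by have /andP[a0 a1] := @indic_bounds R n A z; rewrite ger0_norm.
have int_le0 : \int[leb n]_z (h z * \1_A z) <= 0.
  apply/ler_addgt0Pl => e e0; rewrite addr0.
  have [_ /(_ _ e0)[f [cf f01 fe]]] := measurable_approximable w0 iw mA.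
  have mf : measurable_fun setT f by exact: measurable_continuous_rV.
  have f1 z : `|f z| <= 1 by have /andP[a0 a1] := f01 z; rewrite ger0_norm.
  have hf : \int[leb n]_z (h z * f z) <= 0.
    under eq_Rintegral do rewrite mulrBl.
    by rewrite RintegralB ?subr_le0//; [exact: le12|exact: bint..].
  have d1 z : `|\1_A z - f z| <= 1.
    have /andP[a0 a1] := @indic_bounds R n A z; have /andP[b0 b1] := f01 z.
    by rewrite ler_norml; apply/andP; split; lra.
  have md : measurable_fun setT (fun z => \1_A z - f z : R).
    by apply: measurable_funB => //; exact: measurable_indic.
  have -> : \int[leb n]_z (h z * \1_A z) =
      \int[leb n]_z (h z * f z) + \int[leb n]_z (h z * (\1_A z - f z)).
    rewrite -RintegralD//; [|exact: bint..].
    by apply: eq_Rintegral => z _; ring.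
  rewrite -[e]add0r; apply: lerD => //.
  apply: le_trans (ler_norm _) _.
  apply: le_trans (le_normr_Rintegral _ _) _ => //; first exact: bint.
  have iN : (leb n).-integrable setT (EFin \o (fun z => `|h z * (\1_A z - f z)|)).
    by apply: integrable_norm; exact: bint.
  rewrite -lee_fin /Rintegral fineK; last exact: integrable_fin_num iN.
  apply: le_trans fe; rewrite le_eqVlt; apply/orP; left; apply/eqP.
  by apply: eq_integral => z _; rewrite normrM mulrC distrC.
have pos z : 0 <= h z * \1_A z.
  rewrite indicE; case: (boolP (z \in A)) => [|_]; last by rewrite mulr0.
  by rewrite inE => /ltW; rewrite mulr1.
have iA := bint h _ ih (measurable_indic mA) ind1.
have int0 : (\int[leb n]_z `|(h z * \1_A z)%:E| = 0)%E.
  under eq_integral do rewrite gee0_abs ?lee_fin//.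
  apply/eqP; rewrite eq_le; apply/andP; split; last first.
    by apply: integral_ge0 => z _; rewrite lee_fin.
  by rewrite -(fineK (integrable_fin_num measurableT iA)) lee_fin.
have miA : measurable_fun setT (fun z => (h z * \1_A z)%:E) by have /integrableP[] := iA.
have := (ae_eq_integral_abs (leb n) measurableT miA).1 int0.
apply: (@filterS _ _ (ae_filter_ringOfSetsType (leb n))) => z /(_ I) [] hz.
rewrite -subr_le0 leNgt; apply/negP => hpos.
by move: hz; rewrite indicE mem_set//= mulr1 => h0; rewrite /h in h0; rewrite h0 ltxx in hpos.
Qed.

Lemma ae_prod_slice (P : set (R * space)) : {ae stleb n, forall Y, P Y} ->
  {ae (@lebesgue_measure R), forall s, {ae leb n, forall z, P (s, z)}}.
Proof.
move=> [N [mN N0 sub]].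
have mx : measurable_fun setT (leb n \o xsection N).
  exact: (@measurable_fun_xsection _ _ (measurableTypeR R) _ R (leb n)).
have int0 : (\int[@lebesgue_measure R]_s `|leb n (xsection N s)| = 0)%E.
  under eq_integral do rewrite gee0_abs//.
  exact: N0.
have := (ae_eq_integral_abs (@lebesgue_measure R) measurableT mx).1 int0.
apply: (@filterS _ _ (ae_filter_ringOfSetsType (@lebesgue_measure R))) => s /(_ I)/= s0.
exists (xsection N s); split => //; first exact: measurable_xsection.
by move=> z nP; rewrite /xsection/= inE; apply: sub.
Qed.

End almost_everywhere_comparison.

(** * Restarting the Cauchy problem *)

Section restarting.
Context {R : realType} {d : nat}.
Local Notation space := 'rV[R]_d.
Local Notation spacetime := (R * 'rV[R]_d)%type.
Variables (a : spacetime -> 'M[R]_d) (Gamma : R -> space -> R -> space -> R).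
Hypothesis fsG : fundamental_solution a Gamma.

Lemma measurable_future (s : R) : measurable [set Y : spacetime | s < Y.1].
Proof.
rewrite (_ : mkset _ = `]s, +oo[%classic `*` setT); first exact: measurableX.
by apply/seteqP; split => [Y /= Yt|Y [/=]]; [split => //=; rewrite in_itv/= andbT|rewrite in_itv/= andbT].
Qed.

Lemma weak_derivative_sub (U W : set spacetime) v (u g : spacetime -> R) : W `<=` U ->
  weak_derivative U v u g -> weak_derivative W v u g.
Proof.
move=> WU ug phi tphi; have := ug phi (test_function_sub WU tphi).
have [sphi [K [cK KW phi0]]] := tphi.
have D0 X : ~ K X -> 'D_v phi X = 0 by exact: derive_off_support cK phi0.
rewrite (@Rintegral_support _ _ U); last by move=> X nU; rewrite D0 ?mulr0// => /KW/WU.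
rewrite (@Rintegral_support _ _ U); last by move=> X nU; rewrite phi0 ?mulr0// => /KW/WU.
rewrite (@Rintegral_support _ _ W); last by move=> X nW; rewrite D0 ?mulr0// => /KW.
by rewrite (@Rintegral_support _ _ W)// => X nW; rewrite phi0 ?mulr0// => /KW.
Qed.

Lemma strong_solution_sub (U W : set spacetime) u : measurable U -> measurable W -> W `<=` U ->
  strong_solution a U u -> strong_solution a W u.
Proof.
move=> mU mW WU [cu [ut [Du [D2u [[L1 L2 L3 L4] w1 w2 w3 eq]]]]].
split=> [X /WU/cu//|]; exists ut, Du, D2u; split.
- by split=> [|| i|i j]; apply: Lp_loc_sub WU _.
- exact: weak_derivative_sub w1.
- by move=> i; exact: weak_derivative_sub (w2 i).
- by move=> i j; exact: weak_derivative_sub (w3 i j).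
- apply: (@filterS _ _ (ae_filter_ringOfSetsType (stleb d)) _ _ _ eq) => X hX /WU.
  exact: hX.
Qed.

Variables (s : R) (f : space -> R).
Hypotheses (cf : continuous f) (f01 : forall z, 0 <= f z <= 1).

(** The bounded solution that starts from f at time s. *)
Definition cauchy_solution (X : spacetime) : R := \int[leb d]_z (Gamma X.1 X.2 s z * f z).

Lemma datum_continuous (g : space -> R) : continuous g -> (forall z, 0 <= g z <= 1) ->
  initial_datum g.
Proof.
move=> cg g01; split; first exact: measurable_continuous_rV.
  by exists 1 => z; have /andP[g0 g1] := g01 z; rewrite ger0_norm.
by apply: aeW => z; exact: cg.
Qed.

Lemma integrable_Gamma_mul t x (r : R) (g : space -> R) : r < t -> measurable_fun setT g ->
  (forall z, 0 <= g z <= 1) -> (leb d).-integrable setT (fun z => (Gamma t x r z * g z)%:E).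
Proof.
move=> rt mg g01; apply: (le_integrable _ _ _ (fs_integrable fsG x rt)) => //.
  apply/measurable_EFinP; apply: measurable_funM => //.
  by have /integrableP[/measurable_EFinP] := fs_integrable fsG x rt.
move=> z _; have /andP[g0 g1] := g01 z.
by rewrite lee_fin normrM ler_piMr// ger0_norm.
Qed.

Lemma cauchy_solution01 X : s < X.1 -> 0 <= cauchy_solution X <= 1.
Proof.
move=> sX; have iG := integrable_Gamma_mul X.2 sX (measurable_continuous_rV cf) f01.
have iG1 := fs_integrable fsG X.2 sX.
apply/andP; split.
  apply: Rintegral_ge0 => z _.
  by have /andP[f0 _] := f01 z; rewrite mulr_ge0// (fs_ge0 fsG).
apply: (@le_trans _ _ (\int[leb d]_z (Gamma X.1 X.2 s z))).
  apply: le_Rintegral => // z _.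
  by have /andP[_ f1] := f01 z; rewrite ler_piMr// (fs_ge0 fsG).
by rewrite /Rintegral (fundamental_mass1 X.2 fsG sX).
Qed.

Lemma cauchy_solution_continuous X : s < X.1 -> {for X, continuous cauchy_solution}.
Proof. by move=> sX; have [[[cu _] _ _] _] := fs_cauchy fsG s (datum_continuous cf f01); exact: cu. Qed.

Lemma cauchy_solution_slice_continuous tau : s < tau -> continuous (fun z => cauchy_solution (tau, z)).
Proof.
move=> stau z; apply: (@continuous_comp _ _ _ (fun z => (tau, z)) cauchy_solution).
  exact: pairr_continuous.
exact: cauchy_solution_continuous.
Qed.

(** After the time tau, the solution that starts at time s is a bounded solution
with continuous initial value at tau; uniqueness identifies it with the one
given by the kernel. *)
Lemma chapman_kolmogorov t x tau : s < tau -> tau < t ->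
  cauchy_solution (t, x) = \int[leb d]_z (Gamma t x tau z * cauchy_solution (tau, z)).
Proof.
move=> stau taut.
have sub : [set Y : spacetime | tau < Y.1] `<=` [set Y | s < Y.1].
  by move=> Y /=; exact: lt_trans.
have c01 z : 0 <= cauchy_solution (tau, z) <= 1 by exact: cauchy_solution01.
have dat := datum_continuous (cauchy_solution_slice_continuous stau) c01.
have [[su [M bu] _] _] := fs_cauchy fsG s (datum_continuous cf f01).
have bs : bounded_solution a tau (fun z => cauchy_solution (tau, z)) cauchy_solution.
  split.
  - exact: strong_solution_sub (measurable_future s) (measurable_future tau) sub su.
  - by exists M => X /sub; exact: bu.
  - by move=> z _; apply: cvg_within_filter; exact: cauchy_solution_continuous.
have [_ uniq] := fs_cauchy fsG tau dat.
exact: (uniq _ bs (t, x) taut).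
Qed.

Lemma cvg_cauchy_solution_initial z (tau : nat -> R) : (forall k, s < tau k) ->
  tau k @[k --> \oo] --> s -> cauchy_solution (tau k, z) @[k --> \oo] --> f z.
Proof.
move=> stau ctau; have [[_ _ ini] _] := fs_cauchy fsG s (datum_continuous cf f01).
move=> A nA; have := ini z (@cf z) A nA; rewrite /within/= => h.
have := @pairl_continuous R space z s _ h => h'.
have := ctau _ h'; rewrite /nbhs/= => -[k _ hk]; exists k => // m km.
by apply: (hk m km) => /=; exact: stau.
Qed.

End restarting.

(** * The bound at every time and for the precise representative *)

Section pointwise_bounds.
Context {R : realType} {d : nat}.
Local Notation space := 'rV[R]_d.
Local Notation spacetime := (R * 'rV[R]_d)%type.
Local Notation mu := (@lebesgue_measure R).
Variables (N kappa t : R) (x : space).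
Hypotheses (N_gt0 : 0 < N) (kappa_gt0 : 0 < kappa).
Local Notation G s y := (gaussian N kappa t x s y).

(** The power with real exponent d/2 is rewritten as a d-th power, whose continuity
and monotonicity are directly available. *)
Lemma gaussianE s y : s < t -> G s y = N * (Num.sqrt (t - s) ^+ d)^-1 *
    expR (- (kappa * (enorm (x - y) ^+ 2 * (t - s)^-1))).
Proof.
move=> st; rewrite /gaussian; congr (_ / _ * _).
have ts0 : 0 <= t - s by rewrite subr_ge0 ltW.
by rewrite -(powR12_sqrt ts0) -powR_mulrn ?powR_ge0// -powRrM mulrC.
Qed.

Lemma gaussian_ge0 s y : 0 <= G s y.
Proof. by rewrite /gaussian mulr_ge0 ?expR_ge0// divr_ge0 ?powR_ge0// ltW. Qed.

Lemma enorm_sqr_continuous : continuous (fun z : space => enorm (x - z) ^+ 2).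
Proof.
have cc i : continuous (fun z : space => (x ord0 i - z ord0 i) ^+ 2).
  have c1 : continuous (fun _ : space => x ord0 i) by exact: cst_continuous.
  have c2 : continuous (fun z : space => z ord0 i) by exact: coord_continuous.
  have c3 : continuous (fun z : space => x ord0 i - z ord0 i).
    by move=> z; exact: (cvgB (c1 z) (c2 z)).
  by move=> z; exact: (cvgM (c3 z) (c3 z)).
rewrite (_ : (fun z => _) = (fun z : space => \sum_i (x ord0 i - z ord0 i) ^+ 2)); last first.
  by apply/funext => z; rewrite enorm_sqr; apply: eq_bigr => i _; rewrite !mxE.
have gen (r : seq 'I_d) : continuous (fun z : space => \sum_(i <- r) (x ord0 i - z ord0 i) ^+ 2).
  elim: r => [|i r IH].
    have -> : (fun z : space => \sum_(i <- [::]) (x ord0 i - z ord0 i) ^+ 2) = (fun=> 0).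
      by apply/funext => z; rewrite big_nil.
    exact: cst_continuous.
  have -> : (fun z : space => \sum_(i <- i :: r) (x ord0 i - z ord0 i) ^+ 2) =
      (fun z => (x ord0 i - z ord0 i) ^+ 2 + \sum_(i <- r) (x ord0 i - z ord0 i) ^+ 2).
    by apply/funext => z; rewrite big_cons.
  by move=> z; exact: (cvgD (cc i z) (IH z)).
exact: gen.
Qed.

Lemma gaussian_continuous s y : s < t ->
  {for (s, y), continuous (fun Y : spacetime => G Y.1 Y.2)}.
Proof.
move=> st.
pose g (Y : spacetime) := N * (Num.sqrt (t - Y.1) ^+ d)^-1 *
    expR (- (kappa * (enorm (x - Y.2) ^+ 2 * (t - Y.1)^-1))).
have cfst : {for (s, y), continuous (fun Y : spacetime => Y.1)} by exact: cvg_fst.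
have csnd : {for (s, y), continuous (fun Y : spacetime => Y.2)} by exact: cvg_snd.
have cc (k : R) : {for (s, y), continuous (fun _ : spacetime => k)}.
  have c0 : continuous (fun _ : spacetime => k) by exact: cst_continuous.
  exact: (c0 (s, y)).
have cts : {for (s, y), continuous (fun Y : spacetime => t - Y.1)}.
  exact: (cvgB (cc t) cfst).
have csq : {for (s, y), continuous (fun Y : spacetime => Num.sqrt (t - Y.1) ^+ d)}.
  apply: (@continuous_comp _ _ _ (fun Y : spacetime => Num.sqrt (t - Y.1)) (fun p => p ^+ d)).
    by apply: (@continuous_comp _ _ _ (fun Y : spacetime => t - Y.1) Num.sqrt) => //; exact: sqrt_continuous.
  exact: exprn_continuous.
have cen : {for (s, y), continuous (fun Y : spacetime => enorm (x - Y.2) ^+ 2)}.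
  apply: (@continuous_comp _ _ _ (fun Y : spacetime => Y.2) (fun z : space => enorm (x - z) ^+ 2)) => //.
  exact: enorm_sqr_continuous.
have ts0 : t - (s, y).1 != 0 by rewrite gt_eqF// subr_gt0.
have sq0 : Num.sqrt (t - (s, y).1) ^+ d != 0.
  by rewrite expf_neq0// gt_eqF// sqrtr_gt0 subr_gt0.
have cin : {for (s, y), continuous (fun Y : spacetime => - (kappa * (enorm (x - Y.2) ^+ 2 * (t - Y.1)^-1)))}.
  exact: (cvgN (cvgM (cc kappa) (cvgM cen (cvgV ts0 cts)))).
have cex : {for (s, y), continuous (fun Y : spacetime => expR (- (kappa * (enorm (x - Y.2) ^+ 2 * (t - Y.1)^-1))))}.
  by apply: (@continuous_comp _ _ _ _ expR _ cin); exact: continuous_expR.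
have cg : {for (s, y), continuous g}.
  exact: (cvgM (cvgM (cc N) (cvgV sq0 csq)) cex).
have h2 : \forall Y \near (s, y), 0 < t - Y.1.
  by apply: (cvgr_gt _ cts); rewrite subr_gt0.
have e : \forall Y \near (s, y), g Y = G Y.1 Y.2.
  by apply: filterS h2 => Y; rewrite subr_gt0 => Yt; rewrite gaussianE.
move=> A; rewrite /= gaussianE// => nA.
by apply: filterS2 e (cg A nA) => Y gY AY; rewrite /= -gY.
Qed.

Lemma gaussian_le_dominator s r y : s < t -> s <= r -> r <= (s + t) / 2 ->
  G r y <= N * (Num.sqrt ((t - s) / 2) ^+ d)^-1 * expR (- (kappa / (t - s) * enorm (x - y) ^+ 2)).
Proof.
move=> st sr rm; have rt : r < t by lra.
rewrite gaussianE//; apply: ler_pM; rewrite ?expR_ge0 ?mulr_ge0 ?invr_ge0 ?exprn_ge0 ?sqrtr_ge0//.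
- exact: ltW.
- rewrite ler_wpM2l//; first exact: ltW.
  rewrite lef_pV2 ?posrE ?exprn_gt0 ?sqrtr_gt0//; try lra.
  by rewrite lerXn2r ?nnegrE ?sqrtr_ge0// ler_wsqrtr//; lra.
- rewrite ler_expR lerN2 -mulrA ler_wpM2l//; first exact: ltW.
  rewrite mulrC ler_wpM2l ?sqr_ge0// lef_pV2 ?posrE; lra.
Qed.

Lemma measurable_gaussian s : s < t -> measurable_fun setT (fun z => G s z).
Proof.
move=> st; rewrite (_ : (fun z => _) = (fun z : space => N * (Num.sqrt (t - s) ^+ d)^-1 *
    expR (- (kappa * (enorm (x - z) ^+ 2 * (t - s)^-1))))); last first.
  by apply/funext => z; rewrite gaussianE.
apply: measurable_funM => //; apply: measurableT_comp; first exact: measurable_expR.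
apply: measurable_funN; apply: measurable_funM => //; apply: measurable_funM => //.
by apply: measurable_continuous_rV; exact: enorm_sqr_continuous.
Qed.

(** A bound of the Gaussians at all times between s and the midpoint of [s,t]. *)
Definition dominator s (z : space) : R :=
  N * (Num.sqrt ((t - s) / 2) ^+ d)^-1 * expR (- (kappa / (t - s) * enorm (x - z) ^+ 2)).

Lemma dominator_ge0 s z : 0 <= dominator s z.
Proof. by rewrite /dominator mulr_ge0 ?expR_ge0// mulr_ge0 ?invr_ge0 ?exprn_ge0 ?sqrtr_ge0// ltW. Qed.

Lemma integrable_dominator s : s < t -> (leb d).-integrable setT (EFin \o dominator s).
Proof.
move=> st; have c0 : 0 < kappa / (t - s) by rewrite divr_gt0// subr_gt0.
have mexp : measurable_fun setT (fun z : space => (expR (- (kappa / (t - s) * enorm (x - z) ^+ 2)))%:E).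
  apply/measurable_EFinP; apply: measurableT_comp; first exact: measurable_expR.
  apply: measurable_funN; apply: measurable_funM => //.
  by apply: measurable_continuous_rV; exact: enorm_sqr_continuous.
rewrite (_ : _ \o _ = (fun z => (N * (Num.sqrt ((t - s) / 2) ^+ d)^-1)%:E *
   (expR (- (kappa / (t - s) * enorm (x - z) ^+ 2)))%:E)%E)//.
apply: integrableZl => //; apply/integrableP; split => //.
under eq_integral do rewrite gee0_abs ?lee_fin ?expR_ge0//.
exact: integral_gauss_lty.
Qed.

Lemma integrable_gaussian s r : s < t -> s <= r -> r <= (s + t) / 2 ->
  (leb d).-integrable setT (fun z => (G r z)%:E).
Proof.
move=> st sr rm; apply: (le_integrable _ _ _ (integrable_dominator st)) => //.
  by apply/measurable_EFinP; apply: measurable_gaussian; lra.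
move=> z _; rewrite lee_fin !ger0_norm ?dominator_ge0 ?gaussian_ge0//.
exact: gaussian_le_dominator.
Qed.

Variables (a : spacetime -> 'M[R]_d) (Gamma : R -> space -> R -> space -> R) (T : R).
Hypothesis fsG : fundamental_solution a Gamma.
Hypothesis aeG : {ae stleb d, forall Y, 0 < t - Y.1 < T -> Gamma t x Y.1 Y.2 <= G Y.1 Y.2}.

(** The bound for almost every (s,y) says nothing about a given time s. The
identity of Chapman and Kolmogorov moves the integral to times tau > s close to
s at which the bound is known, and the limit tau -> s only involves the
Gaussian and a Cauchy solution with continuous initial value, both continuous
at s. *)
Lemma integral_continuous_le s (f : space -> R) : 0 < t - s < T ->
  continuous f -> (forall z, 0 <= f z <= 1) ->
  \int[leb d]_z (Gamma t x s z * f z) <= \int[leb d]_z (G s z * f z).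
Proof.
move=> /andP[ts0 tsT] cf f01; have st : s < t by rewrite -subr_gt0.
pose good r := {ae leb d, forall z, 0 < t - r < T -> Gamma t x r z <= G r z}.
have aegood : {ae mu, forall r, good r} := ae_prod_slice aeG.
pose m := (t - s) / 2; have m0 : 0 < m by rewrite divr_gt0.
have ex k : exists r, s < r < s + m / k.+1%:R /\ good r.
  have [|r h1 h2] := ae_itv_exists (l := s) (r := s + m / k.+1%:R) _ aegood.
    by rewrite ltrDl divr_gt0.
  by exists r.
have [tau htau] := choice ex.
have stau k : s < tau k by have [/andP[]] := htau k.
have taum k : tau k <= (s + t) / 2.
  have [/andP[_ h] _] := htau k; apply: le_trans (ltW h) _.
  rewrite (_ : (s + t) / 2 = s + m); last by rewrite /m; field.
  by rewrite lerD2l ler_pdivrMr// ler_peMr ?ler1n// ltW.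
have taut k : tau k < t by have := taum k; lra.
have ctau : tau k @[k --> \oo] --> s.
  have hi : m * k.+1%:R^-1 @[k --> \oo] --> (0 : R).
    by rewrite -(mulr0 m); apply: cvgM; [exact: cvg_cst|exact: cvg_harmonic].
  apply/cvgrPdist_le => e e0; have /cvgrPdist_le/(_ _ e0) := hi.
  apply: filterS => k; rewrite sub0r normrN => mk.
  have [/andP[k1 k2] _] := htau k.
  rewrite ler0_norm; last by rewrite subr_le0 ltW.
  have := le_trans (ler_norm _) mk; move: k2; set q := m / _; clearbody q; lra.
pose u := cauchy_solution Gamma s f.
have u01 k z : 0 <= u (tau k, z) <= 1.
  by apply: (cauchy_solution01 fsG cf f01); exact: stau.
have cu k : continuous (fun z => u (tau k, z)).
  exact: (cauchy_solution_slice_continuous fsG cf f01 (stau k)).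
have iGu k : (leb d).-integrable setT (fun z => (G (tau k) z * u (tau k, z))%:E).
  apply: (le_integrable _ _ _ (integrable_gaussian st (ltW (stau k)) (taum k))) => //.
    apply/measurable_EFinP; apply: measurable_funM; first exact: measurable_gaussian.
    exact: measurable_continuous_rV.
  move=> z _; have /andP[u0 u1] := u01 k z.
  by rewrite lee_fin normrM ler_piMr// ger0_norm.
have step k : u (t, x) <= \int[leb d]_z (G (tau k) z * u (tau k, z)).
  rewrite /u (chapman_kolmogorov fsG cf f01 x (stau k) (taut k)) -/u.
  have iG := integrable_Gamma_mul fsG x (taut k) (measurable_continuous_rV (cu k)) (u01 k).
  rewrite -lee_fin /Rintegral !fineK//; try exact: integrable_fin_num.
  apply: ae_ge0_le_integral => //=.
  - by move=> z _; have /andP[u0 _] := u01 k z; rewrite lee_fin mulr_ge0// (fs_ge0 fsG).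
  - by have /integrableP[] := iG.
  - by move=> z _; have /andP[u0 _] := u01 k z; rewrite lee_fin mulr_ge0// gaussian_ge0.
  - by have /integrableP[] := iGu k.
  have [_ gk] := htau k.
  apply: (@filterS _ _ (ae_filter_ringOfSetsType (leb d)) _ _ _ gk) => z hz _.
  have /andP[u0 _] := u01 k z; rewrite lee_fin ler_wpM2r// hz//.
  by have := stau k; have := taut k => *; apply/andP; split; lra.
have iGf : (leb d).-integrable setT (fun z => (G s z * f z)%:E).
  have sm : s <= (s + t) / 2 by lra.
  apply: (le_integrable _ _ _ (integrable_gaussian st (lexx s) sm)) => //.
    apply/measurable_EFinP; apply: measurable_funM; first exact: measurable_gaussian.
    exact: measurable_continuous_rV.
  move=> z _; have /andP[u0 u1] := f01 z.
  by rewrite lee_fin normrM ler_piMr// ger0_norm.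
have cv : (\int[leb d]_z (G (tau k) z * u (tau k, z))%:E)%E @[k --> \oo]
    --> (\int[leb d]_z (G s z * f z)%:E)%E.
  apply: (@dominated_cvg _ _ _ (leb d) _ measurableT _ _ (EFin \o dominator s)) => //.
  - by move=> k; have /integrableP[] := iGu k.
  - move=> z _; apply: cvg_EFin; first by near=> k.
    apply: cvgM; last exact: (cvg_cauchy_solution_initial fsG cf f01).
    have cG : G r z @[r --> s] --> G s z.
      apply: (@continuous_comp _ _ _ (fun r => (r, z)) (fun Y : spacetime => G Y.1 Y.2)).
        exact: pairl_continuous.
      exact: gaussian_continuous.
    exact: (@cvg_comp _ _ _ tau (fun r => G r z) _ (nbhs s)).
  - exact: integrable_dominator.
  - move=> k z _; have /andP[u0 u1] := u01 k z.
    rewrite lee_fin normrM (ger0_norm u0) ger0_norm ?gaussian_ge0//.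
    apply: le_trans (ler_piMr (gaussian_ge0 _ _) u1) _.
    exact: gaussian_le_dominator (ltW (stau k)) (taum k).
rewrite -/(cauchy_solution Gamma s f (t, x)) -/u -lee_fin [X in (_ <= X)%E]fineK; last exact: integrable_fin_num iGf.
have cst_u : (fun=> (u (t, x))%:E) @ \oo --> (u (t, x))%:E by exact: cvg_cst.
apply: (lee_cvg_to cst_u cv); near=> k.
by rewrite -(fineK (integrable_fin_num measurableT (iGu k))) lee_fin; exact: step.
Unshelve. all: by end_near. Qed.

Lemma gaussian_near s y (e : R) : s < t -> 0 < e ->
  \forall Y \near (s, y), G Y.1 Y.2 <= G s y + e.
Proof.
move=> st e0; have /cvgrPdist_le/(_ _ e0) h := @gaussian_continuous s y st.
by apply: filterS h => Y; rewrite ler_norml => /andP[h1 _]; lra.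
Qed.

Lemma ae_gaussian_slice s : 0 < t - s < T ->
  {ae leb d, forall y, Gamma t x s y <= G s y}.
Proof.
move=> stT; have st : s < t by rewrite -subr_gt0; have /andP[] := stT.
have sm : s <= (s + t) / 2 by lra.
apply: (ae_le_of_continuous (fs_integrable fsG x st) (integrable_gaussian st (lexx s) sm)).
by move=> f cf f01; exact: integral_continuous_le.
Qed.

Lemma average_le (C : set spacetime) (u : spacetime -> R) (c V : R) :
  measurable C -> stleb d C = V%:E -> 0 < V -> 0 <= c ->
  measurable_fun C u -> (forall X, 0 <= u X) ->
  {ae stleb d, forall X, C X -> u X <= c} -> (average C u <= c%:E)%E.
Proof.
move=> mC CV V0 c0 mu0 u0 ae; rewrite /average CV inver gt_eqF//.
have le : (\int[stleb d]_(X in C) (u X)%:E <= (c * V)%:E)%E.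
  apply: (@le_trans _ _ (\int[stleb d]_(X in C) c%:E)%E).
    apply: ae_ge0_le_integral => //.
    - by move=> X _; rewrite lee_fin.
    - exact/measurable_EFinP.
  by rewrite integral_cst// CV.
apply: (@le_trans _ _ ((V^-1)%:E * (c * V)%:E)%E).
  by apply: lee_wpmul2l => //; rewrite lee_fin invr_ge0 ltW.
by rewrite -EFinM lee_fin mulrC mulfK// gt_eqF.
Qed.

(** A small cylinder at (s,y) lies after time s, hence in the slab where the
almost everywhere bound holds, and the Gaussian varies little on it. *)
Lemma precise_le_gaussian s y : (0 < d)%N -> 0 < t - s < T ->
  (precise Gamma t x s y <= (G s y)%:E)%E.
Proof.
move=> d0 /andP[ts0 tsT]; have st : s < t by rewrite -subr_gt0.
apply/lee_addgt0Pr => e e0.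
have [[U V] /= [nU nV] UV] := gaussian_near y st e0.
have /nbhs_ballP[r1 /= r10 hr1] := nU.
have [r2 r20 hr2] := nbhs_rVP nV.
pose rho := Num.min 1 (Num.min r1 (Num.min r2 (t - s))).
have rho0 : 0 < rho by rewrite /rho !lt_min ltr01 r10 r20 ts0.
pose av r := average (cylinder (s, y) r) (fun Y => Gamma t x Y.1 Y.2).
apply: (@le_trans _ _ (ereal_sup (av @` `]0, rho[%classic))).
  apply: ereal_inf_lbound; exists `]0, rho[%classic => //.
  near=> r; rewrite /= in_itv/=; apply/andP; split; near: r.
    exact: nbhs_right_gt.
  exact: nbhs_right_lt.
apply: ub_ereal_sup => _ [r /= + <-]; rewrite in_itv/= => /andP[r0].
rewrite !lt_min => /and4P[rl1 rr1 rr2 rts].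
have r2r : r ^+ 2 <= r by rewrite expr2 ler_piMl// ltW.
have mC : measurable (cylinder (s, y) r) by exact: measurable_cylinder.
have Ct : cylinder (s, y) r `<=` [set Y | Y.1 < t].
  by move=> Y [/= + _]; rewrite in_itv/= => /andP[_ h]; lra.
have near_C Y : cylinder (s, y) r Y -> G Y.1 Y.2 <= G s y + e.
  move=> [/=]; rewrite in_itv/= => /andP[h1 h2] h3; apply: UV; split => /=.
    by apply: hr1; rewrite /ball/= ltr_distlC; apply/andP; split; lra.
  apply: hr2 => i; apply: le_lt_trans rr2.
  rewrite distrC -(ler_pXn2r (n := 2))//; last by rewrite nnegrE ltW.
  rewrite -normrX ger0_norm ?sqr_ge0//; move: h3 => /(eballE _ _ r0) /ltW; apply: le_trans.
  by rewrite (bigD1 i)//= lerDl sumr_ge0// => j _; exact: sqr_ge0.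
have lfin := leb_eball_lty y r0; have lge := leb_eball_ge y d0 r0.
have VE := stleb_cylinder (s, y) r0.
have lE : leb d (eball y r) = (fine (leb d (eball y r)))%:E by rewrite fineK// ge0_fin_numE.
rewrite /= lE -EFinM in VE; rewrite lE lee_fin in lge.
apply: (average_le mC VE).
- rewrite mulr_gt0 ?exprn_gt0//; apply: lt_le_trans lge.
  by rewrite exprn_gt0// mulr_gt0// divr_gt0// ltr0n.
- by rewrite addr_ge0 ?gaussian_ge0// ltW.
- have [[mG _] _] := fs_adjoint fsG t x.
  by apply: measurable_funS mG => //; exact: measurable_past.
- by move=> Y; exact: fs_ge0 fsG _ _ _ _.
- apply: (@filterS _ _ (ae_filter_ringOfSetsType (stleb d)) _ _ _ aeG) => Y hY CY.
  apply: le_trans (near_C Y CY); apply: hY; have /= Yt := Ct _ CY.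
  move: CY => [/=]; rewrite in_itv/= => /andP[h1 h2] _; apply/andP; split; lra.
Unshelve. all: by end_near. Qed.

End pointwise_bounds.

(* The order of the quantifiers expresses the dependence of the constants:
   kappa depends on Lambda only, and N on d, lambda, Lambda, N0 only. *)
Theorem theorem1p3 (R : realType) (Lambda : R) (Lambda_gt0 : 0 < Lambda) :
  exists2 kappa : R, 0 < kappa &
  forall (d : nat) (lambda N0 : R),
    (0 < d)%N -> 0 < lambda -> lambda <= Lambda -> 0 < N0 ->
  exists2 N : R, 0 < N &
  forall (a : R * 'rV[R]_d -> 'M[R]_d) (T : R)
         (Gamma : R -> 'rV[R]_d -> R -> 'rV[R]_d -> R),
    elliptic lambda Lambda a ->
    0 < T ->
    local_boundedness a (Num.sqrt T) N0 ->
    fundamental_solution a Gamma ->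
  forall (t s : R) (x : 'rV[R]_d), 0 < t - s < T ->
    {ae leb d, forall y, Gamma t x s y <= gaussian N kappa t x s y} /\
    forall y, (precise Gamma t x s y <= (gaussian N kappa t x s y)%:E)%E.
Proof.
have kappa_gt0 : 0 < kappa0 Lambda by rewrite invr_gt0 mulr_gt0.
exists (kappa0 Lambda) => // d lambda N0 d_gt0 lambda_gt0 _ N0_gt0.
have N_gt0 : 0 < gauss_const (d := d) Lambda N0.
  by rewrite /gauss_const !mulr_gt0 ?expR_gt0// exprn_gt0// divr_gt0// ltr0n.
exists (gauss_const (d := d) Lambda N0) => // a T Gamma ella T_gt0 lbN0 fsG t s x stT.
have aeG := ae_gaussian t x d_gt0 Lambda_gt0 N0_gt0 T_gt0 lambda_gt0 ella fsG lbN0.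
split; first exact: (ae_gaussian_slice N_gt0 kappa_gt0 fsG aeG).
by move=> y; exact: (precise_le_gaussian N_gt0 fsG aeG).
Qed.
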